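(* Let $X$ be a reflexive Banach space with $1$-symmetric basis. A closed subspace $Y$ of $V_X^0$ contains an isomorphic copy of $c_0$ if and only if $C[0,1]\cap(\overline{Y}^{w^{*}}\setminus Y)\neq\emptyset$.
   Context: $X$ is a (infinite-dimensional, real) reflexive Banach space with a $1$-symmetric basis $(e_n)_n$, i.e. $\|\sum_n \epsilon_n a_n e_{\pi(n)}\|_X=\|\sum_n a_n e_n\|_X$ for all finitely supported real $(a_n)$, signs $\epsilon_n$ and permutations $\pi$ of $\mathbb{N}$. For $f:[0,1]\to\mathbb{R}$ and a partition $\mathcal{P}=\{0=t_0<\dots<t_n=1\}$ put $\alpha_X(f,\mathcal{P})=\|\sum_{i=0}^{n-1}(f(t_{i+1})-f(t_i))e_i\|_X$ (with $e_0,\dots,e_{n-1}$ any $n$ distinct basis vectors) and $\delta(\mathcal{P})=\max_i(t_{i+1}-t_i)$. Let $\|f\|_{V_X}=\sup_{\mathcal{P}}\alpha_X(f,\mathcal{P})$, $V_X=\{f:[0,1]\to\mathbb{R}: f(0)=0,\ \|f\|_{V_X}<\infty\}$ and $V_X^0=\{f\in V_X:\lim_{\varepsilon\to0}\sup\{\alpha_X(f,\mathcal{P}):\delta(\mathcal{P})\le\varepsilon\}=0\}$, Banach spaces with norm $\|\cdot\|_{V_X}$; $V_X^0\subset C[0,1]$. The bidual $(V_X^0)^{**}$ is identified isometrically with $V_X$: $F\in(V_X^0)^{**}$ corresponds to the function $t\mapsto F(\delta_t)$, where $\delta_t\in(V_X^0)^*$ is evaluation at $t\in[0,1]$. For $Y\subset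 V_X^0$, $\overline{Y}^{w^*}\subset V_X$ is the closure of $Y$ in the weak$^*$ topology $\sigma((V_X^0)^{**},(V_X^0)^{*})$. *)

(* Defs.v *)
From HB Require Import structures.
From mathcomp Require Import all_boot all_order all_algebra.
From mathcomp Require Import all_classical all_reals all_analysis.

Set Implicit Arguments.
Unset Strict Implicit.
Unset Printing Implicit Defensive.

Import Order.TTheory GRing.Theory Num.Theory.
Import numFieldNormedType.Exports.

Local Open Scope classical_set_scope.
Local Open Scope ring_scope.

Section sup_lemmas.
Context {R : realType}.

Lemma le_sup_range T (g : T -> R) M t :
  (forall s, g s <= M) -> g t <= sup (range g).
Proof. by move=> gM; apply: ub_le_sup; [exists M => _ [s _ <-] | exists t]. Qed.

Lemma sup_range_le T (g : T -> R) (t0 : T) M :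
  (forall s, g s <= M) -> sup (range g) <= M.
Proof. by move=> gM; apply: ge_sup; [exists (g t0); exists t0 | move=> _ [s _ <-]]. Qed.

Lemma sup_range_normZ T (g h : T -> R) (t0 : T) (a : R) M :
  (forall s, g s <= M) -> (forall s, h s = `|a| * g s) ->
  sup (range h) = `|a| * sup (range g).
Proof.
move=> gM hE; apply/eqP; rewrite eq_le; apply/andP; split.
  by apply: (sup_range_le t0) => s; rewrite hE ler_wpM2l// (le_sup_range _ gM).
have hM s : h s <= `|a| * M by rewrite hE ler_wpM2l.
have [a0|a0] := eqVneq a 0.
  rewrite a0 normr0 mul0r; apply: le_trans (le_sup_range t0 hM).
  by rewrite hE a0 normr0 mul0r.
rewrite mulrC -ler_pdivlMr ?normr_gt0//; apply: (sup_range_le t0) => s.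
by rewrite ler_pdivlMr ?normr_gt0// mulrC -hE (le_sup_range _ hM).
Qed.
End sup_lemmas.

Definition pack_linear {R : realType} (V W : normedModType R)
    (phi : V -> W) (lphi : linear phi) : {linear V -> W} :=
  HB.pack phi (GRing.isLinear.Build _ _ _ _ _ lphi).

Lemma linear_continuousP {R : realType} (V : normedModType R) (phi : V -> R^o) :
  linear phi ->
  continuous phi <-> exists C, forall x, `|phi x| <= C * `|x|.
Proof.
move=> lphi; split.
  move=> /(linear_bounded_continuous (pack_linear lphi)).
  move=> /linear_boundedP/pinfty_ex_gt0[C _ LC].
  by exists C.
move=> [C LC]; apply: (@bounded_linear_continuous _ _ _ (pack_linear lphi)).
apply/linear_boundedP; exists C; split=> [|r Cr x]; first exact: num_real.
by apply: (le_trans (LC x)); rewrite ler_wpM2r// ltW.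
Qed.

Section dual_def.
Context {R : realType} (V : normedModType R).

Definition dual_pred : {pred V -> R^o} :=
  mem [set phi : V -> R^o | linear phi /\ continuous phi].

Record dual := Dual { dual_fun :> V -> R^o ; _ : dual_fun \in dual_pred }.

HB.instance Definition _ := [isSub for dual_fun].
HB.instance Definition _ := [Choice of dual by <:].

Lemma dual_pred_submod : GRing.submod_closed dual_pred.
Proof.
split=> [|a phi psi /set_mem[lphi cphi] /set_mem[lpsi cpsi]]; apply/mem_set.
  by split=> [b x y|x]; [rewrite /= scaler0 addr0 | exact: cst_continuous].
split=> [b x y|x].
  by rewrite !fctE lphi lpsi !scalerDr !scalerA mulrC addrACA.
by apply: cvgD; [apply: cvgZl_tmp; exact: cphi | exact: cpsi].
Qed.

HB.instance Definition _ :=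
  GRing.isSubmodClosed.Build R (V -> R^o) dual_pred dual_pred_submod.
HB.instance Definition _ := [SubChoice_isSubLmodule of dual by <:].

Lemma dual_linear (phi : dual) : linear phi.
Proof. by case: phi => f fP; have [] := set_mem fP. Qed.

Lemma dual_bounded (phi : dual) :
  exists2 C, 0 <= C & forall x, `|phi x| <= C * `|x|.
Proof.
case: phi => f fP; have [lf /(linear_continuousP lf)[C fC]] := set_mem fP.
exists `|C| => // x; apply: (le_trans (fC x)).
by rewrite ler_wpM2r// ler_norm.
Qed.

Definition dual_norm (phi : dual) : R :=
  sup [set `|phi x| | x in [set x : V | `|x| <= 1]].

Lemma dual_norm_ub (phi : dual) x : `|x| <= 1 -> `|phi x| <= dual_norm phi.
Proof.
move=> x1; apply: ub_le_sup; last by exists x.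
have [C C0 hC] := dual_bounded phi; exists C => _ [y /= y1 <-].
by rewrite (le_trans (hC y))// ler_piMr.
Qed.

Lemma dual_norm_le (phi : dual) M :
  (forall x, `|x| <= 1 -> `|phi x| <= M) -> dual_norm phi <= M.
Proof.
move=> hM; apply: ge_sup; last by move=> _ [x /= x1 <-]; exact: hM.
by exists `|phi 0|; exists 0 => //=; rewrite normr0.
Qed.

Lemma dualZ (phi : dual) a x : phi (a *: x) = a *: phi x.
Proof.
have phi0 : phi 0 = 0.
  have := dual_linear phi 1 0 0; rewrite !scale1r addr0 => /eqP.
  by rewrite -subr_eq subrr eq_sym => /eqP.
by have := dual_linear phi a x 0; rewrite !addr0 phi0 addr0.
Qed.

Lemma dual_normD (phi psi : dual) :
  dual_norm (phi + psi) <= dual_norm phi + dual_norm psi.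
Proof.
apply: dual_norm_le => x x1; rewrite (le_trans (ler_normD _ _))//.
by rewrite lerD// dual_norm_ub.
Qed.

Lemma dual_normZ (a : R) (phi : dual) :
  dual_norm (a *: phi) = `|a| * dual_norm phi.
Proof.
have le1 (b : R) (psi : dual) : dual_norm (b *: psi) <= `|b| * dual_norm psi.
  apply: dual_norm_le => x x1; rewrite [_ x]/(b * psi x) normrM.
  by rewrite ler_wpM2l// dual_norm_ub.
apply/eqP; rewrite eq_le le1/=; have [->|a0] := eqVneq a 0.
  rewrite normr0 mul0r; apply: (le_trans (normr_ge0 _)).
  by apply: (@dual_norm_ub _ 0); rewrite normr0.
rewrite -ler_pdivlMl ?normr_gt0// -normfV.
by apply: (le_trans _ (le1 _ _)); rewrite scalerA mulVf// scale1r.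
Qed.

Lemma dual_norm0_eq0 (phi : dual) : dual_norm phi = 0 -> phi = 0.
Proof.
move=> phi0; apply/val_inj/funext => x /=.
have [->|x0] := eqVneq x 0; first by rewrite -(scale0r 0) dualZ scale0r.
have : `|phi (`|x|^-1 *: x)| <= 0.
  by rewrite -phi0 dual_norm_ub// normrZ normfV normr_id mulVf ?normr_eq0.
rewrite normr_le0 dualZ scaler_eq0 invr_eq0 normr_eq0 (negbTE x0)/=.
by move=> /eqP.
Qed.

HB.instance Definition _ := @Lmodule_isNormed.Build R dual
  dual_norm dual_normD dual_normZ dual_norm0_eq0.

Lemma bidual_emb_subproof (x : V) :
  (fun phi : dual => phi x) \in [set F : dual -> R^o | linear F /\ continuous F].
Proof.
have l : linear (fun phi : dual => phi x : R^o) by [].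
apply/mem_set; split=> //; apply/(linear_continuousP l).
exists `|x| => phi; have [->|x0] := eqVneq x 0.
  by rewrite -(scale0r 0) dualZ !scale0r !normr0 mul0r.
rewrite -ler_pdivrMl ?normr_gt0// -{1}[`|x|]normr_id -normfV -normrM.
rewrite -[_ * _]/(`|x|^-1 *: phi x) -dualZ.
by apply: dual_norm_ub; rewrite normrZ normfV normr_id mulVf ?normr_eq0.
Qed.

End dual_def.

Definition bidual_emb {R : realType} {V : normedModType R} (x : V) :
  dual (dual V) := Dual (bidual_emb_subproof x).

Definition reflexive_space {R : realType} (V : normedModType R) :=
  range (@bidual_emb R V) = setT.

(* The dual V^* with the weak* topology sigma(V^*, V), i.e. the topology of
   pointwise convergence on V; the type [dual V] itself carries the norm
   topology. *)
Definition weak_star {R : realType} (V : normedModType R) :=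
  initial_topology (fun phi : dual V => (phi : V -> R^o) : {ptws V -> R^o}).
HB.instance Definition _ {R : realType} (V : normedModType R) :=
  Topological.on (weak_star V).

Section c0_def.
Context (R : realType).

Definition c0_pred : {pred nat -> R^o} :=
  mem [set u : nat -> R^o | u @ \oo --> (0 : R^o)].

Record c0 := C0 { c0_fun :> nat -> R^o ; _ : c0_fun \in c0_pred }.

HB.instance Definition _ := [isSub for c0_fun].
HB.instance Definition _ := [Choice of c0 by <:].

Lemma c0_pred_submod : GRing.submod_closed c0_pred.
Proof.
split=> [|a u v /set_mem u0 /set_mem v0]; apply/mem_set; first exact: cvg_cst.
rewrite /= -[X in _ --> X]addr0 -[X in _ --> X + _](scaler0 _ a).
by apply: cvgD => //; exact: cvgZl_tmp.
Qed.

HB.instance Definition _ :=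
  GRing.isSubmodClosed.Build R (nat -> R^o) c0_pred c0_pred_submod.
HB.instance Definition _ := [SubChoice_isSubLmodule of c0 by <:].

Definition c0_norm (u : c0) : R := sup (range (fun n => `|u n|)).

Lemma c0_bounded (u : c0) : exists M, forall n, `|u n| <= M.
Proof.
case: u => u up; have u0 : u @ \oo --> (0 : R^o) by exact: set_mem up.
have /cvg_seq_bounded[M [_ uM]] : cvgn (u : (R^o)^nat) by apply/cvg_ex; exists 0.
by exists (M + 1) => n; apply: uM => //; rewrite ltrDl.
Qed.

Lemma c0_normD (u v : c0) : c0_norm (u + v) <= c0_norm u + c0_norm v.
Proof.
have [[M uM] [N vN]] := (c0_bounded u, c0_bounded v).
apply: (sup_range_le 0%N) => n; rewrite (le_trans (ler_normD _ _))// lerD//.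
  exact: (le_sup_range n uM).
exact: (le_sup_range n vN).
Qed.

Lemma c0_normZ (a : R) (u : c0) : c0_norm (a *: u) = `|a| * c0_norm u.
Proof.
have [M uM] := c0_bounded u.
by apply: (sup_range_normZ 0%N uM) => n; rewrite normrM.
Qed.

Lemma c0_norm0_eq0 (u : c0) : c0_norm u = 0 -> u = 0.
Proof.
move=> u0; apply/val_inj/funext => n /=; apply/eqP; rewrite -normr_le0 -u0.
by have [M uM] := c0_bounded u; exact: (le_sup_range n uM).
Qed.

HB.instance Definition _ := @Lmodule_isNormed.Build R c0
  c0_norm c0_normD c0_normZ c0_norm0_eq0.

End c0_def.

Definition contains_copy {R : realType} (E V : normedModType R) (Y : set V) :=
  exists T : {linear E -> V}, range T `<=` Y /\
    exists c C : R, 0 < c /\ forall u, c * `|u| <= `|T u| <= C * `|u|.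

Definition closed_subspace {R : realType} (V : normedModType R) (Y : set V) :=
  [/\ Y 0, forall (a : R) x y, Y x -> Y y -> Y (a *: x + y) & closed Y].

Definition schauder_basis {R : realType} (X : normedModType R) (e : nat -> X) :=
  forall x : X, exists! a : nat -> R, series (fun n => a n *: e n) @ \oo --> x.

(* Every finitely supported sequence vanishes outside some [0, n[. *)
Definition symmetric1 {R : realType} (X : normedModType R) (e : nat -> X) :=
  forall (n : nat) (a : nat -> R) (s : nat -> bool) (p : nat -> nat),
    bijective p ->
    `|\sum_(i < n) ((-1) ^+ s i * a i) *: e (p i)| = `|\sum_(i < n) a i *: e i|.

Record symmetric_basis {R : realType} (X : normedModType R) := SymmetricBasis {
  basis_vec :> nat -> X ;
  basis_schauder : schauder_basis basis_vec ;
  basis_symmetric : symmetric1 basis_vec }.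

Section unit_interval.
Context (R : realType).

Definition unit_itv : set R := `[0, 1]%classic.

Lemma unit_itv0_subproof : (0 : R) \in unit_itv.
Proof. by apply/mem_set; rewrite /unit_itv/= in_itv/= lexx ler01. Qed.

Definition unit_itv0 : unit_itv := SigSub unit_itv0_subproof.

Lemma clamp_subproof (x : R) : Num.max 0 (Num.min x 1) \in unit_itv.
Proof.
apply/mem_set; rewrite /unit_itv/= in_itv/= le_max lexx/= ge_max ler01/=.
by rewrite ge_min lexx orbT.
Qed.

Definition clamp (x : R) : unit_itv := SigSub (clamp_subproof x).

Lemma clampE (x : R) : 0 <= x <= 1 -> \val (clamp x) = x.
Proof. by move=> /andP[x0 x1] /=; rewrite (min_idPl x1) (max_idPr x0). Qed.

(* The values of the point function beyond the index [psize] are irrelevant. *)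
Record partition := Partition {
  psize : nat ;
  ppoint :> nat -> unit_itv ;
  partition_first : \val (ppoint 0%N) = 0 ;
  partition_last : \val (ppoint psize) = 1 ;
  partition_lt : forall i, (i < psize)%N ->
    \val (ppoint i) < \val (ppoint i.+1) }.

Definition mesh (p : partition) : R :=
  \big[Num.max/0]_(i < psize p) (\val (p i.+1) - \val (p i)).

Lemma uniform_partition_subproof (n : nat) :
  [/\ \val (clamp (0%N%:R / n.+1%:R)) = 0, \val (clamp (n.+1%:R / n.+1%:R)) = 1
    & forall i, (i < n.+1)%N -> \val (clamp (i%:R / n.+1%:R)) = i%:R / n.+1%:R /\
        \val (clamp (i.+1%:R / n.+1%:R)) = i.+1%:R / n.+1%:R].
Proof.
have E i : (i <= n.+1)%N -> \val (clamp (i%:R / n.+1%:R)) = i%:R / n.+1%:R.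
  by move=> i_n; rewrite clampE// divr_ge0//= ler_pdivrMr ?ltr0n// mul1r ler_nat.
split; [by rewrite E// mul0r | by rewrite E// divff | ].
by move=> i i_n; rewrite !E// ltnW.
Qed.

Lemma ex_partition (eps : R) : 0 < eps -> exists p, mesh p <= eps.
Proof.
move=> eps0; set n := Num.truncn eps^-1.
have [p0 p1 E] := uniform_partition_subproof n.
have lt i : (i < n.+1)%N -> \val (clamp (i%:R / n.+1%:R)) <
    \val (clamp (i.+1%:R / n.+1%:R)).
  by move=> /E[-> ->]; rewrite ltr_pM2r ?invr_gt0 ?ltr0n// ltr_nat.
exists (Partition p0 p1 lt); apply/bigmax_leP; split=> [|i _]; first exact: ltW.
have [-> ->] := E _ (ltn_ord i); rewrite -mulrBl -natrB// subSnn mul1r.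
by rewrite -[eps]invrK lef_pV2 ?posrE ?ltr0n ?invr_gt0// ltW// truncnS_gt.
Qed.

Lemma three_points (t : unit_itv) : 0 < \val t < 1 ->
  exists p : partition, [/\ psize p = 2, p 0%N = unit_itv0 & p 1%N = t].
Proof.
move=> /andP[t0 t1].
pose q i := if i == 0%N then unit_itv0 else if i == 1%N then t else clamp 1.
have q2 : \val (q 2%N) = 1 by rewrite clampE// lexx ler01.
have lt i : (i < 2)%N -> \val (q i) < \val (q i.+1).
  by case: i => [|[|]]// _; rewrite q2.
by exists (@Partition 2 q erefl q2 lt).
Qed.

Lemma two_points (t : unit_itv) : \val t = 1 ->
  exists p : partition, [/\ psize p = 1, p 0%N = unit_itv0 & p 1%N = t].
Proof.
move=> t1; pose q i := if i == 0%N then unit_itv0 else t.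
have lt i : (i < 1)%N -> \val (q i) < \val (q i.+1).
  by case: i => // _; rewrite /q/= t1 ltr01.
by exists (@Partition 1 q erefl t1 lt).
Qed.

End unit_interval.
Arguments unit_itv R : clear implicits.
Arguments unit_itv0 {R}.

Section VX_def.
Context {R : realType} {X : normedModType R} (e : symmetric_basis X).
Implicit Types (f g : unit_itv R -> R^o) (p : partition R).

Definition alpha f p : R :=
  `|\sum_(i < psize p) (f (p i.+1) - f (p i)) *: e i|.

Definition variation f : \bar R := ereal_sup [set (alpha f p)%:E | p in setT].

Definition VX : set (unit_itv R -> R^o) :=
  [set f | f unit_itv0 = 0 /\ (variation f < +oo)%E].

Definition mesh_variation f (eps : R) : \bar R :=
  ereal_sup [set (alpha f p)%:E | p in [set p | mesh p <= eps]].

Definition VX0_pred : {pred unit_itv R -> R^o} :=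
  mem [set f | VX f /\ mesh_variation f eps @[eps --> 0^'+] --> 0%E].

Record VX0 := MkVX0 { VX0_fun :> unit_itv R -> R^o ; _ : VX0_fun \in VX0_pred }.

HB.instance Definition _ := [isSub for VX0_fun].
HB.instance Definition _ := [Choice of VX0 by <:].

Lemma alphaD a f g p :
  alpha (a *: f + g) p <= `|a| * alpha f p + alpha g p.
Proof.
rewrite /alpha -normrZ scaler_sumr (le_trans _ (ler_normD _ _))//.
rewrite -big_split/= le_eqVlt; apply/orP; left; apply/eqP; congr `|_|.
apply: eq_bigr => i _; rewrite scalerA -scalerDl; congr (_ *: _).
rewrite !fctE; rewrite -[a *: f _]/(a * _) -[a *: f (p i)]/(a * _).
by rewrite mulrBr opprD addrACA.
Qed.

Lemma variation_lty f :
  (variation f < +oo)%E <-> exists M, forall p, alpha f p <= M.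
Proof.
split=> [fy|[M fM]]; last first.
  apply: (@le_lt_trans _ _ M%:E); last exact: ltry.
  by apply: ge_ereal_sup => _ [p _ <-]; rewrite lee_fin.
have [p0 _] := @ex_partition R 1 ltr01.
have ub p : ((alpha f p)%:E <= variation f)%E.
  by apply: ereal_sup_ubound; exists p.
case E : (variation f) fy => [r| |]// _.
  by exists r => p; rewrite -lee_fin -E.
by have := ub p0; rewrite E.
Qed.

Lemma mesh_variation_cvg0 f :
  mesh_variation f eps @[eps --> 0^'+] --> 0%E <->
  forall M, 0 < M -> \forall eps \near 0^'+, forall p, mesh p <= eps ->
    alpha f p <= M.
Proof.
have ub p eps : mesh p <= eps -> ((alpha f p)%:E <= mesh_variation f eps)%E.
  by move=> pe; apply: ereal_sup_ubound; exists p.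
split=> [f0 M M0|f0].
  have /fine_cvgP[fin /cvgr0Pnorm_le/(_ M M0)] := f0.
  apply: filterS2 fin => eps fin fM p /ub; rewrite -(fineK fin) lee_fin => pM.
  by apply: (le_trans pM); apply: le_trans fM; exact: ler_norm.
have bnd M : 0 < M -> \forall eps \near 0^'+,
    (0 <= mesh_variation f eps <= M%:E)%E.
  move=> M0; near=> eps; apply/andP; split.
    have eps0 : 0 < eps by near: eps; exact: nbhs_right_gt.
    have [p pe] := ex_partition eps0.
    by apply: le_trans (ub _ _ pe); rewrite lee_fin; exact: normr_ge0.
  apply: ge_ereal_sup => _ [p /= pe <-]; rewrite lee_fin; move: p pe.
  by near: eps; exact: f0.
apply/fine_cvgP; split.
  apply: filterS (bnd _ ltr01) => eps /andP[f_ge0 f_le1].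
  by rewrite ge0_fin_numE// (le_lt_trans f_le1)// ltry.
apply/cvgr0Pnorm_le => M M0; apply: filterS (bnd _ M0) => eps /andP[f_ge0 f_le].
have fin : mesh_variation f eps \is a fin_num.
  by rewrite ge0_fin_numE// (le_lt_trans f_le)// ltry.
by rewrite /= ger0_norm ?fine_ge0// -lee_fin fineK.
Unshelve. all: by end_near. Qed.

Lemma alpha0 p : alpha 0 p = 0.
Proof. by rewrite /alpha big1 ?normr0// => i _; rewrite subrr scale0r. Qed.

Lemma VX0_pred_submod : GRing.submod_closed VX0_pred.
Proof.
split=> [|a f g /set_mem[[f0 /variation_lty[M fM]] /mesh_variation_cvg0 fc]
               /set_mem[[g0 /variation_lty[N gN]] /mesh_variation_cvg0 gc]];
  apply/mem_set; split.
- by split=> //; apply/variation_lty; exists 0 => p; rewrite alpha0.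
- by apply/mesh_variation_cvg0 => M M0; apply: nearW => eps p _; rewrite alpha0 ltW.
- split; first by rewrite !fctE f0 g0 scaler0 addr0.
  apply/variation_lty; exists (`|a| * M + N) => p.
  by rewrite (le_trans (alphaD _ _ _ _))// lerD// ler_wpM2l.
- apply/mesh_variation_cvg0 => K K0.
  have a0 : 0 < `|a| + 1 by rewrite ltr_wpDl.
  have K1 : 0 < K / 2 / (`|a| + 1) by rewrite !divr_gt0.
  have K2 : 0 < K / 2 by rewrite divr_gt0.
  near=> eps => p pe; rewrite (le_trans (alphaD _ _ _ _))// [leRHS]splitr lerD//.
    apply: (@le_trans _ _ ((`|a| + 1) * alpha f p)).
      by apply: ler_wpM2r; [exact: normr_ge0 | rewrite lerDl].
    by rewrite mulrC -ler_pdivlMr//; move: p pe; near: eps; exact: fc.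
  by move: p pe; near: eps; exact: gc.
Unshelve. all: by end_near. Qed.

HB.instance Definition _ :=
  GRing.isSubmodClosed.Build R (unit_itv R -> R^o) VX0_pred VX0_pred_submod.
HB.instance Definition _ := [SubChoice_isSubLmodule of VX0 by <:].

Definition VX_norm f : R := fine (variation f).

Lemma VX_normE f : (variation f < +oo)%E -> VX_norm f = sup (range (alpha f)).
Proof.
move=> /variation_lty[M fM]; rewrite /VX_norm /variation -image_comp.
have [p0 _] := @ex_partition R 1 ltr01.
by rewrite ereal_sup_EFin//; [exists M => _ [p _ <-] | exists (alpha f p0); exists p0].
Qed.

Lemma VX0_variation (f : VX0) : (variation f < +oo)%E.
Proof. by case: f => f fP; have [[]] := set_mem fP. Qed.

Lemma VX0_at0 (f : VX0) : f unit_itv0 = 0.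
Proof. by case: f => f fP; have [[]] := set_mem fP. Qed.

Lemma alpha_le_norm (f : VX0) p : alpha f p <= VX_norm f.
Proof.
rewrite VX_normE ?VX0_variation//.
by have /variation_lty[M fM] := VX0_variation f; exact: le_sup_range fM.
Qed.

Lemma VX_norm_le (f : VX0) M : (forall p, alpha f p <= M) -> VX_norm f <= M.
Proof.
move=> fM; rewrite VX_normE ?VX0_variation//.
by have [p0 _] := @ex_partition R 1 ltr01; exact: sup_range_le.
Qed.

Lemma VX0_normD (f g : VX0) : VX_norm (f + g : VX0) <= VX_norm f + VX_norm g.
Proof.
apply: VX_norm_le => p; have := alphaD 1 f g p.
rewrite scale1r normr1 mul1r => /le_trans; apply.
by rewrite lerD// alpha_le_norm.
Qed.

Lemma VX0_normZ (a : R) (f : VX0) : VX_norm (a *: f : VX0) = `|a| * VX_norm f.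
Proof.
rewrite !VX_normE ?VX0_variation//.
have /variation_lty[M fM] := VX0_variation f.
have [p0 _] := @ex_partition R 1 ltr01.
apply: (sup_range_normZ p0 fM) => p; rewrite /alpha -normrZ scaler_sumr.
by congr `|_|; apply: eq_bigr => i _; rewrite scalerA mulrBr.
Qed.

Lemma basis0_neq0 : e 0%N != 0.
Proof.
apply/eqP => e0; have [a [_ aU]] := basis_schauder e 0.
have c0 (b : nat -> R) : (forall n, (0 < n)%N -> b n = 0) ->
    series (fun n => b n *: e n) @ \oo --> (0 : X).
  move=> b0; rewrite (_ : series _ = fun=> 0); first exact: cvg_cst.
  apply/funext => n; rewrite /series/= big1_seq// => -[|i] _.
    by rewrite e0 scaler0.
  by rewrite b0// scale0r.
have E1 := aU _ (c0 (fun=> 0) (fun _ _ => erefl)).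
have /aU : series (fun n => (n == 0%N)%:R *: e n) @ \oo --> (0 : X).
  by apply: c0 => -[].
by rewrite E1 => /(congr1 (@^~ 0%N))/eqP; rewrite /= eq_sym oner_eq0.
Qed.

Lemma basis_le2 (a b : R) : `|a| * `|e 0%N| <= `|a *: e 0%N + b *: e 1%N|.
Proof.
have := @basis_symmetric _ _ e 2 (fun i => if i == 0%N then a else b)
  (fun i => i == 1%N) id (Bijective (fun=> erefl) (fun=> erefl)).
rewrite !big_ord_recl !big_ord0 /= !addr0 expr0 expr1 mul1r mulN1r scaleNr => E.
rewrite -(@ler_pM2l _ 2)// -{1}[2]normr_nat mulrA -normrM -normrZ.
rewrite [leRHS]mulr_natl mulr2n.
apply: le_trans (_ : `|a *: e 0%N - b *: e 1%N| + `|a *: e 0%N + b *: e 1%N| <= _).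
  apply: le_trans (ler_normD _ _).
  by rewrite addrACA addNr addr0 -scalerDl -mulr2n mulr_natl.
by rewrite lerD2r E.
Qed.

Lemma VX0_eval_le (f : VX0) t : `|f t| * `|e 0%N| <= VX_norm f.
Proof.
have : 0 <= \val t <= 1 by have := set_mem (valP t); rewrite /unit_itv/= in_itv.
rewrite le_eqVlt => /andP[/predU1P[t0 _|t0]].
  have -> : t = unit_itv0 by exact: val_inj.
  have [p _] := @ex_partition R 1 ltr01.
  rewrite VX0_at0 normr0 mul0r; apply: le_trans (alpha_le_norm f p).
  exact: normr_ge0.
rewrite le_eqVlt => /predU1P[/two_points[p [pn p0 pt]]|t1].
  apply: le_trans (alpha_le_norm f p); rewrite /alpha pn big_ord_recl big_ord0.
  by rewrite addr0 p0 pt VX0_at0 subr0 normrZ.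
have [|p [pn p0 pt]] := @three_points R t; first by rewrite t0.
apply: le_trans (alpha_le_norm f p); rewrite /alpha pn !big_ord_recl big_ord0.
rewrite addr0 p0 pt VX0_at0 subr0; exact: basis_le2.
Qed.

Lemma VX0_norm0_eq0 (f : VX0) : VX_norm f = 0 -> f = 0.
Proof.
move=> f0; apply/val_inj/funext => t /=; have := VX0_eval_le f t.
by rewrite f0 pmulr_lle0 ?normr_gt0 ?basis0_neq0// normr_le0 => /eqP.
Qed.

HB.instance Definition _ := @Lmodule_isNormed.Build R VX0
  VX_norm VX0_normD VX0_normZ VX0_norm0_eq0.

Lemma eval_at_subproof (t : unit_itv R) :
  (fun f : VX0 => f t) \in [set phi : VX0 -> R^o | linear phi /\ continuous phi].
Proof.
have l : linear (fun f : VX0 => f t : R^o) by [].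
apply/mem_set; split=> //; apply/(linear_continuousP l).
exists (`|e 0%N|^-1) => f.
by rewrite ler_pdivlMl ?normr_gt0 ?basis0_neq0// mulrC; exact: VX0_eval_le.
Qed.

Definition eval_at (t : unit_itv R) : dual VX0 := Dual (eval_at_subproof t).

(* The isometric identification of (V_X^0)^** with V_X. *)
Definition bidual_fun (F : dual (dual VX0)) : unit_itv R -> R^o :=
  fun t => F (eval_at t).

Definition weak_star_closure (Y : set VX0) : set (unit_itv R -> R^o) :=
  bidual_fun @` @closure (weak_star (dual VX0)) (bidual_emb @` Y).

End VX_def.

Definition C01 (R : realType) : set (unit_itv R -> R^o) :=
  [set f | continuous f].
Arguments C01 R : clear implicits.

(* Main.v *)
Require Import Defs.
From mathcomp Require Import all_boot all_order all_algebra.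
From mathcomp Require Import all_classical all_reals all_analysis.
From mathcomp Require Import zify ring lra.

(** Writing V for V_X^0, consider pairs of a partition and a functional of norm at
    most 1 on X; they norm V, and as X is reflexive, any sequence of such pairs has a
    cluster point whose tails are small.  Simons' inequality then shows that a bounded
    sequence in V tending uniformly to 0 has convex combinations tending to 0 in norm,
    and more generally that if a bounded sequence y_k in V tends uniformly to a
    continuous f of finite variation, then suitable convex combinations of the y_k are
    close, uniformly over all partitions, to the corresponding combinations of f with
    its increments over intervals shorter than a cutoff h_k removed.

    If F in the weak* closure of Y induces a continuous f, then f is a uniform limit of
    a bounded sequence in Y: by Hahn-Banach it suffices to evaluate F on functionals
    bounded for the supremum norm, and these are norm limits of combinations of point
    evaluations, since X contains neither c_0 nor l_1.  If f is in V, then f is in Y by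
    the first statement.  Otherwise successive blocks of convex combinations differ by
    increments of f over disjoint ranges of interval lengths, and by unconditionality
    these differences span c_0.

    Conversely, the image u_n of the unit basis of c_0 tends to 0 uniformly, as X does
    not contain c_0, so that the sum of a sparse subsequence is a continuous function.
    If it were in Y, convex combinations of its partial sums would converge in norm,
    which fails in c_0. *)

Set Implicit Arguments.
Unset Strict Implicit.
Unset Printing Implicit Defensive.

Import Order.TTheory GRing.Theory Num.Theory.
Import numFieldNormedType.Exports.

Local Open Scope classical_set_scope.
Local Open Scope ring_scope.

(** * The Hahn-Banach theorem *)

(** Simons' inequality is used with approximate maximizers, so that no partition attaining the norm
    has to be found. What stands in for compactness is an ordering: by symmetry of the basis the
    intervals of a partition may be listed by decreasing length, and from position K on they are
    then no longer than 1/K, whatever the partition. The first K coordinates of the functionals have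
    cluster points, and reflexivity makes the tail of the limit functional small.

    The cutoffs h_k answer the obstacle that f, unlike each y_k, need not have small variation on
    fine partitions. On intervals shorter than h_k only the increment of y_k is left, which is
    harmless because y_k lies in V; and the removed increments of f are individually small by
    uniform continuity.

    A functional bounded for the supremum norm is morally a measure. It is discretized through a
    partition whose open cells carry little of it, possible atoms being absorbed by the partition
    points; interpolation at those points then turns it into point evaluations. *)

Section hahn_banach.
Context {R : realType} {V : lmodType R}.
Implicit Types (p q : V -> R) (x y : V).

Definition sublinear p :=
  (forall x y, p (x + y) <= p x + p y) /\
  (forall a x, 0 <= a -> p (a *: x) = a * p x).

Lemma sublinear0 p : sublinear p -> p 0 = 0.
Proof. by move=> [_ /(_ 0 0 (lexx _))]; rewrite scale0r mul0r. Qed.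

Lemma sublinear_ge p x : sublinear p -> - p (- x) <= p x.
Proof.
move=> sp; have := sp.1 x (- x).
by rewrite subrr (sublinear0 sp) -lerBlDr sub0r.
Qed.

(** For sublinear [p] this is a sublinear minorant of [p] whose value at [- y] is at most [- p y];
    hence every linear functional below it takes the value [p y] at [y]. *)
Definition ray_inf p y x : R := inf [set p (x + t *: y) - t * p y | t in [set t | 0 <= t]].

Lemma ray_inf_lb p y x t : sublinear p -> 0 <= t ->
  ray_inf p y x <= p (x + t *: y) - t * p y.
Proof.
move=> [pD pZ] t0; apply: ge_inf; last by exists t.
exists (- p (- x)) => _ [s /= s0 <-]; rewrite lerBrDr addrC lerBlDr -pZ//.
rewrite (le_trans _ (pD _ _))//.
by rewrite addrAC subrr add0r.
Qed.

Lemma ray_inf_ge p y x m :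
  (forall t, 0 <= t -> m <= p (x + t *: y) - t * p y) -> m <= ray_inf p y x.
Proof.
move=> h; apply: lb_le_inf; last by move=> _ [t /= t0 <-]; exact: h.
by exists (p (x + 0 *: y) - 0 * p y); exists 0 => /=.
Qed.

Lemma ray_inf_le p y x : sublinear p -> ray_inf p y x <= p x.
Proof.
move=> sp; apply: (le_trans (ray_inf_lb y x sp (lexx 0))).
by rewrite scale0r addr0 mul0r subr0.
Qed.

Lemma ray_inf_sublinear p y : sublinear p -> sublinear (ray_inf p y).
Proof.
move=> sp; have [pD pZ] := sp.
have le1 a x : 0 < a -> a * ray_inf p y x <= ray_inf p y (a *: x).
  move=> a0; apply: ray_inf_ge => t t0.
  rewrite mulrC -ler_pdivlMr//.
  apply: le_trans (ray_inf_lb y x sp (_ : 0 <= t / a)) _.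
    by rewrite divr_ge0// ltW.
  rewrite ler_pdivlMr//.
  have -> : a *: x + t *: y = a *: (x + (t / a) *: y).
    by rewrite scalerDr scalerA mulrCA divff ?gt_eqF// mulr1.
  rewrite (pZ _ _ (ltW a0)) mulrBl le_eqVlt; apply/orP; left; apply/eqP.
  by field; rewrite gt_eqF.
split=> [x x'|a x].
  rewrite -lerBlDr; apply: ray_inf_ge => t t0.
  rewrite lerBlDr -lerBlDl. apply: ray_inf_ge => s s0; rewrite lerBlDl.
  apply: le_trans (ray_inf_lb y _ sp (addr_ge0 t0 s0)) _.
  rewrite mulrDl scalerDl [x + x' + _]addrACA.
  have := pD (x + t *: y) (x' + s *: y); lra.
rewrite le_eqVlt => /predU1P[<-|a0].
  rewrite scale0r mul0r; apply/eqP; rewrite eq_le; apply/andP; split.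
    by rewrite (le_trans (ray_inf_le _ _ sp))// (sublinear0 sp).
  by apply: ray_inf_ge => t t0; rewrite add0r pZ// subrr.
apply/eqP; rewrite eq_le le1// andbT.
(* The reverse inequality is [le1] for the scalar [a^-1] and the vector [a *: x]. *)
have ai : 0 < a^-1 by rewrite invr_gt0.
have := le1 _ (a *: x) ai.
by rewrite scalerA mulVf ?gt_eqF// scale1r mulrC ler_pdivrMr// mulrC.
Qed.

(* A pointwise minimal sublinear functional equals its infima along all rays,
   hence is additive. *)
Lemma sublinear_ge_linear p : sublinear p ->
  exists phi : V -> R^o, linear phi /\ forall x, phi x <= p x.
Proof.
move=> sp; pose T := {q : V -> R | sublinear q /\ forall x, q x <= p x}.
pose r (q q' : T) := `[< forall x, sval q' x <= sval q x >].
have [|q1 q2 q3 /asboolP h1 /asboolP h2|q1 q2 /asboolP h1 /asboolP h2|A Atot|q qmin] :=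
  @Zorn T r.
- by move=> q; apply/asboolP.
- by apply/asboolP => x; apply: le_trans (h2 x) (h1 x).
- case: q1 h1 h2 => q1 q1P; case: q2 => q2 q2P /= h1 h2.
  have E : q1 = q2 by apply/funext => x; apply/eqP; rewrite eq_le h1 h2.
  by move: q1P q2P; rewrite E => q1P q2P; congr exist; exact: Prop_irrelevance.
- have [[q0 Aq0]|A0] := pselect (A !=set0); last first.
    have pp : sublinear p /\ forall x, p x <= p x by [].
    exists (exist _ p pp) => q Aq.
    by exfalso; apply: A0; exists q.
  pose m x := inf [set sval (q : T) x | q in A].
  have lbA x (q : T) : A q -> m x <= sval q x.
    move=> Aq; apply: ge_inf; last by exists q.
    exists (- p (- x)) => _ [q' _ <-]; have [sq' qp] := svalP q'.
    by apply: le_trans (sublinear_ge x sq'); rewrite lerN2 qp.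
  have geA x c : (forall q : T, A q -> c <= sval q x) -> c <= m x.
    move=> h; apply: lb_le_inf; last by move=> _ [q' Aq' <-]; exact: h.
    by exists (sval q0 x); exists q0.
  have mZ a x : 0 < a -> a * m x <= m (a *: x).
    move=> a0; apply: geA => q Aq; rewrite ((svalP q).1.2 a x (ltW a0)).
    by rewrite ler_pM2l// lbA.
  have sm : sublinear m.
    split=> [x y|a x].
      rewrite -lerBlDr; apply: (geA) => q Aq; rewrite lerBlDr -lerBlDl.
      apply: geA => q' Aq'; rewrite lerBlDl.
      have [/asboolP qq'|/asboolP qq'] := Atot _ _ Aq Aq'.
        apply: le_trans (lbA _ _ Aq') _; apply: le_trans ((svalP q').1.1 _ _) _.
        by rewrite lerD2r.
      apply: le_trans (lbA _ _ Aq) _; apply: le_trans ((svalP q).1.1 _ _) _.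
      by rewrite lerD2l.
    rewrite le_eqVlt => /predU1P[<-|a0].
      rewrite scale0r mul0r; apply/eqP; rewrite eq_le; apply/andP; split.
        by apply: le_trans (lbA _ _ Aq0) _; rewrite (sublinear0 (svalP q0).1).
      by apply: geA => q Aq; rewrite (sublinear0 (svalP q).1).
    apply/eqP; rewrite eq_le mZ// andbT.
    have ai : 0 < a^-1 by rewrite invr_gt0.
    have := mZ _ (a *: x) ai.
    by rewrite scalerA mulVf ?gt_eqF// scale1r mulrC ler_pdivrMr// mulrC.
  have mp : sublinear m /\ forall x, m x <= p x.
    split=> // x; apply: le_trans (lbA _ _ Aq0) _; exact: (svalP q0).2.
  exists (exist _ m mp) => q Aq; apply/asboolP => x; exact: lbA.
have [sq qp] := svalP q; set f := sval q.
have qD y x : f x + f y <= f (x + y).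
  have rp : sublinear (ray_inf f y) /\ forall x, ray_inf f y x <= p x.
    split; first exact: ray_inf_sublinear.
    by move=> z; apply: le_trans (ray_inf_le _ _ sq) (qp z).
  have E : exist _ _ rp = q by apply: qmin; apply/asboolP => z; exact: ray_inf_le.
  have E3 : ray_inf f y = f by exact: (congr1 sval E).
  by have := ray_inf_lb y x sq ler01; rewrite scale1r mul1r -/f E3; lra.
have fD x y : f (x + y) = f x + f y.
  by apply/eqP; rewrite eq_le qD (sq.1).
have fN x : f (- x) = - f x.
  by apply/eqP; rewrite -subr_eq0 opprK -fD addNr; apply/eqP; exact: sublinear0 sq.
exists f; split=> // a x y; rewrite fD; congr (_ + _).
have [a0|a0] := leP 0 a; first exact: sq.2.
have fZN : f (- a *: x) = - a * f x by apply: sq.2; rewrite oppr_ge0 ltW.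
by rewrite -[a]opprK scaleNr fN fZN scaleNr.
Qed.

Theorem hahn_banach p g : sublinear p ->
  exists phi : V -> R^o, [/\ linear phi, forall x, phi x <= p x & phi g = p g].
Proof.
move=> sp; have [phi [lphi phip]] := sublinear_ge_linear (ray_inf_sublinear g sp).
have phip' x : phi x <= p x by apply: le_trans (phip x) (ray_inf_le _ _ sp).
exists phi; split=> //; apply/eqP; rewrite eq_le phip'/=.
have phiN : phi (- g) = - phi g.
  have phi0 : phi 0 = 0.
    by apply/eqP; rewrite eq_le; have := lphi 1 0 0; rewrite !scale1r addr0; lra.
  by have := lphi (-1) g 0; rewrite !scaleN1r addr0 phi0 addr0.
have := le_trans (phip (- g)) (ray_inf_lb g (- g) sp ler01).
by rewrite scale1r addNr (sublinear0 sp) mul1r sub0r phiN lerN2.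
Qed.

End hahn_banach.

(** * Simons' inequality *)

Section weights.
Context {R : realType}.
Implicit Types (a : nat -> R) (N M : nat).

Definition weights a N M :=
  [/\ forall k, 0 <= a k, forall k, ~~ (N <= k < M)%N -> a k = 0
    & \sum_(k < M) a k = 1].

Lemma weights_sum (V : lmodType R) a N M M' (v : nat -> V) : weights a N M ->
  (M <= M')%N -> \sum_(k < M') a k *: v k = \sum_(k < M) a k *: v k.
Proof.
move=> [_ az _] MM'; rewrite -!(big_mkord xpredT (fun k => a k *: v k)).
rewrite [LHS](@big_cat_nat _ _ _ M)//= [X in _ + X]big1_seq ?addr0// => k.
by rewrite mem_index_iota => /andP[_ /andP[Mk _]]; rewrite az ?scale0r// ltnNge Mk/= andbF.
Qed.

Lemma weights1 N : weights (fun k => (k == N)%:R) N N.+1.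
Proof.
split=> [k|k|]; first exact: ler0n.
  by case: eqVneq => // ->; rewrite leqnn ltnSn.
by rewrite big_ord_recr/= eqxx big1 ?add0r// => -[i iN _] /=; rewrite ltn_eqF.
Qed.

Lemma weights_half a a' N M M' : weights a N M -> weights a' N M' ->
  weights (fun k => 2^-1 * a k + 2^-1 * a' k) N (maxn M M').
Proof.
move=> wa wa'; have [a0 az a1] := wa; have [a0' az' a1'] := wa'; split.
- by move=> k; rewrite addr_ge0// mulr_ge0// invr_ge0.
- move=> k h; rewrite az ?az' ?mulr0 ?addr0//; apply: contra h => /andP[-> /=].
    by rewrite leq_max => ->; rewrite ?orbT.
  by rewrite leq_max => ->.
have E b L : weights b N L -> (L <= maxn M M')%N -> \sum_(k < maxn M M') b k = 1.
  move=> wb LM; have [_ _ <-] := wb; have := @weights_sum R^o b N L _ (fun=> 1) wb LM.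
  by rewrite /GRing.scale/=; under eq_bigr do rewrite mulr1;
     under [RHS]eq_bigr do rewrite mulr1.
rewrite big_split/= -!mulr_sumr !(E _ _ wa) ?leq_maxl// (E _ _ wa') ?leq_maxr//.
by rewrite !mulr1 -div1r -splitr.
Qed.

Lemma weightsW a N N' M : (N' <= N)%N -> weights a N M -> weights a N' M.
Proof.
move=> NN [a0 az a1]; split=> // k h; apply: az; apply: contra h => /andP[Nk ->].
by rewrite (leq_trans NN).
Qed.

Lemma weights_le a N M (x : nat -> R) c : weights a N M ->
  (forall k, (N <= k < M)%N -> x k <= c) -> \sum_(k < M) a k * x k <= c.
Proof.
move=> [a0 az a1] xc; rewrite -[c]mul1r -a1 mulr_suml; apply: ler_sum => k _.
have [Nk|Nk] := leqP N k; first by rewrite ler_wpM2l// xc// Nk/=.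
by rewrite az ?mul0r// leqNgt Nk.
Qed.

Lemma weights_norm_le (V : normedModType R) a N M (x : nat -> V) c : weights a N M ->
  (forall k, (N <= k < M)%N -> `|x k| <= c) -> `|\sum_(k < M) a k *: x k| <= c.
Proof.
move=> wa xc; rewrite (le_trans (ler_norm_sum _ _ _))//.
under eq_bigr do rewrite normrZ ger0_norm ?(let: And3 a0 _ _ := wa in a0 _)//.
exact: weights_le wa xc.
Qed.

End weights.

Section simons.
Context {R : realType} (T : Type).
Implicit Types (g : T -> R).

Definition bsup g : R := sup (range g).

Lemma bsup_ub g B t : (forall s, g s <= B) -> g t <= bsup g.
Proof. by move=> gB; exact: le_sup_range gB. Qed.

Lemma bsup_le g (t0 : T) B : (forall s, g s <= B) -> bsup g <= B.
Proof. exact: sup_range_le. Qed.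

Lemma bsup_adherent g (t0 : T) B e : (forall s, g s <= B) -> 0 < e ->
  exists t, bsup g - e < g t.
Proof.
move=> gB e0; have hs : has_sup (range g).
  by split; [exists (g t0), t0 | exists B => _ [s _ <-]].
by have [_ [t _ <-] h] := sup_adherent e0 hs; exists t.
Qed.

Lemma ex_almost_min (S : Type) (A : S -> Prop) (F : S -> R) B e :
  (exists y, A y) -> (forall y, A y -> B <= F y) -> 0 < e ->
  exists y, A y /\ forall y', A y' -> F y <= F y' + e.
Proof.
move=> [y0 Ay0] FB e0; have hi : has_inf [set F y | y in A].
  by split; [exists (F y0), y0 | exists B => _ [y Ay <-]; exact: FB].
have [_ [y Ay <-] h] := inf_adherent e0 hi; exists y; split=> // y' Ay'.
apply/ltW/(lt_le_trans h); rewrite lerD2r; apply: ge_inf; first by case: hi.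
by exists y'.
Qed.

(* A sequential form of Simons' inequality: the averages [y n] are chosen so
   that [z m = \sum_(n < m) 2 ^- n.+1 * y n] almost attains its supremum at a
   point where all tail averages stay large. *)
Theorem simons (h : nat -> T -> R) (C : R) (t0 : T) :
  (forall n t, `|h n t| <= C) ->
  (forall (b : nat -> T) c, 0 < c -> exists n, forall L M,
     exists2 m, (M <= m)%N & forall k, (n <= k <= n + L)%N -> h k (b m) < c) ->
  forall eps N, 0 < eps -> exists a M, weights a N M /\
    forall t, \sum_(k < M) a k * h k t <= eps.
Proof.
move=> hC hlim eps N eps0; apply: contrapT => hno.
have C0 : 0 <= C by apply: le_trans (hC 0%N t0).
pose q n : R := 2 ^- n.
have q0 n : 0 < q n by rewrite invr_gt0 exprn_gt0.
have qS n : q n = 2 * q n.+1.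
  by rewrite /q exprS invfM mulrA divff ?mul1r.
have q1 n : q n <= 1 by rewrite invf_le1 ?exprn_gt0// exprn_ege1// ler1n.
pose conv n g := exists a M, weights a (N + n) M /\
  g = fun t => \sum_(k < M) a k * h k t.
have conv_bd n g : conv n g -> forall t, `|g t| <= C.
  move=> [a [M [wa ->]]] t.
  exact: (@weights_norm_le _ R^o _ _ _ (h ^~ t) _ wa).
have convW n g : conv n.+1 g -> conv n g.
  by move=> [a [M [wa ->]]]; exists a, M; split=> //; apply: weightsW wa; rewrite addnS.
have convH n g g' : conv n g -> conv n g' ->
    conv n (fun t => 2^-1 * g t + 2^-1 * g' t).
  move=> [a [M [wa ->]]] [a' [M' [wa' ->]]].
  exists (fun k => 2^-1 * a k + 2^-1 * a' k), (maxn M M'); split.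
    exact: weights_half.
  apply/funext => t; rewrite !mulr_sumr.
  have := @weights_sum R R^o _ _ _ _ (h ^~ t) wa (leq_maxl M M').
  have := @weights_sum R R^o _ _ _ _ (h ^~ t) wa' (leq_maxr M M').
  rewrite /GRing.scale/= -!mulr_sumr => <- <-.
  rewrite !mulr_sumr -big_split/=; apply: eq_bigr => k _; ring.
have conv_ge n g : conv n g -> eps <= bsup g.
  move=> cg; have gb := conv_bd _ _ cg; apply: contrapT => /negP; rewrite -ltNge => ge.
  apply: hno; have [a [M [wa ga]]] := cg; exists a, M; split.
    by apply: weightsW wa; rewrite leq_addr.
  move=> t; have := congr1 (@^~ t) ga => /= <-; apply: le_trans (ltW ge).
  by apply: (@bsup_ub _ C) => s; apply: le_trans (gb s); exact: ler_norm.
have conv_ex n : exists g, conv n g.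
  exists (fun t => \sum_(k < (N + n).+1) (k == (N + n)%N :> nat)%:R * h k t).
  by exists (fun k => (k == N + n)%N%:R), (N + n).+1; split=> //; exact: weights1.
(* The square is dictated by [low]: passing from n to n + 1 costs [de n / 2], which is exactly what
   the term [eps / 2 * (1 - q n)] gives up at that step. *)
pose de n : R := eps / 4 * q n * q n.
have de0 n : 0 < de n by rewrite !mulr_gt0// divr_gt0.
have /choice[Y YP] : forall nz : nat * (T -> R), exists y, conv nz.1 y /\
    ((forall t, `|nz.2 t| <= C) -> forall y', conv nz.1 y' ->
      bsup (fun t => nz.2 t + q nz.1 * y t) <=
      bsup (fun t => nz.2 t + q nz.1 * y' t) + de nz.1).
  move=> [n z] /=; have [zC|nzC] := pselect (forall t, `|z t| <= C); last first.
    by have [y cy] := conv_ex n; exists y.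
  have [y cy|y [cy ymin]] := @ex_almost_min _ (conv n)
    (fun y => bsup (fun t => z t + q n * y t)) (- (C + C)) (de n) (conv_ex n) _ (de0 n).
    have bd s : `|z s + q n * y s| <= C + C.
      rewrite (le_trans (ler_normD _ _))// lerD// normrM gtr0_norm//.
      by rewrite -[C]mul1r ler_pM// ?(conv_bd _ _ cy)// ltW.
    have ub : forall s, z s + q n * y s <= C + C.
      by move=> s; apply: le_trans (bd s); exact: ler_norm.
    apply: le_trans (bsup_ub t0 ub).
    by rewrite lerNl; apply: le_trans (bd t0); rewrite -normrN ler_norm.
  by exists y.
pose z := fix z n : T -> R := if n is n'.+1 then
  (fun t => z n' t + q n * Y (n', z n') t) else (fun=> 0).
pose y n := Y (n, z n).
have zS n t : z n.+1 t = z n t + q n.+1 * y n t by [].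
have cy n : conv n (y n) := (YP (n, z n)).1.
have yC n t : `|y n t| <= C := conv_bd _ _ (cy n) t.
have zC n t : `|z n t| <= C * (1 - q n).
  elim: n => [|n IH]; first by rewrite normr0 /q expr0 invr1 subrr mulr0.
  rewrite zS (le_trans (ler_normD _ _))//.
  have : `|q n.+1 * y n t| <= q n.+1 * C by rewrite normrM gtr0_norm// ler_pM2l.
  have := qS n; nra.
have zC' n t : `|z n t| <= C.
  by apply: le_trans (zC n t) _; have := q0 n; nra.
have zB n t : z n t <= C by apply: le_trans (zC' n t); exact: ler_norm.
(* [y'] is an average of [y n], ..., [y m], hence a competitor of the almost minimal [y n]; this
   lets [step] compare the index n with every later m. *)
have tele n m : (n <= m)%N -> exists2 y', conv n y' &
    forall t, z m t + q m * y m t = z n t + q n * y' t.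
  move=> nm; rewrite -(subKn nm); move: (m - n)%N (leq_subr n m) => d.
  elim: d => [|d IH] dm; first by rewrite subn0; exists (y m).
  have [|y' cy' E] := IH; first exact: ltnW.
  set n' := (m - d.+1)%N; have n'S : (m - d = n'.+1)%N by rewrite /n' subnS prednK// subn_gt0.
  exists (fun t => 2^-1 * y n' t + 2^-1 * y' t).
    by apply: convH => //; apply: convW; rewrite -n'S.
  by move=> t; rewrite E n'S zS [q n']qS; field.
pose P n := bsup (z n).
have zyB : forall k t, z k t + q k * y k t <= C + C.
  move=> k t; rewrite lerD// (le_trans (ler_norm _))// normrM gtr0_norm//.
  by rewrite -[leRHS]mul1r ler_pM// ltW.
have Pm m : bsup (fun t => z m t + q m * y m t) <= P m + q m * C.
  apply: bsup_le => // t; apply: lerD; first exact: bsup_ub (zB m).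
  by rewrite ler_pM2l// (le_trans (ler_norm _)).
have Plow m : eps <= P m + q m * C.
  apply: le_trans (Pm m); have [y' cy' E] := tele 0%N m (leq0n m).
  apply: le_trans (conv_ge _ _ cy') _; apply: bsup_le => // t.
  have -> : y' t = z m t + q m * y m t by rewrite E /= /q expr0 invr1 mul1r add0r.
  exact: bsup_ub (zyB m).
have step n m : (n <= m)%N -> 2 * P n.+1 <= P n + (P m + q m * C) + de n.
  move=> nm; rewrite -ler_pdivlMl//; apply: bsup_le => // t.
  rewrite ler_pdivlMl//.
  have -> : 2 * z n.+1 t = z n t + (z n t + q n * y n t) by rewrite zS [q n]qS; ring.
  rewrite -addrA; apply: lerD; first exact: bsup_ub (zB n).
  apply: le_trans (bsup_ub t (zyB n)) _.
  have [y' cy' E] := tele n m nm.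
  apply: le_trans ((YP (n, z n)).2 (zC' n) y' cy') _; rewrite /= lerD2r.
  by under [X in bsup X]funext do rewrite -E.
(* By [step] the gap between [P n] and the final value shrinks by at most a factor 2 when n grows by
   one, up to [de n]. It is at least [eps] for n = 0, so at n it is still at least
   [q n * (eps / 2)]. *)
have low n m : (n <= m)%N ->
    q n * (eps - eps / 2 * (1 - q n)) <= P m + q m * C - P n.
  elim: n => [|n IH] nm.
    have P0 : P 0%N <= 0 by apply: bsup_le.
    by rewrite /q expr0 invr1; have := Plow m; rewrite /q; lra.
  have := step n m (ltnW nm); have := IH (ltnW nm); rewrite /de [q n]qS.
  have := q0 n.+1; set x := q n.+1 => x0 h1 h2.
  nra.
have /choice[b bP] : forall m, exists t, P m - q m < z m t.
  by move=> m; have [t] := bsup_adherent t0 (zB m) (q0 m); exists t.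
have e8 : 0 < eps / 8 by rewrite divr_gt0.
(* At the near maximizer [b m], the averages [y k] with [n <= k < n + l] involve finitely many [h j]
   and are at most [eps / 8]; the later ones weigh at most [q (n + l) * C]. With the error terms in
   [q m], the gain from [z n] to [z m] stays below 3/8 of [q n * eps], while [low] demands one
   half. *)
have [n nP] := hlim b _ e8.
have qsmall e : 0 < e -> exists l, forall m, (l <= m)%N -> q m < e.
  move=> e0; have := @near_infty_natSinv_expn_lt R (PosNum e0).
  move=> [l _ lP]; exists l => m lm; have := lP m lm; rewrite div1r.
  by rewrite /q; apply: le_lt_trans.
have C1 : 0 < C + 1 by rewrite ltr_wpDl.
have [l lP] := qsmall (eps / 8 / (C + 1)) ltac:(by rewrite divr_gt0).
have [l' l'P] := qsmall (q n * (eps / 8) / (C + 1)) ltac:(by rewrite divr_gt0// mulr_gt0).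
have [L LP] : exists L, forall k, (n <= k < n + l)%N -> exists a M,
    [/\ weights a (N + k) M, y k = (fun t => \sum_(k < M) a k * h k t) & (M <= n + L)%N].
  elim: l {lP} => [|l [L IH]].
    by exists 0%N => k; rewrite addn0 => /andP[nk kn]; move: (leq_ltn_trans nk kn); rewrite ltnn.
  have [a [M [wa ya]]] := cy (n + l)%N; exists (maxn L M) => k /andP[nk].
  rewrite addnS ltnS leq_eqVlt => /predU1P[->|kl].
    exists a, M; split=> //; first by apply: leq_trans (leq_maxr _ _) (leq_addl _ _).
  have [|a' [M' [wa' ya' M'L]]] := IH k; first by rewrite nk.
  by exists a', M'; split=> //; rewrite (leq_trans M'L)// leq_add2l leq_maxl.
have [m mM hm] := nP L (maxn (n + l) l').
have nlm : (n + l <= m)%N by apply: leq_trans mM; exact: leq_maxl.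
have ym k : (n <= k < n + l)%N -> y k (b m) <= eps / 8.
  move=> kl; have [a [M [wa -> ML]]] := LP k kl.
  apply: (@weights_le _ _ _ _ (fun j => h j (b m)) _ wa) => j /andP[Nj jM].
  have /andP[nk _] := kl.
  apply/ltW/hm; rewrite (leq_trans nk) ?(leq_trans (leq_addl N k))//=.
  exact: leq_trans (ltnW jM) ML.
have part1 d : (d <= l)%N -> z (n + d)%N (b m) <= z n (b m) + (q n - q (n + d)%N) * (eps / 8).
  elim: d => [|d IH] dl; first by rewrite addn0 subrr mul0r addr0.
  rewrite addnS zS; have := IH (ltnW dl); have := ym (n + d)%N.
  rewrite leq_addr ltn_add2l dl => /(_ isT); have := q0 (n + d).+1; rewrite [q (n + d)%N]qS; nra.
have part2 d : z (n + l + d)%N (b m) <= z (n + l)%N (b m) + (q (n + l)%N - q (n + l + d)%N) * C.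
  elim: d => [|d IH]; first by rewrite addn0 subrr mul0r addr0.
  rewrite addnS zS; have : y (n + l + d)%N (b m) <= C by rewrite (le_trans (ler_norm _)).
  have := IH; have := q0 (n + l + d).+1; rewrite [q (n + l + d)%N]qS; nra.
have := part1 l (leqnn l); have := part2 (m - (n + l))%N; rewrite subnKC//.
have := bP m; have zPn : z n (b m) <= P n by exact: bsup_ub (zB n).
have := low n m (leq_trans (leq_addr l n) nlm).
have : q m * (C + 1) < q n * (eps / 8).
  by rewrite -ltr_pdivlMr//; apply: l'P; apply: leq_trans mM; exact: leq_maxr.
have : q (n + l)%N * (C + 1) <= q n * (eps / 8).
  rewrite /q exprD invfM -mulrA ler_pM2l// -ler_pdivlMr//; apply/ltW/lP; exact: leqnn.
have := q0 n; have := q0 m; have := q0 (n + l)%N; have := q1 n.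
nra.
Qed.

End simons.

(** * Duals and biduals *)

Section ultra.
Context {R : realType}.

(** A single ultrafilter assigns limits to all bounded real sequences at once; every compactness
    argument below runs through it. *)
Lemma ex_free_ultrafilter : exists U : set_system nat,
  [/\ ProperFilter U, forall N, U [set n | (N <= n)%N]
    & forall (u : nat -> R) B, (forall n, `|u n| <= B) ->
        exists l, forall e, 0 < e -> U [set n | `|u n - l| < e]].
Proof.
have [U [UU Uoo]] := ultraFilterLemma (eventually_filter).
exists U; split; first exact: ultra_proper.
  by move=> N; apply: Uoo; exists N.
move=> u B uB; have cB := @segment_compact R (- B) B.
have uU : (u @ U) `[- B, B]%classic.
  rewrite /= /nbhs/= /fmap/=; apply: filterS filterT => n _ /=.
  by rewrite in_itv/= -ler_norml.
have [l [_ lcl]] := cB (u @ U) _ uU.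
exists l => e e0; have [//|Ue] := in_ultra_setVsetC [set n | `|u n - l| < e] UU.
have UA : (u @ U) [set x | e <= `|x - l|].
  by apply: (@filterS _ U) Ue => n /= h; rewrite leNgt; apply/negP.
have [x [/= ex]] := lcl _ _ UA (nbhsx_ballx l e e0).
by rewrite /ball/= distrC ltNge ex.
Qed.

End ultra.

Section duality.
Context {R : realType}.

Lemma dual_le (V : normedModType R) (phi : dual V) x : `|phi x| <= `|phi| * `|x|.
Proof.
have [->|x0] := eqVneq x 0; first by rewrite -(scale0r 0) dualZ !scale0r !normr0 mulr0.
rewrite -ler_pdivrMr ?normr_gt0//.
have -> : `|phi x| / `|x| = `|phi (`|x|^-1 *: x)|.
  by rewrite dualZ normrM normfV normr_id mulrC.
by apply: dual_norm_ub; rewrite normrZ normfV normr_id mulVf ?normr_eq0.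
Qed.

Lemma dual_norm_leP (V : normedModType R) (phi : dual V) C : 0 <= C ->
  (forall x, `|phi x| <= C * `|x|) -> `|phi| <= C.
Proof.
move=> C0 h; apply: dual_norm_le => x x1; apply: le_trans (h x) _.
by rewrite ler_piMr.
Qed.

Lemma ex_dual (V : normedModType R) (phi : V -> R^o) C : linear phi ->
  (forall x, `|phi x| <= C * `|x|) -> exists d : dual V, forall x, d x = phi x.
Proof.
move=> lphi phiC.
have P : phi \in @dual_pred R V.
  by apply/mem_set; split=> //; apply/(linear_continuousP lphi); exists C.
by exists (Dual P).
Qed.

Lemma dualD (V : normedModType R) (phi : dual V) x y : phi (x + y) = phi x + phi y.
Proof. by have := dual_linear phi 1 x y; rewrite !scale1r. Qed.

Lemma dualN (V : normedModType R) (phi : dual V) x : phi (- x) = - phi x.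
Proof. by rewrite -scaleN1r dualZ scaleN1r. Qed.

Lemma dualB (V : normedModType R) (phi : dual V) x y : phi (x - y) = phi x - phi y.
Proof. by rewrite dualD dualN. Qed.

Lemma dual0 (V : normedModType R) (phi : dual V) : phi 0 = 0.
Proof. by rewrite -(scale0r 0) dualZ scale0r. Qed.

Lemma dual_sum (V : normedModType R) (phi : dual V) I (r : seq I) (P : pred I) (f : I -> V) :
  phi (\sum_(i <- r | P i) f i) = \sum_(i <- r | P i) phi (f i).
Proof. by apply: (big_morph phi (dualD phi) (dual0 phi)). Qed.

Lemma sublinear_dominated (V : normedModType R) (psi : V -> R^o) C : linear psi ->
  (forall x, psi x <= C * `|x|) -> forall x, `|psi x| <= C * `|x|.
Proof.
move=> lpsi psiC x; rewrite ler_norml psiC andbT lerNl.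
have psi0 : psi 0 = 0.
  by apply/eqP; rewrite eq_le; have := lpsi 1 0 0; rewrite !scale1r addr0; lra.
have <- : psi (- x) = - psi x.
  by have := lpsi (-1) x 0; rewrite !scaleN1r addr0 psi0 addr0.
by rewrite (le_trans (psiC _))// normrN.
Qed.

Lemma ex_norming (V : normedModType R) (g : V) : exists phi : dual V,
  (forall x, `|phi x| <= `|x|) /\ phi g = `|g|.
Proof.
have [|phi [lphi phile phig]] := @hahn_banach R V (fun x => `|x|) g.
  by split=> [x y|a x a0]; rewrite ?ler_normD// normrZ ger0_norm.
have phi1 x : `|phi x| <= 1 * `|x|.
  by apply: sublinear_dominated => // y; rewrite mul1r.
have [d dE] := ex_dual lphi phi1; exists d; split=> [x|]; rewrite dE//.
by rewrite -[leRHS]mul1r.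
Qed.

(** The Hahn-Banach theorem is applied to the infimal convolution [q] of [psi] on [Y] with
    [c * |x|]. It is at most [c * |x|] everywhere and at most [psi] on [Y], and on a linear space an
    inequality between linear functionals is an equality. *)
Lemma dual_extension (V : normedModType R) (Y : set V) (psi : dual V) c : 0 <= c ->
  Y 0 -> (forall (a : R) x y, Y x -> Y y -> Y (a *: x + y)) ->
  (forall y, Y y -> `|psi y| <= c * `|y|) ->
  exists phi : dual V, `|phi| <= c /\ forall y, Y y -> phi y = psi y.
Proof.
move=> c0 Y0 YS psic.
have YZ a y : Y y -> Y (a *: y) by move=> Yy; rewrite -[_ *: _]addr0; exact: YS.
have YD x y : Y x -> Y y -> Y (x + y) by move=> Yx Yy; rewrite -[x]scale1r; exact: YS.
pose A x := [set psi y + c * `|x - y| | y in Y].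
have lb x y : Y y -> - (c * `|x|) <= psi y + c * `|x - y|.
  move=> Yy; have := psic y Yy; rewrite ler_norml => /andP[h _].
  have : `|y| <= `|x| + `|x - y| by rewrite -[y](subKr x) (le_trans (ler_normB _ _))// subKr.
  by nra.
pose q x := inf (A x).
have q_le x y : Y y -> q x <= psi y + c * `|x - y|.
  move=> Yy; apply: ge_inf; last by exists y.
  by exists (- (c * `|x|)) => _ [z Yz <-]; exact: lb.
have q_ge x m : (forall y, Y y -> m <= psi y + c * `|x - y|) -> m <= q x.
  move=> h; apply: lb_le_inf; last by move=> _ [z Yz <-]; exact: h.
  by exists (psi 0 + c * `|x - 0|), 0.
have qZ a x : 0 < a -> a * q x <= q (a *: x).
  move=> a0; apply: (q_ge) => y Yy.
  have := q_le x (a^-1 *: y) (YZ _ _ Yy); rewrite -(ler_pM2l a0) => /le_trans; apply.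
  rewrite mulrDr dualZ [a * (_ *: _)]mulrA mulfV ?gt_eqF// mul1r lerD2l mulrCA.
  by rewrite -{1}(gtr0_norm a0) -normrZ scalerBr scalerA mulfV ?gt_eqF// scale1r.
have [|phi [lphi phiq _]] := @hahn_banach R V q 0.
  split=> [x y|a x].
    rewrite -lerBlDr; apply: (q_ge) => u Yu; rewrite lerBlDr -lerBlDl.
    apply: (q_ge) => v Yv; rewrite lerBlDl.
    apply: le_trans (q_le _ _ (YD _ _ Yu Yv)) _.
    have : `|x + y - (u + v)| <= `|x - u| + `|y - v|.
      by rewrite opprD addrACA ler_normD.
    by rewrite dualD; nra.
  rewrite le_eqVlt => /predU1P[<-|a0].
    rewrite scale0r mul0r; apply/eqP; rewrite eq_le; apply/andP; split.
      by have := q_le 0 0 Y0; rewrite dual0 subr0 normr0 mulr0 addr0.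
    by apply: (q_ge) => y Yy; have := lb 0 y Yy; rewrite normr0 mulr0 oppr0.
  apply/eqP; rewrite eq_le qZ// andbT.
  have ai : 0 < a^-1 by rewrite invr_gt0.
  have := qZ _ (a *: x) ai.
  by rewrite scalerA mulVf ?gt_eqF// scale1r mulrC ler_pdivrMr// mulrC.
have phic x : `|phi x| <= c * `|x|.
  apply: sublinear_dominated => // y; apply: le_trans (phiq y) _.
  by have := q_le y 0 Y0; rewrite dual0 add0r subr0.
have [d dE] := ex_dual lphi phic; exists d; split.
  by apply: dual_norm_leP => // x; rewrite dE.
have le1 y : Y y -> d y <= psi y.
  move=> Yy; rewrite dE; apply: le_trans (phiq y) _.
  by have := q_le y y Yy; rewrite subrr normr0 mulr0 addr0.
move=> y Yy; apply/eqP; rewrite eq_le le1//=.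
by have := le1 _ (YZ (-1) y Yy); rewrite !scaleN1r !dualN lerN2.
Qed.

(** An [F] that kills the annihilator of [Y] sees only the restriction of [psi] to [Y], so [psi] may
    be replaced by a norm-controlled extension of that restriction. *)
Lemma bidual_annihilator_le (V : normedModType R) (Y : set V) (F : dual (dual V))
    (psi : dual V) c : 0 <= c ->
  Y 0 -> (forall (a : R) x y, Y x -> Y y -> Y (a *: x + y)) ->
  (forall phi : dual V, (forall y, Y y -> phi y = 0) -> F phi = 0) ->
  (forall y, Y y -> `|psi y| <= c * `|y|) -> `|F psi| <= `|F| * c.
Proof.
move=> c0 Y0 YS FY psic; have [phi [phic E]] := dual_extension c0 Y0 YS psic.
have : F (psi - phi) = 0.
  by apply: FY => y Yy; apply/eqP; rewrite [_ y]/(psi y - phi y) subr_eq0 E.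
rewrite dualB => /eqP; rewrite subr_eq0 => /eqP ->.
by apply: le_trans (dual_le _ _) _; rewrite ler_wpM2l.
Qed.

Lemma weak_star_eval_continuous (V : normedModType R) (x : V) :
  continuous ((fun phi => phi x) : weak_star V -> R^o).
Proof.
move=> phi; apply: (@continuous_comp (weak_star V) {ptws V -> R^o} R^o
  (fun phi : dual V => (phi : V -> R^o)) (fun f => f x)).
  exact: initial_continuous.
exact: (@proj_continuous V (fun=> R^o) x).
Qed.

Lemma weak_star_closure_annihilator (V : normedModType R) (Y : set V)
    (F : weak_star (dual V)) (phi : dual V) :
  closure (bidual_emb @` Y : set (weak_star (dual V))) F ->
  (forall y, Y y -> phi y = 0) -> (F : dual (dual V)) phi = 0.
Proof.
move=> clF phiY.
pose Z : set (weak_star (dual V)) := (fun G => (G : dual (dual V)) phi) @^-1` [set 0 : R^o].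
have cZ : closed Z.
  apply: (closed_comp (f := (fun G => (G : dual (dual V)) phi) : weak_star (dual V) -> R^o)).
    by move=> G _; exact: weak_star_eval_continuous.
  exact: closed_eq.
suff : Z F by [].
by apply: cZ; apply: closure_subset clF => _ [y Yy <-]; exact: phiY.
Qed.

(** [F phi] is the limit of [phi (x n)] along a free ultrafilter; freeness makes it agree with
    ordinary limits wherever these exist. *)
Lemma bounded_bidual_cluster (V : normedModType R) (x : nat -> V) B :
  (forall n, `|x n| <= B) -> exists F : dual (dual V),
  (forall (phi : dual V) l, (fun n => phi (x n) : R^o) @ \oo --> (l : R^o) -> F phi = l) /\
  (forall Y : set V, (forall n, Y (x n)) ->
     closure (bidual_emb @` Y : set (weak_star (dual V))) F).
Proof.
move=> xB; have [U [PU Uoo Ulim]] := @ex_free_ultrafilter R.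
have B0 : 0 <= B by apply: le_trans (xB 0%N).
have phiB (phi : dual V) n : `|phi (x n)| <= `|phi| * B.
  by apply: le_trans (dual_le _ _) _; rewrite ler_wpM2l.
have /choice[f fP] : forall phi : dual V, exists l, forall e, 0 < e ->
    U [set n | `|phi (x n) - l| < e].
  by move=> phi; exact: (Ulim (fun n => phi (x n)) _ (phiB phi)).
have f_uniq (phi : dual V) l : (forall e, 0 < e -> U [set n | `|phi (x n) - l| < e]) ->
    f phi = l.
  move=> lP; apply/eqP; rewrite -subr_eq0 -normr_le0; apply/ler_addgt0Pl => e e0.
  have e2 : 0 < e / 2 by rewrite divr_gt0.
  have [n [/= h1 h2]] := filter_ex (filterI (fP phi _ e2) (lP _ e2)).
  rewrite addr0 -(subrKA (phi (x n))) (le_trans (ler_normD _ _))//.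
  by rewrite [leRHS]splitr lerD ?ltW// distrC.
have lf : linear (f : dual V -> R^o).
  move=> a phi psi; apply: f_uniq => e e0.
  have e2 : 0 < e / 2 by rewrite divr_gt0.
  have ea : 0 < e / 2 / (`|a| + 1) by rewrite divr_gt0// ltr_wpDl.
  apply: filterS2 (fP phi _ ea) (fP psi _ e2) => n /= h1 h2.
  rewrite -[X in `|X - _|]/(a * phi (x n) + psi (x n)) opprD addrACA -mulrBr.
  rewrite (le_lt_trans (ler_normD _ _))// normrM [ltRHS]splitr ler_ltD//.
  apply: (@le_trans _ _ ((`|a| + 1) * `|phi (x n) - f phi|)).
    by rewrite ler_wpM2r// lerDl.
  by rewrite mulrC -ler_pdivlMr ?ltW// ltr_wpDl.
have fB (phi : dual V) : `|f phi| <= B * `|phi|.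
  apply/ler_addgt0Pl => e e0; have [n /= h] := filter_ex (fP phi _ e0).
  have := ler_normB (phi (x n)) (phi (x n) - f phi); rewrite subKr.
  by have := phiB phi n; move: h => /=; lra.
have [F FE] := ex_dual lf fB; exists F; split.
  move=> phi l hl; rewrite FE; apply: f_uniq => e e0.
  have [N _ NP] := (cvgrPdistC_lt _ _).1 hl e e0.
  by apply: filterS (Uoo N) => n /= /NP /=.
move=> Y Yx W; rewrite nbhsE/= => -[W' [[C oC CW'] W'F] W'W].
have CF : nbhs ((F : dual V -> R^o) : {ptws dual V -> R^o}) C.
  by apply: open_nbhs_nbhs; split=> //; move: W'F; rewrite -CW'.
have cvgF : {ptws, (fun n => (bidual_emb (x n) : dual V -> R^o)) @ U --> (F : dual V -> R^o)}.
  apply/pointwise_cvgP => phi; apply/cvgrPdistC_lt => e e0.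
  by rewrite FE; exact: fP.
have UC : U [set n | C (bidual_emb (x n) : dual V -> R^o)] by exact: cvgF CF.
have [n /= Cn] := @filter_ex _ U _ _ UC.
exists (bidual_emb (x n)); split; first by exists (x n).
by apply: W'W; rewrite -CW'.
Qed.

End duality.

(** * Symmetric bases of reflexive spaces *)

Section symmetric_norm.
Context {R : realType} {X : normedModType R} (e : symmetric_basis X).
Implicit Types (s t : seq R) (x : R).

Fixpoint lincomb (k : nat) s : X :=
  if s is x :: s' then x *: e k + lincomb k.+1 s' else 0.

(** The norm of X carried over to finite lists. By symmetry it ignores order, signs and zeros, so a
    family of intervals can be measured without numbering its members. *)
Definition nrm s : R := `|lincomb 0 s|.

Lemma lincombE k s : lincomb k s = \sum_(i < size s) s`_i *: e (k + i)%N.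
Proof.
elim: s k => [|x s IH] k /=; first by rewrite big_ord0.
rewrite big_ord_recl/= addn0 IH; congr (_ + _); apply: eq_bigr => i _.
by rewrite /= /bump/= addnA addn1 addSnnS.
Qed.

Lemma lincomb_cat k s t : lincomb k (s ++ t) = lincomb k s + lincomb (k + size s) t.
Proof.
elim: s k => [|x s IH] k /=; first by rewrite add0r addn0.
by rewrite IH addrA addSnnS.
Qed.

Lemma lincomb_map I k (r : seq I) (f g : I -> R) (a : R) :
  lincomb k [seq a * f i + g i | i <- r] =
  a *: lincomb k [seq f i | i <- r] + lincomb k [seq g i | i <- r].
Proof.
elim: r k => [|i r IH] k /=; first by rewrite scaler0 addr0.
by rewrite IH scalerDr scalerDl -scalerA addrACA.
Qed.

Lemma lincomb_map0 I k (r : seq I) : lincomb k [seq 0 | _ <- r] = 0.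
Proof. by elim: r k => //= i r IH k; rewrite IH scale0r addr0. Qed.

Lemma nrm_ge0 s : 0 <= nrm s. Proof. exact: normr_ge0. Qed.

Lemma nrm_nil : nrm [::] = 0. Proof. by rewrite /nrm normr0. Qed.

Lemma nrm_seq1 x : nrm [:: x] = `|x| * `|e 0%N|.
Proof. by rewrite /nrm/= addr0 normrZ. Qed.

Lemma basis0_gt0 : 0 < `|e 0%N|.
Proof. by rewrite normr_gt0 basis0_neq0. Qed.

Lemma nrmE (a : nat -> R) n : nrm (mkseq a n) = `|\sum_(i < n) a i *: e i|.
Proof.
rewrite /nrm lincombE size_mkseq; congr `|_|; apply: eq_bigr => i _.
by rewrite nth_mkseq.
Qed.

Lemma nrm_alpha (f : unit_itv R -> R^o) (p : Defs.partition R) :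
  alpha e f p = nrm [seq f (p i.+1) - f (p i) | i <- iota 0 (psize p)].
Proof. by rewrite -[map _ _]/(mkseq _ _) nrmE. Qed.

(** [p n1 n2] is the permutation of the indices that exchanges the first two blocks; such exchanges
    generate all permutations of a list ([catCA_perm_ind]). *)
Lemma nrm_catCA s1 s2 s3 : nrm (s1 ++ s2 ++ s3) = nrm (s2 ++ s1 ++ s3).
Proof.
pose n1 := size s1; pose n2 := size s2.
pose p m1 m2 i := if (i < m1)%N then (i + m2)%N else
  if (i < m1 + m2)%N then (i - m1)%N else i.
have pK m1 m2 : cancel (p m1 m2) (p m2 m1).
  move=> i; rewrite /p; case: (ltnP i m1) => im1.
    have -> : (i + m2 < m2)%N = false by lia.
    have -> : (i + m2 < m2 + m1)%N by lia.
    lia.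
  case: (ltnP i (m1 + m2)) => im.
    have -> : (i - m1 < m2)%N by lia.
    lia.
  have -> : (i < m2)%N = false by lia.
  by have -> : (i < m2 + m1)%N = false by lia.
have bp : bijective (p n1 n2) by exists (p n2 n1).
have := @basis_symmetric _ _ e (size (s1 ++ s2 ++ s3)) (nth 0 (s1 ++ s2 ++ s3))
  (fun=> false) _ bp.
have -> : `|\sum_(i < size (s1 ++ s2 ++ s3)) (s1 ++ s2 ++ s3)`_i *: e i| =
    nrm (s1 ++ s2 ++ s3) by rewrite /nrm lincombE.
move=> <-; rewrite /nrm !lincomb_cat !size_cat !lincombE; congr `|_|.
under eq_bigr do rewrite expr0 mul1r.
rewrite !big_split_ord/= addrCA; congr (_ + (_ + _)); apply: eq_bigr => i _ /=.
- rewrite !nth_cat/= ltnNge leq_addr/= addKn ltn_ord/= /p -/n1.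
  have -> : (n1 + i < n1)%N = false by lia.
  have -> : (n1 + i < n1 + n2)%N by have := ltn_ord i; rewrite -/n2; lia.
  by rewrite addKn.
- by rewrite nth_cat ltn_ord /p ltn_ord addnC.
- rewrite !nth_cat -/n1 -/n2 /p.
  have -> : (n1 + (n2 + i) < n1)%N = false by lia.
  have -> : (n1 + (n2 + i) - n1 < n2)%N = false by lia.
  have -> : (n1 + (n2 + i) < n1 + n2)%N = false by lia.
  have -> : (n1 + (n2 + i) - n1 - n2 = i)%N by lia.
  by congr (_ *: e _); lia.
Qed.

Lemma nrm_perm s t : perm_eq s t -> nrm s = nrm t.
Proof.
move=> st; apply/esym; move: s t st.
move=> s t st.
apply: (@catCA_perm_ind R (fun u => nrm u = nrm s) _ _ _ st) => // s1 s2 s3.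
by rewrite nrm_catCA.
Qed.

Lemma nrm_flip s1 x s2 : nrm (s1 ++ - x :: s2) = nrm (s1 ++ x :: s2).
Proof.
pose a i := (s1 ++ x :: s2)`_i.
have bid : bijective (@id nat) by exists id.
have := @basis_symmetric _ _ e (size (s1 ++ x :: s2)) a
  (fun i => i == size s1) id bid.
have -> : `|\sum_(i < size (s1 ++ x :: s2)) a i *: e i| = nrm (s1 ++ x :: s2).
  by rewrite /nrm lincombE.
move=> <-; rewrite /nrm lincombE; congr `|_|.
have -> : size (s1 ++ - x :: s2) = size (s1 ++ x :: s2) by rewrite !size_cat.
apply: eq_bigr => i _; congr (_ *: _).
rewrite /a !nth_cat; case: ltnP => h; first by rewrite ltn_eqF// expr0 mul1r.
case: eqVneq => [->|ne]; first by rewrite subnn/= expr1 mulN1r.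
have : (0 < i - size s1)%N by rewrite subn_gt0 ltn_neqAle eq_sym ne.
by case: (i - size s1)%N => //= k _; rewrite expr0 mul1r.
Qed.

(** Writing [x = th * y] with [|th| <= 1], the left vector is the convex combination, with weights
    [(1 + th) / 2] and [(1 - th) / 2], of the vectors with entries [y] and [- y], which have equal
    norms. *)
Lemma nrm_shrink1 s1 x y s2 : `|x| <= `|y| -> nrm (s1 ++ x :: s2) <= nrm (s1 ++ y :: s2).
Proof.
move=> xy; have [y0|y0] := eqVneq y 0.
  by move: xy; rewrite y0 normr0 normr_le0 => /eqP ->.
pose th := x / y.
have th1 : -1 <= th <= 1.
  by rewrite -ler_norml normrM normfV ler_pdivrMr ?normr_gt0// mul1r.
have -> : nrm (s1 ++ x :: s2) =
    `|((1 + th) / 2) *: lincomb 0 (s1 ++ y :: s2) +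
      ((1 - th) / 2) *: lincomb 0 (s1 ++ - y :: s2)|.
  rewrite /nrm !lincomb_cat/=; congr `|_|.
  have E (A C D : X) : A = ((1 + th) / 2) *: A + ((1 - th) / 2) *: A.
    by rewrite -scalerDl (_ : _ + _ = 1) ?scale1r//; lra.
  rewrite !scalerDr !scalerA.
  rewrite [RHS]addrACA; congr (_ + _); first exact: (E _ 0 0).
  rewrite [RHS]addrACA; congr (_ + _); last exact: (E _ 0 0).
  by rewrite -scalerDl; congr (_ *: _); rewrite /th; field.
rewrite (le_trans (ler_normD _ _))// !normrZ -!/(nrm _) nrm_flip -mulrDl.
have /andP[t1 t2] := th1.
rewrite !ger0_norm; [|lra|lra|lra].
by rewrite (_ : _ * _ + _ * _ = 1) ?mul1r//; lra.
Qed.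

Lemma nrm_map_le (I : eqType) (r : seq I) (f g : I -> R) :
  {in r, forall i, `|f i| <= `|g i|} -> nrm (map f r) <= nrm (map g r).
Proof.
move=> fg; rewrite -[map f r]cat0s -[map g r]cat0s.
elim: r [::] fg => [//|i r IH] u fg /=.
apply: (le_trans (nrm_shrink1 u _ (fg i (mem_head _ _)))).
rewrite -!cat_rcons; apply: IH => j jr; apply: fg; by rewrite in_cons jr orbT.
Qed.

Lemma nrm_map_abs (I : eqType) (r : seq I) (f g : I -> R) :
  {in r, forall i, `|f i| = `|g i|} -> nrm (map f r) = nrm (map g r).
Proof.
by move=> fg; apply/eqP; rewrite eq_le !nrm_map_le// => i ir; rewrite fg.
Qed.

Lemma nrm_mapD I (r : seq I) (f g : I -> R) :
  nrm [seq f i + g i | i <- r] <= nrm (map f r) + nrm (map g r).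
Proof.
apply: le_trans (ler_normD _ _); rewrite /nrm.
have := lincomb_map 0 r f g 1; rewrite scale1r => <-.
by under [X in _ <= `|lincomb 0 X|]eq_map do rewrite mul1r.
Qed.

Lemma nrm_mapZ I (r : seq I) (f : I -> R) a :
  nrm [seq a * f i | i <- r] = `|a| * nrm (map f r).
Proof.
rewrite /nrm -normrZ; congr `|_|; have := lincomb_map 0 r f (fun=> 0) a.
rewrite lincomb_map0 addr0 => <-; congr lincomb.
by apply: eq_map => i; rewrite addr0.
Qed.

Lemma nrm_map_sum I (r : seq I) (n : nat) (f : nat -> I -> R) :
  nrm [seq \sum_(k < n) f k i | i <- r] <= \sum_(k < n) nrm (map (f k) r).
Proof.
elim: n => [|n IH].
  rewrite big_ord0; under eq_map do rewrite big_ord0.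
  by rewrite /nrm lincomb_map0 normr0.
rewrite big_ord_recr/=; under eq_map do rewrite big_ord_recr/=.
by apply: le_trans (nrm_mapD _ _ _) _; rewrite lerD2r.
Qed.

Lemma nrm_cons_le x s : nrm s <= nrm (x :: s).
Proof.
apply: (@le_trans _ _ (nrm (0 :: s))); last first.
  by apply: (@nrm_shrink1 [::] 0 x s); rewrite normr0.
suff -> : nrm (0 :: s) = nrm s by [].
rewrite (@nrm_perm (0 :: s) (rcons s 0)); last by rewrite perm_sym perm_rcons.
by rewrite /nrm -cats1 lincomb_cat/= scale0r !addr0.
Qed.

Lemma nrm_cons0 s : nrm (0 :: s) = nrm s.
Proof.
rewrite (@nrm_perm (0 :: s) (rcons s 0)); last by rewrite perm_sym perm_rcons.
by rewrite /nrm -cats1 lincomb_cat/= scale0r !addr0.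
Qed.

Lemma nrm_catr s t : nrm t <= nrm (s ++ t).
Proof. by elim: s => //= x s IH; apply: le_trans IH (nrm_cons_le _ _). Qed.

Lemma nrm_catl s t : nrm s <= nrm (s ++ t).
Proof. by rewrite (@nrm_perm (s ++ t) (t ++ s)) ?nrm_catr// perm_catC. Qed.

Lemma nrm_cat_le s t : nrm (s ++ t) <= nrm s + nrm t.
Proof.
rewrite {1}/nrm lincomb_cat (le_trans (ler_normD _ _))// lerD2l.
apply: (@le_trans _ _ (nrm (nseq (size s) 0 ++ t))); last first.
  by elim: (size s) => //= n IH; rewrite nrm_cons0.
rewrite /nrm lincomb_cat size_nseq (_ : lincomb 0 (nseq _ _) = 0) ?add0r//.
by elim: (size s) 0%N => //= n IH k; rewrite IH scale0r addr0.
Qed.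

Lemma nrm_subseq s t : subseq s t -> nrm s <= nrm t.
Proof.
by move=> /perm_to_subseq[u /nrm_perm ->]; exact: nrm_catl.
Qed.

End symmetric_norm.

Lemma map_cst (I T : Type) (x : T) (r : seq I) : [seq x | _ <- r] = nseq (size r) x.
Proof. by elim: r => //= i r ->. Qed.

(** * Consequences of reflexivity: small tails and the growth of the fundamental function *)

Section reflexive_basis.
Context {R : realType} {X : normedModType R} (e : symmetric_basis X).
Implicit Types (s t : seq R) (x : nat -> R).

Lemma nrm_mkseq_mono x m n : (m <= n)%N -> nrm e (mkseq x m) <= nrm e (mkseq x n).
Proof.
move=> mn; have [k ->] : exists k, n = (m + k)%N by exists (n - m)%N; rewrite subnKC.
by rewrite /mkseq iotaD map_cat; exact: nrm_catl.
Qed.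

Lemma basis_coord : exists c : nat -> dual X,
  [/\ forall v, series (fun n => c n v *: e n) @ \oo --> v,
      forall i j, c i (e j) = (i == j)%:R
    & forall v n, nrm e (mkseq (fun i => c i v) n) <= `|v| ].
Proof.
have /choice[a aP] : forall v : X, exists b : nat -> R,
    unique (fun b => series (fun n => b n *: e n) @ \oo --> v) b.
  by move=> v; have [b [h1 h2]] := basis_schauder e v; exists b; split.
have a_cvg v : series (fun n => a v n *: e n) @ \oo --> v := (aP v).1.
have a_uniq v b : series (fun n => b n *: e n) @ \oo --> v -> a v = b.
  by move=> h; apply: (aP v).2.
have a_nrm v n : nrm e (mkseq (a v) n) <= `|v|.
  apply/ler_addgt0Pl => eps eps0.
  have [N _ NP] := (cvgrPdistC_lt _ _).1 (a_cvg v) eps eps0.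
  have := NP (maxn n N) (leq_maxr _ _) => /=; rewrite /series/= big_mkord => h.
  apply: le_trans (nrm_mkseq_mono _ (leq_maxl n N)) _; rewrite nrmE.
  set w := \sum_(_ < _) _ in h *.
  have := ler_normD (w - v) v; rewrite subrK; lra.
have a_lin n : linear (fun v => a v n : R^o).
  move=> b v w; rewrite (a_uniq _ (fun n => b *: a v n + a w n))//.
  rewrite (_ : series _ = fun n => b *: series (fun n => a v n *: e n) n +
    series (fun n => a w n *: e n) n).
    by apply: cvgD; [apply: cvgZl_tmp|].
  apply/funext => k; rewrite /series/= scaler_sumr -big_split/=.
  by apply: eq_bigr => i _; rewrite scalerDl scalerA.
have a_bd n v : `|a v n| <= `|e 0%N|^-1 * `|v|.
  rewrite ler_pdivlMl ?basis0_gt0// mulrC -nrm_seq1.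
  apply: le_trans (a_nrm v n.+1); apply: nrm_subseq.
  by rewrite /mkseq sub1seq; apply/mapP; exists n; rewrite // mem_iota/= add0n ltnSn.
have /choice[c cP] : forall n, exists d : dual X, forall v, d v = a v n.
  by move=> n; exact: ex_dual (a_lin n) (a_bd n).
exists c; split.
- move=> v; have -> : (fun n => c n v *: e n) = fun n => a v n *: e n.
    by apply/funext => n; rewrite cP.
  exact: a_cvg.
- move=> i j; rewrite cP (a_uniq _ (fun n => (n == j)%:R))//.
  apply: cvg_near_cst; exists j.+1 => // n /= jn.
  rewrite /series/= (bigD1_seq j) ?iota_uniq//=; last by rewrite mem_index_iota.
  by rewrite eqxx scale1r big1 ?addr0// => k /negPf ->; rewrite scale0r.
- by move=> v n; rewrite (eq_mkseq (g := a v)).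
Qed.

Definition pairing x s : R := \sum_(i < size s) s`_i * x i.

Lemma pairing_widen x s n : (size s <= n)%N -> pairing x s = \sum_(i < n) s`_i * x i.
Proof.
move=> sn; rewrite /pairing -(big_mkord xpredT (fun i => s`_i * x i)).
rewrite -(big_mkord xpredT (fun i => s`_i * x i)) [RHS](@big_cat_nat _ _ _ (size s))//=.
rewrite [X in _ + X]big1_seq ?addr0// => i; rewrite mem_index_iota => /andP[_ /andP[si _]].
by rewrite nth_default// mul0r.
Qed.

(** These are the coefficient sequences of functionals of norm at most 1 on the span of the basis.
    The condition survives coordinatewise limits. *)
Definition dual_sequence x := forall s, `|pairing x s| <= nrm e s.

Lemma dual_lincomb (phi : dual X) s : phi (lincomb e 0 s) = pairing (fun i => phi (e i)) s.
Proof.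
rewrite lincombE dual_sum; apply: eq_bigr => i _; rewrite dualZ.
by rewrite add0n.
Qed.

(** The partial sums of [x i *: c i] are bounded in the dual of X. A cluster point of them in the
    third dual, restricted to X along the canonical embedding, is the required functional. *)
Lemma dual_sequence_dual x : dual_sequence x ->
  exists phi : dual X, forall s, phi (lincomb e 0 s) = pairing x s.
Proof.
move=> dx; have [c [c_cvg c_delta c_nrm]] := basis_coord.
pose f n : dual X := \sum_(i < n) x i *: c i.
have fE n v : f n v = pairing x (mkseq (fun i => c i v) n).
  rewrite /pairing size_mkseq /f.
  have E : forall r, (\sum_(i <- r) x i *: c i : dual X) v = \sum_(i <- r) c i v * x i.
    move=> r; elim: r => [|i r IH]; first by rewrite !big_nil.
    by rewrite !big_cons -IH mulrC.
  have := E (index_iota 0 n); rewrite !big_mkord => ->.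
  by apply: eq_bigr => i _; rewrite nth_mkseq.
have f1 n : `|f n| <= 1.
  apply: dual_norm_leP => // v; rewrite fE mul1r; exact: le_trans (dx _) (c_nrm v n).
have [F [Flim _]] := bounded_bidual_cluster f1.
have lF : linear (fun v : X => F (bidual_emb v)).
  move=> b v w; have -> : bidual_emb (b *: v + w) = b *: bidual_emb v + bidual_emb w.
    by apply/val_inj/funext => phi /=; rewrite dualD dualZ.
  by rewrite dualD dualZ.
have [|phi phiE] := @ex_dual R X (fun v => F (bidual_emb v)) `|F| lF.
  move=> v; apply: le_trans (dual_le _ _) _; rewrite ler_wpM2l//.
  by apply: dual_norm_leP => // psi; rewrite mulrC; exact: (dual_le psi v).
exists phi => s; rewrite phiE; apply: Flim.
apply: cvg_near_cst; exists (size s) => // n /= sn.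
rewrite fE (pairing_widen _ sn) (@pairing_widen _ _ n) ?size_mkseq//.
apply: eq_bigr => i _; rewrite nth_mkseq// dual_lincomb; congr (_ * _).
rewrite (pairing_widen _ sn) (bigD1 i)//= c_delta eqxx mulr1 big1 ?addr0// => k.
by rewrite -val_eqE/= => /negPf ki; rewrite c_delta eq_sym ki mulr0.
Qed.

Hypothesis reflX : reflexive_space X.

(* A dual sequence with non-vanishing tails would be bounded below on a bounded
   sequence whose coordinates tend to [0]; reflexivity gives that sequence a weak
   cluster point, which must be [0]. *)
Lemma dual_sequence_tail x eps : dual_sequence x -> 0 < eps ->
  exists K, forall s, (forall i, (i < K)%N -> s`_i = 0) ->
    `|pairing x s| <= eps * nrm e s.
Proof.
move=> dx eps0; apply: contrapT => hno.
have /choice[u uP] : forall K, exists s, (forall i, (i < K)%N -> s`_i = 0) /\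
    eps * nrm e s < `|pairing x s|.
  move=> K; apply: contrapT => hK; apply: hno; exists K => s s0.
  by rewrite leNgt; apply/negP => h; apply: hK; exists s.
have p0 K : pairing x (u K) != 0.
  rewrite -normr_gt0; apply: le_lt_trans (uP K).2.
  by rewrite mulr_ge0 ?nrm_ge0// ltW.
pose v K := (pairing x (u K))^-1 *: lincomb e 0 (u K).
have vB K : `|v K| <= eps^-1.
  rewrite normrZ normfV -/(nrm e (u K)) ler_pdivrMl ?normr_gt0//.
  by rewrite mulrC ler_pdivlMl// ltW// (uP K).2.
have [phi phiE] := dual_sequence_dual dx.
have [c [c_cvg c_delta c_nrm]] := basis_coord.
have [F [Flim _]] := bounded_bidual_cluster vB.
have F1 : F phi = 1.
  apply: Flim; rewrite (_ : (fun n => _) = fun=> 1); first exact: cvg_cst.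
  by apply/funext => n; rewrite /v dualZ phiE /= [_ *: _]mulVf.
have [w _ wF] : range (@bidual_emb R X) F by rewrite reflX.
have cw i : c i w = 0.
  rewrite -[LHS]/(bidual_emb w (c i)) wF; apply: Flim.
  apply: cvg_near_cst; exists i.+1 => // n /= ilt.
  rewrite /v dualZ dual_lincomb (_ : pairing (fun j => c i (e j)) _ = 0) ?scaler0//.
  rewrite /pairing big1// => k _.
  rewrite c_delta; case: eqVneq => [ik|_]; last by rewrite mulr0.
  by rewrite (uP n).1 ?mul0r// -ik.
have w0 : w = 0.
  apply: (cvg_unique _ (c_cvg w)) => //.
  rewrite (_ : series _ = fun=> 0); first exact: cvg_cst.
  apply/funext => n; rewrite /series/= big1// => i _.
  by rewrite cw scale0r.
move: F1; rewrite -wF /= w0 dual0 => /eqP.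
by rewrite eq_sym oner_eq0.
Qed.

Lemma nrm_nseq0 n s : nrm e (nseq n 0 ++ s) = nrm e s.
Proof. by elim: n => //= n IH; rewrite nrm_cons0. Qed.

Lemma lincomb_nseq0 k n : lincomb e k (nseq n 0) = 0.
Proof. by elim: n k => //= n IH k; rewrite IH scale0r addr0. Qed.

Lemma pairing_nseq x n : pairing x (nseq n 1) = \sum_(i < n) x i.
Proof.
rewrite (@pairing_widen _ _ n) ?size_nseq//; apply: eq_bigr => i _.
by rewrite nth_nseq ltn_ord mul1r.
Qed.

Lemma basis_norm n : `|e n| = `|e 0%N|.
Proof.
have := nrm_nseq0 n [:: 1]; rewrite nrm_seq1 normr1 mul1r => <-.
by rewrite /nrm lincomb_cat size_nseq lincomb_nseq0/= scale1r addr0 add0r.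
Qed.

(** The fundamental function of the basis. That it is unbounded reflects the absence of c_0 in X,
    that it is o(n) the absence of l_1. *)
Definition fundamental n : R := nrm e (nseq n 1).

(** Otherwise the sums of the first n basis vectors are bounded, and by reflexivity they have a weak
    cluster point. All its coordinates are 1, so its expansion cannot converge. *)
Lemma fundamental_unbounded M : exists n, M < fundamental n.
Proof.
apply: contrapT => hno.
have hM n : `|lincomb e 0 (nseq n 1)| <= M.
  by rewrite -/(nrm e _) leNgt; apply/negP => h; apply: hno; exists n.
have [c [c_cvg c_delta c_nrm]] := basis_coord.
have [F [Flim _]] := bounded_bidual_cluster hM.
have [w _ wF] : range (@bidual_emb R X) F by rewrite reflX.
have cw i : c i w = 1.
  rewrite -[LHS]/(bidual_emb w (c i)) wF; apply: Flim.
  apply: cvg_near_cst; exists i.+1 => // n /= ilt.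
  rewrite dual_lincomb pairing_nseq (bigD1 (Ordinal ilt))//= c_delta eqxx.
  rewrite big1 ?addr0// => k.
  by rewrite -val_eqE/= c_delta eq_sym => /negPf ->.
have cvgs : cvgn (series (fun n => c n w *: e n)) by apply/cvg_ex; exists w.
have := cvg_series_cvg_0 cvgs.
move=> /cvgrPdistC_lt/(_ _ (basis0_gt0 e))[N _ /(_ N (leqnn N))/=].
by rewrite cw scale1r subr0 basis_norm ltxx.
Qed.

Lemma fundamental_le n m : (n <= m)%N -> fundamental n <= fundamental m.
Proof.
move=> nm; rewrite /fundamental -(subnKC nm) nseqD; exact: nrm_catl.
Qed.

(* Averaging over rotations shows that [fundamental n >= eta * n] for all [n] would
   make the constant sequence [eta] a dual sequence. *)
Lemma fundamental_sublinear eta : 0 < eta -> exists2 n, (0 < n)%N & fundamental n <= eta * n%:R.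
Proof.
move=> eta0; apply: contrapT => hno.
have hn n : (0 < n)%N -> eta * n%:R < fundamental n.
  by move=> n0; rewrite ltNge; apply/negP => h; apply: hno; exists n.
have dx : dual_sequence (fun=> eta).
  move=> s; have [->|s0] := eqVneq s [::].
    by rewrite /pairing big_ord0 normr0 nrm_ge0.
  have n0 : (0 < size s)%N by case: s s0.
  set n := size s in n0; set S := \sum_(i < n) s`_i.
  have -> : pairing (fun=> eta) s = S * eta by rewrite /pairing -mulr_suml.
  have E : nrm e [seq \sum_(k < n) (rot k s)`_i | i <- iota 0 n] <= n%:R * nrm e s.
    apply: le_trans (nrm_map_sum e _ _ (fun k i => (rot k s)`_i)) _.
    rewrite mulr_natl -[n in X in _ <= X]card_ord -sumr_const; apply: ler_sum => k _.
    rewrite -[X in nrm e X]/(mkseq (nth 0 (rot k s)) n).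
    have mk j (r : seq R) : j = size r -> mkseq (nth 0 r) j = r by move=> ->; exact: mkseq_nth.
    by rewrite mk ?size_rot// (@nrm_perm _ _ e (rot k s) s) ?perm_rot.
  have SE i : (i < n)%N -> \sum_(k < n) (rot k s)`_i = S.
    move=> ilt; pose r (k : 'I_n) : 'I_n := Ordinal (ltn_pmod (k + i) n0).
    have rI : injective r.
      move=> k k' /(congr1 val)/= /eqP; rewrite eqn_modDr !modn_small// => /eqP.
      exact: val_inj.
    rewrite /S [RHS](reindex_inj rI)/=; apply: eq_bigr => k _.
    rewrite /rot nth_cat size_drop -/n nth_drop; case: ltnP => h.
      by rewrite modn_small//; move: h; have := ltn_ord k; lia.
    rewrite nth_take; last by have := ltn_ord k; lia.
    have -> : (k + i = (i - (n - k)) + n)%N by have := ltn_ord k; lia.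
    by rewrite modnDr modn_small//; have := ltn_ord k; lia.
  have {}E : `|S| * fundamental n <= n%:R * nrm e s.
    apply: le_trans E; rewrite /fundamental.
    have -> : nseq n (1 : R) = [seq 1 | i <- iota 0 n] by rewrite map_cst size_iota.
    rewrite -nrm_mapZ; apply: nrm_map_le => i; rewrite mem_iota add0n /= => ilt.
    by rewrite SE// mulr1.
  rewrite normrM (gtr0_norm eta0) -(@ler_pM2l _ n%:R) ?ltr0n//.
  apply: le_trans E; rewrite mulrCA ler_wpM2l// mulrC ltW//.
  exact: hn.
(* A constant sequence has no small tail: testing it on one basis vector beyond [K] gives
   [eta <= eta / 2]. *)
have B0 := basis0_gt0 e; have eB : 0 < eta / (2 * `|e 0%N|) by rewrite divr_gt0// mulr_gt0.
have [K KP] := dual_sequence_tail dx eB.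
have := KP (nseq K 0 ++ [:: 1]) _; rewrite nrm_nseq0 nrm_seq1 normr1 mul1r.
have -> : pairing (fun=> eta) (nseq K 0 ++ [:: 1]) = eta.
  rewrite /pairing -mulr_suml size_cat size_nseq addn1 big_ord_recr/=.
  rewrite nth_cat size_nseq ltnn subnn/=.
  by rewrite big1 ?add0r ?mul1r// => i _; rewrite nth_cat size_nseq ltn_ord nth_nseq ltn_ord.
rewrite gtr0_norm// => /(_ _)/wrap[i iK|].
  by rewrite nth_cat size_nseq iK nth_nseq iK.
rewrite invfM mulrA mulfVK ?gt_eqF//; lra.
Qed.

(* Only boundedly many entries of [m] exceed [tau]; they contribute little since
   every [c i] is small, and the others contribute at most [tau * A]. *)
Lemma sum_split_le (n k : nat) (c m : nat -> R) (tau kap B A : R) :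
  0 <= tau -> 0 <= kap -> 0 <= B ->
  (forall i, (i < n)%N -> `|c i| <= kap) -> (forall i, (i < n)%N -> `|m i| <= B) ->
  \sum_(i < n) `|c i| <= A ->
  (count (fun i => tau < `|m i|)%R (iota 0 n) <= k)%N ->
  \sum_(i < n) `|c i * m i| <= k%:R * (kap * B) + tau * A.
Proof.
move=> tau0 kap0 B0 ck mB cA cnt.
have kB : 0 <= kap * B by rewrite mulr_ge0.
apply: (@le_trans _ _ ((count (fun i => tau < `|m i|) (iota 0 n))%:R * (kap * B) +
    tau * \sum_(i < n) `|c i|)); last first.
  by apply: lerD; [rewrite ler_wpM2r// ler_nat | rewrite ler_wpM2l].
elim: n ck mB {cA cnt} => [|n IH] ck mB; first by rewrite !big_ord0/= mul0r mulr0 addr0.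
have {}IH := IH (fun i h => ck i (ltnW h)) (fun i h => mB i (ltnW h)).
rewrite -[in iota 0 n.+1]addn1 iotaD count_cat [count _ (iota (0 + n) 1)]/= add0n addn0 natrD.
rewrite !big_ord_recr/=.
have := ck n (ltnSn n); have := mB n (ltnSn n); have := normr_ge0 (c n).
have := normr_ge0 (m n); rewrite normrM.
have [h|h] := ltP tau `|m n| => m0 c0 h1 h2.
  have : `|c n| * `|m n| <= kap * B by apply: ler_pM.
  have : 0 <= tau * `|c n| by rewrite mulr_ge0.
  by rewrite /= !mulrDl !mulrDr mul1r; move: IH; lra.
have : `|c n| * `|m n| <= tau * `|c n| by rewrite mulrC ler_wpM2r.
by rewrite /= !mulrDl !mulrDr mul0r; move: IH; lra.
Qed.

(** Chebyshev's inequality for the norm of X, with the fundamental function in the place of the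
    counting measure. *)
Lemma nrm_count_le (I : eqType) (r : seq I) (f : I -> R) (tau : R) : 0 <= tau ->
  tau * fundamental (count (fun i => tau < `|f i|) r) <= nrm e (map f r).
Proof.
move=> tau0; set P := fun i => _.
have -> : tau * fundamental (count P r) = nrm e [seq tau | i <- [seq j <- r | P j]].
  rewrite /fundamental -size_filter.
  have -> : nseq (size ([seq i <- r | P i])) (1 : R) = [seq 1 | i <- [seq j <- r | P j]].
    by rewrite map_cst.
  by rewrite -{1}(ger0_norm tau0) -nrm_mapZ; under eq_map do rewrite mulr1.
apply: (@le_trans _ _ (nrm e (map f ([seq i <- r | P i])))).
  apply: nrm_map_le => i; rewrite mem_filter => /andP[Pi _].
  by rewrite ger0_norm// ltW.
by apply: nrm_subseq; apply: map_subseq; exact: filter_subseq.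
Qed.

(** As the fundamental function is unbounded, an [m] in the unit ball has at most [k] entries above
    [tau], with [k] independent of [m]. Those contribute at most [k * kap / |e 0|] and the others at
    most [tau * A']; both constants are chosen to give [eta / 2]. *)
Lemma small_pairing (A eta : R) : 0 < eta -> exists2 kap, 0 < kap &
  forall n (c m : nat -> R), (forall i, (i < n)%N -> `|c i| <= kap) ->
    \sum_(i < n) `|c i| <= A -> nrm e (mkseq m n) <= 1 ->
    \sum_(i < n) `|c i * m i| <= eta.
Proof.
move=> eta0; pose A' := `|A| + 1; have A0 : 0 < A' by rewrite ltr_wpDl.
pose tau := eta / 2 / A'; have tau0 : 0 < tau by rewrite !divr_gt0.
have [k kP] := fundamental_unbounded tau^-1.
have B0 := basis0_gt0 e.
have Bi : 0 <= `|e 0%N|^-1 by rewrite invr_ge0.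
pose kap := eta / 2 * `|e 0%N| / (k%:R + 1).
have k1 : 0 < k%:R + 1 :> R by rewrite ltr_wpDl.
have kap0 : 0 < kap by rewrite divr_gt0// mulr_gt0// divr_gt0.
exists kap => // n c m ck cA m1.
apply: le_trans (@sum_split_le n k c m tau kap `|e 0%N|^-1 A' _ _ _ _ _ _ _) _ => //.
- exact: ltW.
- exact: ltW.
- move=> i ilt; rewrite -[leRHS]mul1r ler_pdivlMr// -nrm_seq1.
  apply: le_trans m1; apply: nrm_subseq; rewrite sub1seq.
  by apply/mapP; exists i; rewrite // mem_iota.
- by apply: le_trans cA _; rewrite (le_trans (ler_norm _))// lerDl.
- rewrite leqNgt; apply/negP => /ltnW/fundamental_le h.
  have := le_trans (@nrm_count_le _ (iota 0 n) m tau (ltW tau0)) m1.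
  have : tau * tau^-1 < tau * fundamental k by rewrite ltr_pM2l.
  rewrite mulfV ?gt_eqF// => h1 h2.
  have : tau * fundamental k <= tau * fundamental (count (fun i => tau < `|m i|) (iota 0 n)).
    by rewrite ler_pM2l.
  lra.
rewrite [leRHS]splitr lerD//.
  have -> : kap * `|e 0%N|^-1 = eta / 2 / (k%:R + 1).
    by rewrite /kap; field; rewrite !gt_eqF.
  by rewrite mulrA ler_pdivrMr// mulrC ler_pM2l ?divr_gt0// lerDl.
by rewrite /tau mulfVK ?gt_eqF.
Qed.

Lemma nrm_indicator (I : eqType) (r : seq I) (P : pred I) :
  nrm e [seq (P i)%:R | i <- r] = fundamental (count P r).
Proof.
have := permEl (perm_filterC P r); rewrite perm_sym => /(perm_map (fun i => (P i)%:R : R)).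
move=> /(nrm_perm e) ->; rewrite map_cat.
have -> : [seq (P i)%:R | i <- [seq i <- r | P i]] = nseq (count P r) (1 : R).
  rewrite -size_filter -map_cst; apply/eq_in_map => i.
  by rewrite mem_filter => /andP[->].
have -> : [seq (P i)%:R | i <- [seq i <- r | predC P i]] =
    nseq (size [seq i <- r | predC P i]) (0 : R).
  rewrite -map_cst; apply/eq_in_map => i.
  by rewrite mem_filter /= => /andP[/negPf ->].
rewrite (@nrm_perm _ _ e _ (nseq (size [seq i <- r | predC P i]) 0 ++ nseq (count P r) 1)).
  by rewrite nrm_nseq0.
by rewrite perm_catC.
Qed.

(** Subadditivity extends the bound from one n to its multiples; rounding k up to a multiple of n
    costs the factor 2 put into [e2]. *)
Lemma fundamental_small (eta : R) : 0 < eta ->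
  exists n, forall k, (n <= k)%N -> fundamental k <= eta * k%:R.
Proof.
move=> eta0; have e2 : 0 < eta / 2 by rewrite divr_gt0.
have [n n0 nP] := fundamental_sublinear e2.
have mulP q : fundamental (q * n) <= q%:R * fundamental n.
  elim: q => [|q IH]; first by rewrite mul0r /fundamental /= nrm_nil.
  rewrite mulSn /fundamental nseqD; apply: le_trans (nrm_cat_le _ _ _) _.
  by rewrite -[q.+1]add1n natrD mulrDl mul1r lerD2l.
exists n => k nk; have q1 : (0 < k %/ n)%N by rewrite divn_gt0.
have kq : (k <= (k %/ n).+1 * n)%N by apply/ltnW; exact: ltn_ceil.
apply: le_trans (fundamental_le kq) _; apply: le_trans (mulP _) _.
apply: (@le_trans _ _ ((k %/ n).+1%:R * (eta / 2 * n%:R))); first by rewrite ler_wpM2l.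
have -> : (k %/ n).+1%:R * (eta / 2 * n%:R) = eta * (((k %/ n).+1 * n)%N%:R / 2).
  by rewrite natrM; field.
rewrite ler_pM2l// ler_pdivrMr// -natrM ler_nat.
apply: (@leq_trans ((k %/ n * 2) * n)); first by rewrite leq_mul2r; lia.
by rewrite mulnAC leq_mul2r leq_trunc_div orbT.
Qed.

(** The dual counterpart of [small_pairing]: a norming functional takes the place of [m], and the
    sublinear growth of the fundamental function bounds the number of its large coordinates. It is
    what places Lipschitz functions in V_X^0. *)
Lemma small_nrm (A eta : R) : 0 < eta -> exists2 kap, 0 < kap &
  forall n (c : nat -> R), (forall i, (i < n)%N -> `|c i| <= kap) ->
    \sum_(i < n) `|c i| <= A -> nrm e (mkseq c n) <= eta.
Proof.
move=> eta0; pose A' := `|A| + 1; have A0 : 0 < A' by rewrite ltr_wpDl.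
pose tau := eta / 2 / A'; have tau0 : 0 < tau by rewrite !divr_gt0.
have [|k kP] := @fundamental_small (tau / 2); first by rewrite divr_gt0.
have B0 := basis0_gt0 e.
pose kap := eta / 2 / `|e 0%N| / (k%:R + 1).
have k1 : 0 < k%:R + 1 :> R by rewrite ltr_wpDl.
have kap0 : 0 < kap by rewrite divr_gt0// divr_gt0// divr_gt0.
exists kap => // n c ck cA.
have [phi [phi1 phiE]] := ex_norming (lincomb e 0 (mkseq c n)).
pose x i := phi (e i).
have -> : nrm e (mkseq c n) = \sum_(i < n) c i * x i.
  rewrite /nrm -phiE dual_lincomb (@pairing_widen _ _ n) ?size_mkseq//.
  by apply: eq_bigr => i _; rewrite nth_mkseq.
apply: le_trans (ler_norm _) _; apply: le_trans (ler_norm_sum _ _ _) _.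
apply: le_trans (@sum_split_le n k c x tau kap `|e 0%N| A' _ _ _ _ _ _ _) _ => //.
- exact: ltW.
- exact: ltW.
- by move=> i _; rewrite -(basis_norm i); exact: phi1.
- by apply: le_trans cA _; rewrite (le_trans (ler_norm _))// lerDl.
- rewrite leqNgt; apply/negP => kc; set P := (fun i => _) in kc.
  (* With more than [k] coordinates above [tau], testing [phi] on their signs bounds the fundamental
     function from below by [tau] times their number, twice what [kP] allows. *)
  pose s := [seq Num.sg (x i) * (P i)%:R | i <- iota 0 n].
  have s_le : nrm e s <= fundamental (count P (iota 0 n)).
    rewrite -nrm_indicator; apply: nrm_map_le => i _.
    by rewrite normrM normr_sg ler_piMl//; case: (x i == 0); rewrite //= ler01.
  have : pairing x s <= nrm e s.
    rewrite -dual_lincomb (le_trans (ler_norm _))// (le_trans (phi1 _))//.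
  have -> : pairing x s = \sum_(i < n) `|x i| * (P i)%:R.
    rewrite (@pairing_widen _ _ n) ?size_map ?size_iota//; apply: eq_bigr => i _.
    rewrite (nth_map 0%N) ?size_iota// nth_iota// add0n mulrAC -normrEsg.
    reflexivity.
  move=> h; have := kP _ (ltnW kc).
  have : tau * (count P (iota 0 n))%:R <= \sum_(i < n) `|x i| * (P i)%:R.
    rewrite -sum1_count natr_sum mulr_sumr -(big_mkord xpredT (fun i => `|x i| * (P i)%:R)).
    rewrite [leRHS](bigID P)/= [X in _ <= _ + X]big1 ?addr0; last first.
      by move=> i /negPf ->; rewrite mulr0.
    by rewrite /index_iota subn0; apply: ler_sum => i Pi; rewrite Pi !mulr1 ltW.
  have : 0 < tau * (count P (iota 0 n))%:R.
    by rewrite mulr_gt0// ltr0n (leq_trans _ kc).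
  by lra.
rewrite [leRHS]splitr lerD//.
  have -> : kap * `|e 0%N| = eta / 2 / (k%:R + 1).
    by rewrite /kap; field; rewrite !gt_eqF.
  by rewrite mulrA ler_pdivrMr// mulrC ler_pM2l ?divr_gt0// lerDl.
by rewrite /tau mulfVK ?gt_eqF.
Qed.

End reflexive_basis.

(** * Partitions and families of intervals *)

Section families.
Context {R : realType}.
Local Notation U := (unit_itv R).
Implicit Types (u v x : U) (s : seq U) (c : U * U) (I J : seq (U * U)).

Definition pos u : R := \val u.
Definition ule u v := pos u <= pos v.
Definition ult u v := pos u < pos v.

Definition cells x s : seq (U * U) := pairmap pair x s.
Definition len c : R := pos c.2 - pos c.1.
Definition df (f : U -> R^o) c : R := f c.2 - f c.1.

Definition unit_itv1 : U := clamp 1.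

Lemma unit_itv_bounds u : 0 <= pos u <= 1.
Proof. by have := set_mem (valP u); rewrite /unit_itv/= in_itv. Qed.

Lemma pos_inj : injective pos. Proof. exact: val_inj. Qed.

Lemma pos_clamp (r : R) : 0 <= r <= 1 -> pos (clamp r) = r.
Proof. exact: clampE. Qed.

Lemma unit_itv1E : pos unit_itv1 = 1 :> R.
Proof. by rewrite pos_clamp// ler01 lexx. Qed.

Lemma cells_cat x s1 s2 : cells x (s1 ++ s2) = cells x s1 ++ cells (last x s1) s2.
Proof. by rewrite /cells pairmap_cat. Qed.

Lemma path_cells_len x s : path ule x s -> all (fun c => 0 <= len c) (cells x s).
Proof.
by elim: s x => //= y s IH x /andP[xy /IH ->]; rewrite andbT /len/= subr_ge0.
Qed.

Lemma cells_sum_len x s : \sum_(c <- cells x s) len c = pos (last x s) - pos x.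
Proof.
elim: s x => [|y s IH] x /=; first by rewrite big_nil subrr.
by rewrite big_cons IH /len/=; ring.
Qed.

Lemma path_iota (w : nat -> U) k n : (forall i, (k <= i < k + n)%N -> ule (w i) (w i.+1)) ->
  path ule (w k) [seq w i | i <- iota k.+1 n].
Proof.
elim: n k => //= n IH k h; rewrite h ?leqnn/=; last by lia.
by apply: IH => i hi; apply: h; lia.
Qed.

Lemma cells_iota (w : nat -> U) k n :
  cells (w k) [seq w i | i <- iota k.+1 n] = [seq (w i, w i.+1) | i <- iota k n].
Proof. by elim: n k => //= n IH k; rewrite IH. Qed.

(* Finite families of non-overlapping intervals, up to order. *)
Definition interval_family I :=
  exists x s L, [/\ path ule x s, subseq L (cells x s) & perm_eq I L].

Lemma family_cells x s : path ule x s -> interval_family (cells x s).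
Proof. by move=> p; exists x, s, (cells x s); split. Qed.

Lemma family_perm I I' : perm_eq I' I -> interval_family I -> interval_family I'.
Proof.
move=> II' [x [s [L [p sL IL]]]]; exists x, s, L; split=> //.
exact: perm_trans IL.
Qed.

Lemma family_subseq I I' : subseq I' I -> interval_family I -> interval_family I'.
Proof.
move=> /perm_to_subseq[K IK] [x [s [L [p sL IL]]]].
have /count_subseqP[L' sL' pL'] : forall c, (count_mem c I' <= count_mem c (cells x s))%N.
  move=> c; apply: (@leq_trans (count_mem c L)); last exact: leq_count_subseq.
  have /permP <- := IL; have /permP -> := IK; rewrite count_cat; exact: leq_addr.
by exists x, s, L'; split.
Qed.

Lemma family_len_ge0 I c : interval_family I -> c \in I -> 0 <= len c.
Proof.
move=> [x [s [L [p sL IL]]]] cI; have /allP := path_cells_len p; apply.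
by apply: (mem_subseq sL); rewrite -(perm_mem IL).
Qed.

Lemma family_sum_len I : interval_family I -> \sum_(c <- I) len c <= 1.
Proof.
move=> [x [s [L [p sL IL]]]]; rewrite (perm_big _ IL)/=.
have [K LK] := perm_to_subseq sL.
have := cells_sum_len x s; rewrite (perm_big _ LK)/= big_cat/=.
have : 0 <= \sum_(c <- K) len c.
  rewrite big_seq sumr_ge0// => c cK; have /allP := path_cells_len p; apply.
  by rewrite (perm_mem LK) mem_cat cK orbT.
have /andP[x0 _] := unit_itv_bounds x; have /andP[_ s1] := unit_itv_bounds (last x s).
lra.
Qed.

Lemma ex_fine_path (eps : R) u v : 0 < eps -> ule u v -> exists s,
  [/\ path ule u s, last u s = v & all (fun c => len c <= eps) (cells u s)].
Proof.
move=> eps0 uv.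
have [n] : exists n : nat, pos v - pos u <= n%:R * eps.
  exists (Num.truncn ((pos v - pos u) / eps)).+1.
  by rewrite -ler_pdivrMr// ltW// truncnS_gt.
elim: n u uv => [|n IH] u uv.
  rewrite mul0r subr_le0 => vu; exists [:: v] => /=.
  rewrite uv /= /len/= andbT; split=> //; apply: le_trans (ltW eps0).
  by rewrite subr_le0.
have [le1 _|gt1] := leP (pos v - pos u) eps.
  by exists [:: v]; rewrite /= uv /len/= le1.
rewrite -addn1 natrD mulrDl mul1r => h.
have bu := unit_itv_bounds u; have bv := unit_itv_bounds v.
pose w : U := clamp (pos u + eps).
have wE : pos w = pos u + eps by rewrite pos_clamp//; move: bu bv; lra.
have uw : ule u w by rewrite /ule wE lerDl ltW.
have [||s [ps ls alls]] := IH w.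
- by rewrite /ule wE; lra.
- by rewrite wE; lra.
by exists (w :: s); rewrite /= uw ps ls alls {1}/len/= wE addrAC subrr add0r lexx.
Qed.

(** The cells selected by the mask are kept, and each of the others is subdivided. *)
Lemma refine_path (eps : R) x s (m : bitseq) : 0 < eps -> path ule x s ->
  all (fun c => len c <= eps) (mask m (cells x s)) -> exists s',
  [/\ path ule x s', last x s' = last x s, all (fun c => len c <= eps) (cells x s')
    & subseq (mask m (cells x s)) (cells x s')].
Proof.
move=> eps0; elim: s x m => [|y s IH] x m /=.
  by move=> _ _; exists [::]; rewrite mask0.
move=> /andP[xy ps].
have fine : exists s', [/\ path ule x s', last x s' = y & all (fun c => len c <= eps) (cells x s')].
  exact: ex_fine_path.
case: m => [|[] m] /=.
- move=> _; have [s1 [p1 l1 a1]] := fine.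
  have [|s2 [p2 l2 a2 _]] := IH y [::] ps; first by rewrite mask0s.
  exists (s1 ++ s2); rewrite cat_path p1 l1 p2 last_cat l1 l2 cells_cat all_cat a1 l1 a2.
  by split=> //; rewrite sub0seq.
- move=> /andP[lxy am]; have [s2 [p2 l2 a2 m2]] := IH y m ps am.
  by exists (y :: s2); rewrite /= xy p2 l2 lxy a2 eqxx.
- move=> am; have [s1 [p1 l1 a1]] := fine.
  have [s2 [p2 l2 a2 m2]] := IH y m ps am.
  exists (s1 ++ s2); rewrite cat_path p1 l1 p2 last_cat l1 l2 cells_cat all_cat a1 l1 a2.
  by split=> //; apply: subseq_trans m2 (suffix_subseq _ _).
Qed.

Lemma strict_path x s : path ule x s -> exists s',
  [/\ path ult x s', last x s' = last x s
    & cells x s' = [seq c <- cells x s | c.1 != c.2]].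
Proof.
elim: s x => [|y s IH] x /=; first by exists [::].
move=> /andP[xy /IH[s' [p l cE]]].
case: eqVneq => [E|ne] /=; first by exists s'; rewrite E.
exists (y :: s'); rewrite /= p l cE; split=> //; rewrite andbT /ult lt_neqAle.
by apply/andP; split=> //; apply: contra ne => /eqP/pos_inj ->.
Qed.

Definition pcells (p : Defs.partition R) : seq (U * U) :=
  [seq (p i, p i.+1) | i <- iota 0 (psize p)].

Lemma pcells_path (p : Defs.partition R) :
  exists s, path ule (p 0%N) s /\ pcells p = cells (p 0%N) s.
Proof.
exists [seq p i | i <- iota 1 (psize p)]; split; last by rewrite cells_iota.
by apply: path_iota => i ip; apply: ltW; apply: partition_lt; lia.
Qed.

Lemma pcells_family (p : Defs.partition R) : interval_family (pcells p).
Proof. by have [s [ps ->]] := pcells_path p; exact: family_cells. Qed.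

Lemma path_partition s : path ult unit_itv0 s -> pos (last unit_itv0 s) = 1 ->
  exists p : Defs.partition R, pcells p = cells unit_itv0 s.
Proof.
move=> ps ls; pose q i := nth unit_itv0 (unit_itv0 :: s) i.
have q1 : pos (q (size s)) = 1 by rewrite /q -last_nth.
have lt i : (i < size s)%N -> pos (q i) < pos (q i.+1).
  by move=> h; have := (pathP unit_itv0 ps) i h.
exists (@Partition R (size s) q erefl q1 lt).
rewrite /pcells/=; apply: (@eq_from_nth _ (unit_itv0, unit_itv0)).
  by rewrite size_map size_iota size_pairmap.
move=> i; rewrite size_map size_iota => h.
by rewrite (nth_map 0%N) ?size_iota// nth_iota// (nth_pairmap unit_itv0)// add0n.
Qed.

Lemma mesh_le (p : Defs.partition R) (eps : R) : 0 <= eps ->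
  all (fun c => len c <= eps) (pcells p) -> mesh p <= eps.
Proof.
move=> eps0 /allP h; apply/bigmax_leP; split=> // i _.
by apply: (h (p i, p i.+1)); apply/mapP; exists (nat_of_ord i); rewrite // mem_iota ltn_ord.
Qed.

Lemma pcells_len (p : Defs.partition R) c : c \in pcells p -> len c <= mesh p.
Proof.
move=> /mapP[i]; rewrite mem_iota add0n /= => ip ->.
exact: (@le_bigmax _ _ _ 0 (fun i : 'I_(psize p) => pos (p i.+1) - pos (p i)) (Ordinal ip)).
Qed.

Lemma pcells_len_gt0 (p : Defs.partition R) c : c \in pcells p -> 0 < len c.
Proof.
move=> /mapP[i]; rewrite mem_iota add0n /= => ip ->.
by rewrite subr_gt0; exact: partition_lt.
Qed.

Lemma nrm_map_filter (X : normedModType R) (e : symmetric_basis X) (J : eqType) (r : seq J)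
    (P : pred J) (g : J -> R) :
  (forall i, ~~ P i -> g i = 0) -> nrm e (map g [seq i <- r | P i]) = nrm e (map g r).
Proof.
move=> g0; have := permEl (perm_filterC P r); rewrite perm_sym => /(perm_map g).
move=> /(nrm_perm e) ->; rewrite map_cat (nrm_perm e (permEl (perm_catC _ _))).
have -> : map g [seq i <- r | predC P i] = nseq (size [seq i <- r | predC P i]) 0.
  by rewrite -map_cst; apply/eq_in_map => i; rewrite mem_filter => /andP[/g0].
by rewrite nrm_nseq0.
Qed.

(** This transfers bounds over partitions, also those restricted to small mesh, to interval
    families. Degenerate intervals are dropped because the points of a partition increase strictly;
    their increments vanish anyway. *)
Lemma family_refine I (eps : R) : 0 < eps -> interval_family I ->
  all (fun c => len c <= eps) I -> exists p : Defs.partition R, mesh p <= eps /\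
  exists2 L, subseq L (pcells p) & perm_eq [seq c <- I | c.1 != c.2] L.
Proof.
move=> eps0 [x [s [L [ps sL IL]]]] aI.
have [m _ Lm] := subseqP sL.
have aL : all (fun c => len c <= eps) (mask m (cells x s)) by rewrite -Lm -(perm_all _ IL).
have [s1 [p1 l1 a1 m1]] := refine_path eps0 ps aL.
have x0 : ule unit_itv0 x by have /andP[] := unit_itv_bounds x.
have l0 : ule (last x s1) unit_itv1.
  by rewrite /ule unit_itv1E; have /andP[] := unit_itv_bounds (last x s1).
have [s0 [p0 e0 a0]] := ex_fine_path eps0 x0.
have [s2 [p2 e2 a2]] := ex_fine_path eps0 l0.
have pS : path ule unit_itv0 (s0 ++ s1 ++ s2) by rewrite !cat_path p0 e0 p1 p2.
have aS : all (fun c => len c <= eps) (cells unit_itv0 (s0 ++ s1 ++ s2)).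
  by rewrite !cells_cat !all_cat a0 e0 a1 a2.
have [S [pS' lS cS]] := strict_path pS.
have [|p pE] := path_partition pS'.
  by rewrite lS !last_cat e0 e2 unit_itv1E.
exists p; split.
  apply: mesh_le; rewrite ?ltW// pE cS; apply/allP => c; rewrite mem_filter => /andP[_ cc].
  exact: (allP aS).
exists [seq c <- L | c.1 != c.2]; last exact: perm_filter.
rewrite pE cS subseq_filter filter_all/=; apply: subseq_trans (filter_subseq _ _) _.
by rewrite !cells_cat e0; apply: subseq_trans (suffix_subseq _ _);
   apply: subseq_trans (prefix_subseq _ _); rewrite Lm.
Qed.

End families.

(** * Membership criteria for V_X^0 and bounds over interval families *)

Section VX0_theory.
Context {R : realType} {X : normedModType R} (e : symmetric_basis X).
Local Notation U := (unit_itv R).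
Implicit Types (f : U -> R^o) (g : VX0 e) (p : Defs.partition R) (I : seq (U * U)).

Definition fnrm f I : R := nrm e (map (df f) I).

Lemma alpha_fnrm f p : alpha e f p = fnrm f (pcells p).
Proof. by rewrite nrm_alpha /fnrm /pcells -map_comp. Qed.

Lemma fnrm_mesh_le f (eps M : R) I : 0 < eps ->
  (forall p, mesh p <= eps -> alpha e f p <= M) ->
  interval_family I -> all (fun c => len c <= eps) I -> fnrm f I <= M.
Proof.
move=> eps0 fM fI aI; have [p [pe [L sL IL]]] := family_refine eps0 fI aI.
apply: le_trans (fM p pe); rewrite alpha_fnrm /fnrm.
rewrite -(@nrm_map_filter _ _ _ _ I (fun c => c.1 != c.2)); last first.
  by move=> c /negPn/eqP E; rewrite /df E subrr.
rewrite (nrm_perm e (perm_map _ IL)); apply: nrm_subseq; exact: map_subseq.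
Qed.

Lemma fnrm_le f (M : R) I : (forall p, alpha e f p <= M) -> interval_family I -> fnrm f I <= M.
Proof.
move=> fM fI; apply: (@fnrm_mesh_le f 1) => //; apply/allP => c cI.
rewrite /len; have /andP[_ ?] := unit_itv_bounds c.2.
have /andP[? _] := unit_itv_bounds c.1; lra.
Qed.

Lemma VX0_alpha_le g p : alpha e g p <= `|g|. Proof. exact: alpha_le_norm. Qed.

Lemma VX0_norm_le g M : (forall p, alpha e g p <= M) -> `|g| <= M.
Proof. exact: VX_norm_le. Qed.

Lemma VX0_fnrm_le g I : interval_family I -> fnrm g I <= `|g|.
Proof. by apply: fnrm_le => p; exact: VX0_alpha_le. Qed.

Lemma VX0_mesh g (eta : R) : 0 < eta -> exists2 eps, 0 < eps &
  forall p, mesh p <= eps -> alpha e g p <= eta.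
Proof.
move=> eta0; case: g => f fP /=; have [_ /mesh_variation_cvg0 h] := set_mem fP.
have [d /= d0 dP] := h eta eta0; exists (d / 2); first by rewrite divr_gt0.
apply: dP => /=; last by rewrite divr_gt0.
by rewrite distrC subr0 gtr0_norm ?divr_gt0// ltr_pdivrMr// ltr_pMr// ltr1n.
Qed.

Lemma VX0_fnrm_small g (eta : R) : 0 < eta -> exists2 eps, 0 < eps &
  forall I, interval_family I -> all (fun c => len c <= eps) I -> fnrm g I <= eta.
Proof.
move=> eta0; have [eps eps0 h] := VX0_mesh g eta0; exists eps => // I.
exact: fnrm_mesh_le.
Qed.

Lemma VX0_predP f (M : R) : f unit_itv0 = 0 -> (forall p, alpha e f p <= M) ->
  (forall eta : R, 0 < eta -> exists2 eps : R, 0 < eps &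
     forall p, mesh p <= eps -> alpha e f p <= eta) -> f \in VX0_pred e.
Proof.
move=> f0 fM fs; apply/mem_set; split.
  by split=> //; apply/variation_lty; exists M.
apply/mesh_variation_cvg0 => eta eta0; have [eps eps0 h] := fs eta eta0.
near=> r => p pr; apply: h; apply: (le_trans pr).
by near: r; exact: nbhs_right_le.
Unshelve. all: by end_near. Qed.

Lemma family1 (u v : U) : ule u v -> interval_family [:: (u, v)].
Proof. by move=> uv; apply: (@family_cells _ u [:: v]); rewrite /= uv. Qed.

Lemma VX0_le g (t : U) : `|g t| <= `|g| / `|e 0%N|.
Proof. by rewrite ler_pdivlMr ?basis0_gt0//; exact: VX0_eval_le. Qed.

Lemma VX0_uniform_continuous g (eta : R) : 0 < eta -> exists2 d, 0 < d &
  forall u v, `|pos u - pos v| <= d -> `|g u - g v| <= eta.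
Proof.
move=> eta0; have B0 := basis0_gt0 e.
have [d d0 h] := VX0_fnrm_small g (mulr_gt0 eta0 B0); exists d => // u v.
have key a b : ule a b -> `|pos a - pos b| <= d -> `|g b - g a| <= eta.
  move=> ab abd; rewrite -(ler_pM2r B0) -nrm_seq1.
  apply: h (family1 ab) _; rewrite /= andbT /len/= (le_trans _ abd)//.
  by rewrite distrC ler_norm.
have [uv|vu] := leP (pos u) (pos v); first by rewrite [X in X <= eta]distrC; exact: key.
by rewrite distrC; apply: key; exact: ltW.
Qed.

Lemma alpha_le_contract f f' p : (forall u v, `|f u - f v| <= `|f' u - f' v|) ->
  alpha e f p <= alpha e f' p.
Proof. by move=> h; rewrite !alpha_fnrm; apply: nrm_map_le => c _; exact: h. Qed.

Lemma VX0_contract g f : f unit_itv0 = 0 ->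
  (forall u v, `|f u - f v| <= `|g u - g v|) -> f \in VX0_pred e.
Proof.
move=> f0 fg; apply: (@VX0_predP _ `|g|) => // [p|eta eta0].
  exact: le_trans (alpha_le_contract p fg) (VX0_alpha_le g p).
have [eps eps0 h] := VX0_mesh g eta0; exists eps => // p /h.
exact: le_trans (alpha_le_contract p fg).
Qed.

Lemma cells_map (phi : U -> U) x s :
  cells (phi x) (map phi s) = [seq (phi c.1, phi c.2) | c <- cells x s].
Proof. by elim: s x => //= y s IH x; rewrite IH. Qed.

Lemma VX0_comp g (phi : U -> U) : (forall u v, ule u v -> ule (phi u) (phi v)) ->
  (forall u v, ule u v -> pos (phi v) - pos (phi u) <= pos v - pos u) ->
  (fun u => g (phi u) - g (phi unit_itv0)) \in VX0_pred e.
Proof.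
move=> phi_mono phi_contr; set f := (fun u => _).
have E p : alpha e f p = fnrm g [seq (phi c.1, phi c.2) | c <- pcells p].
  rewrite alpha_fnrm /fnrm -map_comp; congr nrm; apply: eq_map => c.
  by rewrite /df /f /=; ring.
have F p : interval_family [seq (phi c.1, phi c.2) | c <- pcells p].
  have [x [s [L [ps sL pL]]]] := pcells_family p.
  exists (phi x), (map phi s), [seq (phi c.1, phi c.2) | c <- L]; split.
  - by apply: homo_path ps => u v; exact: phi_mono.
  - by rewrite cells_map; exact: map_subseq.
  - exact: perm_map.
apply: (@VX0_predP _ `|g|) => [|p|eta eta0]; first by rewrite /f subrr.
  by rewrite E; exact: VX0_fnrm_le.
have [eps eps0 h] := VX0_fnrm_small g eta0; exists eps => // p pe.
rewrite E; apply: h (F p) _; apply/allP => _ /mapP[c cp ->].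
apply: le_trans pe; apply: le_trans (pcells_len cp).
by apply: phi_contr; rewrite /ule -subr_ge0; apply/ltW/(pcells_len_gt0 cp).
Qed.

Lemma alpha_diff f f' p : alpha e f p <= alpha e f' p + alpha e (fun u => f u - f' u) p.
Proof.
rewrite !alpha_fnrm /fnrm; apply: le_trans (nrm_mapD _ _ _ _).
rewrite le_eqVlt; apply/orP; left; apply/eqP; congr nrm; apply: eq_map => c.
by rewrite /df; ring.
Qed.

Lemma VX0_closed f : f unit_itv0 = 0 ->
  (forall eta : R, 0 < eta -> exists g, forall p, alpha e (fun u => f u - g u) p <= eta) ->
  f \in VX0_pred e.
Proof.
move=> f0 h; have [g gP] := h 1 ltr01.
apply: (@VX0_predP _ (`|g| + 1)) => // [p|eta eta0].
  apply: le_trans (alpha_diff f g p) _; apply: lerD => //; exact: VX0_alpha_le.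
have e2 : 0 < eta / 2 by rewrite divr_gt0.
have [g' g'P] := h _ e2; have [eps eps0 hg] := VX0_mesh g' e2; exists eps => // p pe.
apply: le_trans (alpha_diff f g' p) _; rewrite [leRHS]splitr; apply: lerD => //.
exact: hg.
Qed.

(** Along a fine partition the increments are individually small while their absolute values add up
    to at most [L], which is the situation of [small_nrm]. *)
Lemma VX0_lipschitz (reflX : reflexive_space X) f (L : R) : f unit_itv0 = 0 -> 0 < L ->
  (forall u v, `|f u - f v| <= L * `|pos u - pos v|) -> f \in VX0_pred e.
Proof.
move=> f0 L0 fL.
have S p : \sum_(i < psize p) `|f (p i.+1) - f (p i)| <= L.
  apply: (@le_trans _ _ (L * \sum_(c <- pcells p) len c)); last first.
    by rewrite -[leRHS]mulr1 ler_pM2l//; apply: family_sum_len; exact: pcells_family.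
  rewrite big_map mulr_sumr -(big_mkord xpredT (fun i => `|f (p i.+1) - f (p i)|)).
  rewrite /index_iota subn0 big_seq [leRHS]big_seq; apply: ler_sum => i ip.
  apply: le_trans (fL _ _) _; rewrite ler_pM2l// ger0_norm// /len/=.
  have : (p i, p i.+1) \in pcells p by apply/mapP; exists i.
  by move=> /pcells_len_gt0/ltW.
have E p : alpha e f p = nrm e (mkseq (fun i => f (p i.+1) - f (p i)) (psize p)).
  by rewrite nrmE.
apply: (@VX0_predP _ (L * `|e 0%N|)) => // [p|eta eta0].
  rewrite /alpha; apply: le_trans (ler_norm_sum _ _ _) _.
  under eq_bigr do rewrite normrZ basis_norm.
  by rewrite -mulr_suml ler_wpM2r.
have [kap kap0 kP] := small_nrm e reflX L eta0.
exists (kap / L); first by rewrite divr_gt0.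
move=> p pe; rewrite E; apply: kP => // i ip.
have ci : (p i, p i.+1) \in pcells p by apply/mapP; exists i; rewrite // mem_iota.
apply: le_trans (fL _ _) _; rewrite mulrC -ler_pdivlMr// ger0_norm; last first.
  exact/ltW/(pcells_len_gt0 ci).
exact: le_trans (pcells_len ci) pe.
Qed.

End VX0_theory.

(** * Functionals bounded by the supremum norm *)

Section real_induction.
Context {R : realType}.
Local Notation U := (unit_itv R).

(** Cousin's lemma. The points reachable from 0 by a chain of good cells have a supremum; the
    condition on its left makes it reachable, and the condition on its right forces it to be 1. *)
Lemma partition_induction (Q : U -> U -> Prop) :
  (forall t : U, exists2 eta : R, 0 < eta &
     (forall a, ule a t -> pos t - eta <= pos a -> Q a t) /\
     (forall b, ule t b -> pos b <= pos t + eta -> Q t b)) ->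
  exists p : Defs.partition R, forall c, c \in pcells p -> Q c.1 c.2.
Proof.
move=> loc.
pose ok x := exists s, [/\ path ule unit_itv0 s, last unit_itv0 s = x
  & forall c, c \in cells (unit_itv0 : U) s -> Q c.1 c.2].
pose S : set R := [set pos x | x in ok].
have S0 : S 0 by exists unit_itv0 => //; exists [::]; split.
have ubS : has_sup S.
  split; first by exists 0.
  by exists 1 => _ [x _ <-]; have /andP[] := unit_itv_bounds x.
have sup0 : 0 <= sup S by apply: ub_le_sup S0; case: ubS.
have sup1 : sup S <= 1.
  by apply: ge_sup; [exists 0 | move=> _ [x _ <-]; have /andP[] := unit_itv_bounds x].
pose t : U := clamp (sup S).
have tE : pos t = sup S by rewrite pos_clamp// sup0 sup1.
have ext x y : ok x -> ule x y -> Q x y -> ok y.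
  move=> [s [ps ls Qs]] xy Qxy; exists (rcons s y); split.
  - by rewrite rcons_path ps ls.
  - by rewrite last_rcons.
  - move=> c; rewrite -cats1 cells_cat ls mem_cat => /orP[/Qs//|].
    by rewrite /cells/= inE => /eqP ->.
have [eta eta0 [Ql Qr]] := loc t.
have [_ [x okx <-] xt] := sup_adherent eta0 ubS.
have le_sup y : ok y -> pos y <= sup S by move=> oky; apply: ub_le_sup; [case: ubS | exists y].
have okt : ok t.
  apply: (ext x) => //; first by rewrite /ule tE; exact: le_sup.
  by apply: Ql; [rewrite /ule tE; exact: le_sup | rewrite tE ltW].
pose b : U := clamp (Num.min (sup S + eta) 1).
have bE : pos b = Num.min (sup S + eta) 1.
  by rewrite pos_clamp// le_min ge_min lexx orbT ler01 !andbT addr_ge0// ltW.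
have tb : ule t b by rewrite /ule tE bE le_min sup1 lerDl ltW.
have okb : ok b.
  by apply: (ext t) => //; apply: Qr => //; rewrite bE tE ge_min lexx.
have b1 : pos b = 1.
  have := le_sup _ okb; rewrite bE; case: (leP (sup S + eta) 1) => // h1 h2.
  have : sup S < sup S + eta by rewrite ltrDl.
  by move=> /lt_le_trans/(_ h2); rewrite ltxx.
have [s [ps ls Qs]] := okb.
have [s' [ps' ls' cs']] := strict_path ps.
have [|p pE] := path_partition ps'; first by rewrite ls' ls.
exists p => c; rewrite pE cs' mem_filter => /andP[_]; exact: Qs.
Qed.

(** At most one cell contains [u] in its interior, so at most one term of the sum is not zero. *)
Lemma path_sum_le x (s : seq U) (u : U) (T : U * U -> R) (M : R) : path ule x s ->
  0 <= M -> (forall c, c \in cells x s -> `|T c| <= M) ->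
  (forall c, c \in cells x s -> ~~ (pos c.1 < pos u < pos c.2) -> T c = 0) ->
  `|\sum_(c <- cells x s) T c| <= M.
Proof.
move=> + M0; elim: s x => [|y s IH] x /=; first by rewrite big_nil normr0.
move=> /andP[xy ps] TM T0; rewrite big_cons.
have [uy|yu] := ltP (pos u) (pos y).
  rewrite [X in _ + X]big_seq big1 ?addr0; first by apply: TM; rewrite mem_head.
  move=> c cs; apply: T0; first by rewrite in_cons cs orbT.
  rewrite negb_and -leNgt; apply/orP; left; apply: le_trans (ltW uy) _.
  elim: s y ps cs {IH uy xy TM} => //= z s IH y /andP[yz ps].
  rewrite in_cons => /predU1P[->//|/(IH _ ps)]; exact: le_trans.
rewrite (T0 (x, y)) ?mem_head//; last by rewrite negb_and -!leNgt /= yu orbT.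
rewrite add0r; apply: IH => // c cs; [apply: TM | apply: T0]; by rewrite in_cons cs orbT.
Qed.

Lemma family_left x (s : seq U) (sg : U * U -> U) : path ule x s ->
  (forall c, c \in cells x s -> ule c.1 (sg c) /\ ule (sg c) c.2) ->
  interval_family [seq (c.1, sg c) | c <- cells x s].
Proof.
move=> ps h.
suff [s' [ps' ls' sub]] : exists s', [/\ path ule x s', last x s' = last x s &
    subseq [seq (c.1, sg c) | c <- cells x s] (cells x s')].
  by apply: (family_subseq sub); exact: family_cells.
elim: s x ps h => [|y s IH] x /=; first by exists [::].
move=> /andP[xy ps] h.
have [|s' [ps' ls' sub]] := IH y ps.
  by move=> c cs; apply: h; rewrite in_cons cs orbT.
have [h1 h2] := h _ (mem_head _ _).
exists (sg (x, y) :: y :: s'); rewrite /= h1 h2 ps' ls' eqxx; split=> //.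
exact: subseq_trans sub (subseq_cons _ _).
Qed.

End real_induction.

(** * Soft thresholding and piecewise linear interpolation *)

Section interpolation.
Context {R : realType} {X : normedModType R} (e : symmetric_basis X).
Local Notation U := (unit_itv R).
Local Notation V := (VX0 e).
Implicit Types (g h : V) (u t : U) (c : U * U) (p : Defs.partition R).

Lemma VX0_ext g h : (forall u, g u = h u) -> g = h.
Proof. by move=> gh; apply/val_inj/funext. Qed.

Lemma VX0_addE g h u : (g + h) u = g u + h u. Proof. by []. Qed.
Lemma VX0_oppE g u : (- g) u = - g u. Proof. by []. Qed.
Lemma VX0_scaleE (a : R) g u : (a *: g) u = a * g u. Proof. by []. Qed.
Lemma VX0_zeroE u : (0 : V) u = 0. Proof. by []. Qed.

Lemma VX0_sumE I (r : seq I) (F : I -> V) u : (\sum_(i <- r) F i) u = \sum_(i <- r) F i u.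
Proof. by elim/big_rec2 : _ => // i y1 y2 _ <-. Qed.

Lemma VX0_eq0 g : `|g| = 0 -> g = 0. Proof. by move/eqP; rewrite normr_eq0 => /eqP. Qed.

(** Soft thresholding: for [kap >= 0] it is 1-Lipschitz, zero on [[- kap, kap]] and within [kap] of
    the identity. *)
Definition trunc (kap x : R) : R := x - Num.max (- kap) (Num.min kap x).

Lemma trunc_lip kap x y : 0 <= kap -> `|trunc kap x - trunc kap y| <= `|x - y|.
Proof.
move=> k0; rewrite /trunc.
by case: (leP kap x) => h1; case: (leP kap y) => h2;
  [case: (leP (- kap) kap)|case: (leP (- kap) kap); case: (leP (- kap) y)
  |case: (leP (- kap) kap); case: (leP (- kap) x)
  |case: (leP (- kap) x); case: (leP (- kap) y)] => *;
  rewrite ler_norml; have := ler_norm (x - y); have := ler_normB 0 (x - y);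
  rewrite ?normr0 ?sub0r ?normrN => *; case: (ler0P (x - y)) => *; lra.
Qed.

Lemma trunc_eq0 kap x : `|x| <= kap -> trunc kap x = 0.
Proof.
rewrite ler_norml => /andP[h1 h2]; rewrite /trunc (min_idPr h2) (max_idPr h1).
by rewrite subrr.
Qed.

Lemma trunc_close kap x : 0 <= kap -> `|x - trunc kap x| <= kap.
Proof.
move=> k0; rewrite /trunc subKr ler_norml.
by rewrite le_max lexx/= ge_max ge_min lexx/= andbT; lra.
Qed.

Hypothesis reflX : reflexive_space X.

Definition umin u b : U := if pos u <= pos b then u else b.

Lemma pos_umin u b : pos (umin u b) = Num.min (pos u) (pos b).
Proof. by rewrite /umin; case: leP. Qed.

(* Identically [0] on degenerate cells, where [len c = 0]. *)
Definition ramp_fun c u : R :=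
  (Num.min (pos u) (pos c.2) - Num.min (pos u) (pos c.1)) / len c.

Lemma pos0 : pos unit_itv0 = 0 :> R. Proof. by []. Qed.

Lemma ramp_subproof c : ramp_fun c \in VX0_pred e.
Proof.
(* The summand 1 keeps the constant positive on degenerate cells, where the quotient is 0 by
   convention. *)
apply: (@VX0_lipschitz _ _ e reflX _ (2 / `|len c| + 1)).
- rewrite /ramp_fun pos0; have /andP[h1 _] := unit_itv_bounds c.1.
  by have /andP[h2 _] := unit_itv_bounds c.2; rewrite !min_l// subrr mul0r.
- by rewrite ltr_wpDl// divr_ge0.
move=> u v; rewrite /ramp_fun -mulrBl normrM normfV mulrDl mul1r.
apply: (@le_trans _ _ (2 / `|len c| * `|pos u - pos v|)); last by rewrite lerDl.
rewrite mulrAC ler_wpM2r ?invr_ge0//.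
have key b : `|Num.min (pos u) b - Num.min (pos v) b| <= `|pos u - pos v|.
  have [D DE] : exists D, D = `|pos u - pos v| by exists `|pos u - pos v|.
  rewrite -DE; have : `|pos u - pos v| <= D by rewrite DE.
  rewrite !ler_norml => /andP[h1 h2].
  by case: (leP (pos u) b) => k1; case: (leP (pos v) b) => k2; apply/andP; split; lra.
set a1 := Num.min (pos u) (pos c.1); set b1 := Num.min (pos v) (pos c.1).
set a2 := Num.min (pos u) (pos c.2); set b2 := Num.min (pos v) (pos c.2).
have -> : a2 - a1 - (b2 - b1) = (a2 - b2) - (a1 - b1) by ring.
by rewrite (le_trans (ler_normB _ _))// mulr_natl mulr2n lerD// key.
Qed.

Definition ramp c : V := MkVX0 (ramp_subproof c).

Lemma gmin_subproof g b : (fun u => g (umin u b)) \in VX0_pred e.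
Proof.
have -> : (fun u => g (umin u b)) = (fun u => g (umin u b) - g (umin unit_itv0 b)).
  apply/funext => u; have -> : umin unit_itv0 b = unit_itv0.
    by rewrite /umin pos0; have /andP[-> _] := unit_itv_bounds b.
  by rewrite VX0_at0 subr0.
apply: (@VX0_comp _ _ e g (fun u => umin u b)) => u v; rewrite /ule !pos_umin => uv.
  by rewrite le_min !ge_min uv lexx orbT.
by case: (leP (pos v) (pos b)) => h1; case: (leP (pos u) (pos b)) => h2; lra.
Qed.

Definition gmin g b : V := MkVX0 (gmin_subproof g b).

(* The deviation of [g] from its linear interpolation, restricted to the cell [c]. *)
Definition hcell g c : V := gmin g c.2 - gmin g c.1 - df g c *: ramp c.

Lemma hcellE g c u : hcell g c u = g (umin u c.2) - g (umin u c.1) - df g c * ramp_fun c u.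
Proof. by []. Qed.

Lemma ramp_le c u : pos u <= pos c.1 -> pos c.1 <= pos c.2 -> ramp_fun c u = 0.
Proof. by move=> h1 h2; rewrite /ramp_fun !min_l ?subrr ?mul0r// (le_trans h1). Qed.

Lemma ramp_ge c u : pos c.2 <= pos u -> 0 < len c -> ramp_fun c u = 1.
Proof.
rewrite /len => h1 h2; rewrite /ramp_fun !min_r//; last by lra.
by rewrite divff// gt_eqF.
Qed.

Lemma umin_l u b : pos u <= pos b -> umin u b = u. Proof. by rewrite /umin => ->. Qed.
Lemma umin_r u b : pos b <= pos u -> umin u b = b.
Proof.
rewrite /umin; case: ifP => // ub bu; apply: pos_inj; apply/eqP.
by rewrite eq_le ub bu.
Qed.

Definition interp f p : V := \sum_(c <- pcells p) df f c *: ramp c.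

Lemma cell_defect0 f c u : 0 < len c -> ~~ (pos c.1 < pos u < pos c.2) ->
  f (umin u c.2) - f (umin u c.1) - df f c * ramp_fun c u = 0.
Proof.
move=> lc; have c12 : pos c.1 <= pos c.2 by rewrite -subr_ge0 ltW.
rewrite negb_and -!leNgt => /orP[h|h].
  by rewrite ramp_le// !umin_l ?subrr ?mulr0 ?subrr// (le_trans h).
by rewrite ramp_ge// !umin_r ?(le_trans c12)// /df mulr1 subrr.
Qed.

Lemma cell_defect_le f c u : 0 < len c -> pos c.1 <= pos u <= pos c.2 ->
  `|f (umin u c.2) - f (umin u c.1) - df f c * ramp_fun c u| <= `|f u - f c.1| + `|df f c|.
Proof.
move=> lc /andP[h1 h2]; rewrite (umin_l h2) (umin_r h1).
apply: le_trans (ler_normB _ _) _; rewrite lerD2l normrM ler_piMr//.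
rewrite /ramp_fun (min_l h2) (min_r h1).
rewrite ger0_norm; last by rewrite divr_ge0 ?(ltW lc)// subr_ge0.
by rewrite ler_pdivrMr// mul1r /len lerD2r.
Qed.

Lemma sum_cell_defect (f : U -> R^o) p u : f unit_itv0 = 0 ->
  \sum_(c <- pcells p) (f (umin u c.2) - f (umin u c.1) - df f c * ramp_fun c u) =
  f u - interp f p u.
Proof.
move=> f0; rewrite sumrB VX0_sumE; congr (_ - _).
rewrite big_map -[iota _ _]/(iota 0 (psize p)) -[X in iota 0 X]subn0 -/(index_iota 0 (psize p)).
rewrite (telescope_sumr (fun i => f (umin u (p i))))//=.
rewrite umin_l; last by rewrite /pos partition_last; have /andP[] := unit_itv_bounds u.
have -> : p 0%N = unit_itv0 by apply: val_inj; rewrite partition_first.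
rewrite umin_r ?f0 ?subr0//; by have /andP[] := unit_itv_bounds u.
Qed.

Lemma pcells_sum_le p u (T : U * U -> R) (M : R) : 0 <= M ->
  (forall c, c \in pcells p -> `|T c| <= M) ->
  (forall c, c \in pcells p -> ~~ (pos c.1 < pos u < pos c.2) -> T c = 0) ->
  `|\sum_(c <- pcells p) T c| <= M.
Proof. by have [s [ps ->]] := pcells_path p; exact: path_sum_le. Qed.

Lemma interp_close (f : U -> R^o) p (eta : R) : f unit_itv0 = 0 -> 0 <= eta ->
  (forall u v, `|pos u - pos v| <= mesh p -> `|f u - f v| <= eta) ->
  forall u, `|f u - interp f p u| <= 2 * eta.
Proof.
move=> f0 eta0 fe u; rewrite -sum_cell_defect//; apply: pcells_sum_le.
- by rewrite mulr_ge0.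
- move=> c cp; have lc := pcells_len_gt0 cp; have lm := pcells_len cp.
  have [h|h] := boolP (pos c.1 < pos u < pos c.2); last first.
    by rewrite cell_defect0// normr0 mulr_ge0.
  have /andP[h1 h2] := h.
  apply: le_trans (cell_defect_le _ lc _) _; first by rewrite !ltW.
  have -> : 2 * eta = eta + eta by ring.
  apply: lerD; apply: fe; apply: le_trans lm; rewrite /len.
    by rewrite ger0_norm; lra.
  by rewrite ger0_norm ?lexx//; move: lc; rewrite /len; lra.
- by move=> c cp; apply: cell_defect0; exact: pcells_len_gt0 cp.
Qed.

Lemma ex_half_max (h : V) (a b : U) : ule a b ->
  (forall u, ~~ (pos a < pos u < pos b) -> h u = 0) ->
  exists s, [/\ ule a s, ule s b & forall u, `|h u| <= 2 * `|h s|].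
Proof.
move=> ab h0; have [hz|/existsNP[w /eqP w0]] := pselect (forall u, h u = 0).
  by exists a; split=> [||u]; rewrite ?hz ?normr0 ?mulr0// /ule.
have hs : has_sup (range (fun u => `|h u|)).
  split; first by exists `|h w|, w.
  by exists (`|h| / `|e 0%N|) => _ [u _ <-]; exact: VX0_le.
have le_s u : `|h u| <= sup (range (fun u => `|h u|)).
  by apply: ub_le_sup; [case: hs | exists u].
have s0 : 0 < sup (range (fun u => `|h u|)).
  by apply: lt_le_trans (le_s w); rewrite normr_gt0.
have s2 : 0 < sup (range (fun u => `|h u|)) / 2 by rewrite divr_gt0.
have [_ [s _ <-] hsup] := sup_adherent s2 hs.
have : h s != 0.
  by rewrite -normr_gt0; apply: lt_trans hsup; lra.
have [/andP[h1 h2] _|/h0 ->] := boolP (pos a < pos s < pos b); last by rewrite eqxx.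
exists s; split=> [||u]; [exact: ltW | exact: ltW |].
by apply: le_trans (le_s u) _; lra.
Qed.

End interpolation.

Section sup_bounded_functionals.
Context {R : realType} {X : normedModType R} (e : symmetric_basis X).
Local Notation U := (unit_itv R).
Local Notation V := (VX0 e).
Implicit Types (g h : V) (u t : U) (c : U * U) (p : Defs.partition R).

Variable psi : V -> R^o.
Hypothesis lpsi : linear psi.
Variable A : R.
Hypothesis psiA : forall h (s : R), 0 <= s -> (forall u, `|h u| <= s) -> `|psi h| <= A * s.

Let psi0 : psi 0 = 0.
Proof. by apply/eqP; rewrite -normr_le0 -(mulr0 A); apply: psiA => // u; rewrite normr0. Qed.

Let psiD h h' : psi (h + h') = psi h + psi h'.
Proof. by have := lpsi 1 h h'; rewrite !scale1r. Qed.

Let psiZ a h : psi (a *: h) = a * psi h.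
Proof. by have := lpsi a h 0; rewrite !addr0 psi0 addr0. Qed.

Let psi_sum I (r : seq I) (F : I -> V) : psi (\sum_(i <- r) F i) = \sum_(i <- r) psi (F i).
Proof. exact: (big_morph psi psiD psi0). Qed.

Let A0 : 0 <= A.
Proof.
rewrite -[A]mulr1; apply: le_trans (normr_ge0 (psi 0)) _; apply: psiA => // u.
by rewrite normr0.
Qed.

(** In terms of a measure representing [psi], this corresponds to a total variation of at most [eps]
    on [S]. *)
Definition small_on (eps : R) (S : U -> Prop) :=
  forall h, (forall u, `|h u| <= 1) -> (forall u, ~ S u -> h u = 0) -> `|psi h| <= eps.

(* Otherwise infinitely many disjointly supported functions accumulate at [t], and
   the values of [psi] on their sums are unbounded; truncation separates the
   supports from [t]. *)
Lemma small_on_local (eps : R) t (sg : R) : `|sg| = 1 -> 0 < eps -> exists2 eta : R, 0 < eta &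
  small_on eps (fun u => 0 < sg * (pos u - pos t) < eta).
Proof.
move=> sg1 eps0; apply: contrapT => hno.
have bad (eta : R) : 0 < eta -> exists h, [/\ forall u, `|h u| <= 1,
    forall u, ~ (0 < sg * (pos u - pos t) < eta) -> h u = 0 & eps < psi h].
  move=> eta0; apply: contrapT => hb; apply: hno; exists eta => // h h1 h0.
  rewrite leNgt; apply/negP => ge; apply: hb.
  have [ph|ph] := leP 0 (psi h); first by exists h; split=> //; rewrite -(ger0_norm ph).
  exists (- h); split=> [u|u hu|]; first by rewrite VX0_oppE normrN.
    by rewrite VX0_oppE h0// oppr0.
  by rewrite -scaleN1r psiZ mulN1r -(ltr0_norm ph).
have key n : exists h, exists2 eta : R, 0 < eta & [/\ forall u, `|h u| <= 1,
    forall u, sg * (pos u - pos t) < eta -> h u = 0 & n%:R * (eps / 2) <= psi h].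
  elim: n => [|n [h [eta eta0 [h1 h0 hn]]]].
    by exists 0, 1 => //; split=> [u|//|]; rewrite ?VX0_zeroE ?normr0// psi0 mul0r.
  have [k [k1 k0 kpsi]] := bad eta eta0.
  (* Thresholding [k] at [kap] changes [psi k] by at most [A * kap <= eps / 2], and it makes the
     function vanish near [t], where [k] is at most [kap] by continuity. This leaves room for the
     next function. *)
  pose kap := eps / 2 / (A + 1).
  have A1 : 0 < A + 1 by rewrite ltr_wpDl.
  have kap0 : 0 < kap by rewrite !divr_gt0.
  have tP : (fun u => trunc kap (k u)) \in VX0_pred e.
    apply: (@VX0_contract _ _ e k) => [|u v]; last exact/trunc_lip/ltW.
    by rewrite VX0_at0 trunc_eq0// normr0 ltW.
  pose k' : V := MkVX0 tP.
  have k'E u : k' u = trunc kap (k u) by [].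
  have [d d0 dP] := VX0_uniform_continuous k kap0.
  have kt : k t = 0 by apply: k0; rewrite subrr mulr0 ltxx.
  have k'le u : `|k' u| <= `|k u|.
    rewrite k'E; have := @trunc_lip _ kap (k u) 0 (ltW kap0).
    by rewrite (@trunc_eq0 _ kap 0) ?subr0// normr0 ltW.
  have k'1 u : `|k' u| <= 1 by exact: le_trans (k'le u) (k1 u).
  have k'0 u : ~ (0 < sg * (pos u - pos t) < eta) -> k' u = 0.
    by move=> /k0 ku; apply/eqP; rewrite -normr_le0 (le_trans (k'le u))// ku normr0.
  exists (h + k'), (Num.min eta d); first by rewrite lt_min eta0.
  split.
  - move=> u; rewrite VX0_addE; have [lt|ge] := ltP (sg * (pos u - pos t)) eta.
      by rewrite h0// add0r.
    by rewrite k'0 ?addr0// => /andP[_]; rewrite ltNge ge.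
  - move=> u; rewrite lt_min => /andP[ue ud]; rewrite VX0_addE h0// add0r.
    have [pos_u|neg_u] := ltP 0 (sg * (pos u - pos t)); last first.
      by apply: k'0 => /andP[]; rewrite ltNge neg_u.
    rewrite k'E trunc_eq0//; have := dP u t; rewrite kt subr0; apply.
    by rewrite -[`|pos u - _|]mul1r -sg1 -normrM gtr0_norm// ltW.
  - rewrite psiD -addn1 natrD mulrDl mul1r; apply: lerD => //.
    have : `|psi (k - k')| <= A * kap.
      apply: psiA; first exact: ltW.
      by move=> u; rewrite VX0_addE VX0_oppE k'E; apply: trunc_close; exact: ltW.
    have : A * kap <= eps / 2.
      rewrite /kap mulrCA -[leRHS]mulr1 ler_pM2l ?divr_gt0// ler_pdivrMr// mul1r.
      by rewrite lerDl.
    have -> : psi (k - k') = psi k - psi k'.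
      by rewrite psiD -scaleN1r psiZ mulN1r.
    by rewrite ler_norml => h2 /andP[_ h3]; lra.
have e2 : 0 < eps / 2 by rewrite divr_gt0.
have [h [eta _ [h1 _ hn]]] := key (Num.truncn (A / (eps / 2))).+1.
have := psiA ler01 h1; rewrite mulr1 => /(le_trans (ler_norm _)) hA.
have := le_trans hn hA; rewrite -ler_pdivlMr//.
by rewrite leNgt truncnS_gt.
Qed.

Lemma small_on_sub (eps : R) (S S' : U -> Prop) : (forall u, S' u -> S u) ->
  small_on eps S -> small_on eps S'.
Proof. by move=> SS sS h h1 h0; apply: sS => // u nS; apply: h0 => /SS. Qed.

(** Near [t] smallness is available on each side but not at [t] itself, where there may be an atom.
    In Cousin's lemma the points [t] become partition points, so that only the open cells have to be
    small. *)
Lemma small_on_partition (eps kap : R) : 0 < eps -> 0 < kap ->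
  exists p, mesh p <= kap /\ forall c, c \in pcells p ->
    small_on eps (fun u => pos c.1 < pos u < pos c.2).
Proof.
move=> eps0 kap0.
have [|p pP] := @partition_induction R (fun a b => pos b - pos a <= kap /\
    small_on eps (fun u => pos a < pos u < pos b)).
  move=> t; have [|r r0 rP] := @small_on_local eps t 1 _ eps0; first by rewrite normr1.
  have [|l l0 lP] := @small_on_local eps t (-1) _ eps0; first by rewrite normrN1.
  exists (Num.min (Num.min r l) kap); first by rewrite !lt_min r0 l0.
  have m1 : Num.min (Num.min r l) kap <= r by rewrite !ge_min lexx.
  have m2 : Num.min (Num.min r l) kap <= l by rewrite !ge_min lexx orbT.
  have m3 : Num.min (Num.min r l) kap <= kap by rewrite !ge_min lexx orbT.
  move: m1 m2 m3; set m := Num.min (Num.min r l) kap => m1 m2 m3.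
  split=> [a|b]; rewrite /ule => h1 h2; (split; first by lra).
    by apply: small_on_sub lP => u /andP[u1 u2]; apply/andP; split; lra.
  by apply: small_on_sub rP => u /andP[u1 u2]; apply/andP; split; lra.
exists p; split; last by move=> c /pP[].
by apply: mesh_le (ltW kap0) _; apply/allP => c /pP[].
Qed.

Hypothesis reflX : reflexive_space X.
Local Notation interp := (interp e reflX).
Local Notation hcell := (hcell reflX).

(** The interpolation error is a sum over the cells of terms [b c * m c], where [m c] is the size of
    the deviation on the cell. Each [b c] is small by the choice of the partition. Their absolute
    values add up to at most [A], as seen by testing [psi] on a signed sum of normalized deviations,
    whose supports are disjoint. As [m] has norm at most [4 * |g|] in X, [small_pairing]
    concludes. *)
Theorem sup_bounded_interp (eta kap : R) : 0 < eta -> 0 < kap ->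
  exists p, mesh p <= kap /\ forall g, `|psi g - psi (interp g p)| <= eta * `|g|.
Proof.
move=> eta0 kap0.
have e4 : 0 < eta / 4 by rewrite divr_gt0.
have [eps eps0 small] := small_pairing e reflX A e4.
have [p [pk pS]] := small_on_partition eps0 kap0.
exists p; split=> // g.
have [/VX0_eq0 ->|gn0] := eqVneq `|g| 0.
  rewrite psi0 /interp big1; first by rewrite psi0 subrr !normr0 mulr0.
  by move=> c _; rewrite /df subrr scale0r.
have g0 : 0 < `|g| by rewrite lt_neqAle eq_sym gn0 normr_ge0.
have defect0 c u : c \in pcells p -> ~~ (pos c.1 < pos u < pos c.2) -> hcell g c u = 0.
  by move=> cp h; rewrite hcellE cell_defect0//; exact: pcells_len_gt0 cp.
have /choice[sg sgP] : forall c, exists s, c \in pcells p ->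
    [/\ ule c.1 s, ule s c.2 & forall u, `|hcell g c u| <= 2 * `|hcell g c s|].
  move=> c; have [cp|ncp] := boolP (c \in pcells p); last by exists c.1.
  have c12 : ule c.1 c.2 by rewrite /ule -subr_ge0 ltW// (pcells_len_gt0 cp).
  have [s sP] := ex_half_max c12 (fun u => @defect0 c u cp).
  by exists s.
(* The point [sg c] realizes at least half of the supremum on the cell. Using a value at a point
   bounds [m] by increments of [g] over two interval families: the left parts of the cells, and the
   cells themselves. *)
pose m c := 2 * `|hcell g c (sg c)|.
have m0 c : 0 <= m c by rewrite mulr_ge0.
have hm c u : c \in pcells p -> `|hcell g c u| <= m c by move=> /sgP[].
pose b c := psi (hcell g c) / m c.
have bm c : c \in pcells p -> psi (hcell g c) = b c * m c.
  move=> cp; have [mz|mn0] := eqVneq (m c) 0; last by rewrite /b mulfVK.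
  rewrite mz mulr0 (_ : hcell g c = 0) ?psi0//; apply: VX0_ext => u.
  by apply/eqP; rewrite VX0_zeroE -normr_le0 -mz hm.
have hb c u : c \in pcells p -> `|((m c)^-1 *: hcell g c) u| <= 1.
  move=> cp; rewrite VX0_scaleE normrM normfV (ger0_norm (m0 c)).
  have [->|mn0] := eqVneq (m c) 0; first by rewrite invr0 mul0r.
  rewrite mulrC ler_pdivrMr ?mul1r ?hm//.
  by rewrite lt_neqAle eq_sym mn0 m0.
have be c : c \in pcells p -> `|b c| <= eps.
  move=> cp; rewrite /b mulrC -psiZ; apply: (pS c cp) => u; first exact: hb.
  by move=> /negP h; rewrite VX0_scaleE defect0// mulr0.
have bA : \sum_(c <- pcells p) `|b c| <= A.
  pose w : V := \sum_(c <- pcells p) (Num.sg (b c) / m c) *: hcell g c.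
  have -> : \sum_(c <- pcells p) `|b c| = psi w.
    rewrite psi_sum; apply: eq_bigr => c _; rewrite psiZ normrEsg /b; ring.
  apply: le_trans (ler_norm _) _; rewrite -[A]mulr1; apply: psiA => // u.
  rewrite VX0_sumE; apply: (@pcells_sum_le _ _ u) => // c cp.
    rewrite -scalerA VX0_scaleE normrM normr_sg.
    apply: le_trans (hb c u cp); rewrite ler_piMl//.
    by case: (b c == 0); rewrite //= ler01.
  by move=> h; rewrite VX0_scaleE (defect0 c u cp h) mulr0.
have mN : nrm e (map m (pcells p)) <= 4 * `|g|.
  rewrite nrm_mapZ ger0_norm//.
  have -> : 4 * `|g| = 2 * (`|g| + `|g|) by ring.
  rewrite ler_pM2l//.
  apply: (@le_trans _ _ (nrm e [seq `|df g (c.1, sg c)| + `|df g c| | c <- pcells p])).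
    apply: nrm_map_le => c cp; rewrite normr_id [leRHS]ger0_norm ?addr_ge0//.
    have [h1 h2 _] := sgP c cp; rewrite hcellE.
    by apply: cell_defect_le; [exact: pcells_len_gt0 cp | apply/andP; split].
  apply: le_trans (nrm_mapD _ _ _ _) _; apply: lerD.
    rewrite (@nrm_map_abs _ _ e _ _ _ (fun c => df g (c.1, sg c))); last first.
      by move=> c _; rewrite normr_id.
    have [s [ps pE]] := pcells_path p.
    have := VX0_fnrm_le g (@family_left R (p 0%N) s sg ps _).
    rewrite -pE /fnrm -map_comp; apply => c cp.
    by have [] := sgP c cp.
  rewrite (@nrm_map_abs _ _ e _ _ _ (df g)); last by move=> c _; rewrite normr_id.
  exact: VX0_fnrm_le (pcells_family p).
have -> : psi g - psi (interp g p) = \sum_(c <- pcells p) b c * m c.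
  rewrite big_seq; under eq_bigr => c cp do rewrite -bm//.
  rewrite -big_seq -psi_sum -(_ : g - interp g p = \sum_(c <- pcells p) hcell g c).
    by rewrite psiD -[- interp g p]scaleN1r psiZ mulN1r.
  apply: VX0_ext => u; rewrite VX0_sumE VX0_addE VX0_oppE -sum_cell_defect//.
  exact: VX0_at0.
apply: le_trans (ler_norm_sum _ _ _) _.
pose M := 4 * `|g|; have M0 : 0 < M by rewrite mulr_gt0.
have := small (psize p) (fun i => b (p i, p i.+1)) (fun i => M^-1 * m (p i, p i.+1)).
have inp i : (i < psize p)%N -> (p i, p i.+1) \in pcells p.
  by move=> ip; apply/mapP; exists i; rewrite // mem_iota.
have sumE (T : U * U -> R) : \sum_(i < psize p) T (p i, p i.+1) = \sum_(c <- pcells p) T c.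
  rewrite big_map -[iota _ _]/(iota 0 (psize p)) -[X in iota 0 X]subn0.
  by rewrite -/(index_iota 0 (psize p)) big_mkord.
rewrite (sumE (fun c => `|b c|)) (sumE (fun c => `|b c * (M^-1 * m c)|)) => h.
have {h} := h (fun i ip => be _ (inp i ip)) bA _.
rewrite /mkseq nrm_mapZ gtr0_norm ?invr_gt0// ler_pdivrMl// mulr1.
have -> : [seq m (p i, p i.+1) | i <- iota 0 (psize p)] = map m (pcells p).
  by rewrite -map_comp.
move=> /(_ mN).
have -> : \sum_(c <- pcells p) `|b c * (M^-1 * m c)| = M^-1 * \sum_(c <- pcells p) `|b c * m c|.
  rewrite mulr_sumr; apply: eq_bigr => c _; rewrite mulrCA normrM.
  by rewrite gtr0_norm ?invr_gt0.
rewrite ler_pdivrMl// => /le_trans; apply.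
by rewrite /M le_eqVlt; apply/orP; left; apply/eqP; field.
Qed.

End sup_bounded_functionals.

(** * Uniform approximation of a continuous weak* limit by a bounded sequence *)

Section bidual_function.
Context {R : realType} {X : normedModType R} (e : symmetric_basis X).
Local Notation U := (unit_itv R).
Local Notation V := (VX0 e).
Variable F : dual (dual V).
Let f : U -> R^o := bidual_fun F.

Lemma bidual_fun0 : f unit_itv0 = 0.
Proof.
rewrite /f /bidual_fun (_ : eval_at e unit_itv0 = 0) ?dual0//.
by apply/val_inj/funext => g /=; rewrite VX0_at0.
Qed.

Definition delta_sum (r : seq (U * U)) (a : U * U -> R) : dual V :=
  \sum_(c <- r) a c *: (eval_at e c.2 - eval_at e c.1).

Lemma delta_sumE r a (g : V) : delta_sum r a g = \sum_(c <- r) a c * df g c.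
Proof.
rewrite /delta_sum; elim: r => [|c r IH]; first by rewrite !big_nil.
by rewrite !big_cons -IH.
Qed.

Lemma bidual_delta_sum r a : F (delta_sum r a) = \sum_(c <- r) a c * df f c.
Proof. by rewrite dual_sum; apply: eq_bigr => c _; rewrite dualZ dualB. Qed.

(** [F] is applied to the combination [D] of point evaluations whose coefficients are those of a
    norming functional on X; the norm of [D] is at most 1. *)
Lemma bidual_fun_alpha_le p : alpha e f p <= `|F|.
Proof.
have [phi [phi1 phiE]] := ex_norming (\sum_(i < psize p) (f (p i.+1) - f (p i)) *: e i).
rewrite /alpha -phiE.
have E (h : U -> R^o) : phi (\sum_(i < psize p) (h (p i.+1) - h (p i)) *: e i) =
    \sum_(i < psize p) phi (e i) * df h (p i, p i.+1).
  by rewrite dual_sum; apply: eq_bigr => i _; rewrite dualZ mulrC.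
pose dl i : dual V := eval_at e (p i.+1) - eval_at e (p i).
rewrite E; pose D : dual V := \sum_(i < psize p) phi (e i) *: dl i.
have -> : \sum_(i < psize p) phi (e i) * df f (p i, p i.+1) = F D.
  by rewrite dual_sum; apply: eq_bigr => i _; rewrite dualZ dualB.
apply: le_trans (ler_norm _) _; apply: le_trans (dual_le _ _) _.
rewrite -[leRHS]mulr1 ler_wpM2l//; apply: dual_norm_leP => // g; rewrite mul1r.
have -> : D g = phi (\sum_(i < psize p) (g (p i.+1) - g (p i)) *: e i).
  rewrite E /D; have H r : (\sum_(i <- r) phi (e i) *: dl i : dual V) g
      = \sum_(i <- r) phi (e i) * df g (p i, p i.+1).
    by elim: r => [|i r IH]; [rewrite !big_nil | rewrite !big_cons -IH].
  by have := H (index_iota 0 (psize p)); rewrite !big_mkord.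
exact: le_trans (phi1 _) (VX0_alpha_le g p).
Qed.

Hypothesis reflX : reflexive_space X.
Variable Y : set V.
Hypothesis subY : closed_subspace Y.
Hypothesis FY : forall phi : dual V, (forall y, Y y -> phi y = 0) -> F phi = 0.
Hypothesis f_uc : forall eta : R, 0 < eta -> exists2 d, 0 < d &
  forall u v, `|pos u - pos v| <= d -> `|f u - f v| <= eta.

(** If the approximation fails for some [eps], an interpolant [g] of [f] is separated by a
    functional [psi] from the sum of the ball of radius [M] of [Y] and a ball of the supremum norm.
    On [Y], [psi] is at most [1 / M], so [|F psi| <= |F| / M <= 1 / 2]. But [F psi] is within 1/8 of
    [psi] at another interpolant of [f], which is within 1/4 of [psi g >= 1]. *)
Lemma approx_in_subspace : exists M : R, forall eps : R, 0 < eps ->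
  exists y, [/\ Y y, `|y| <= M & forall u, `|y u - f u| <= eps].
Proof.
have [Y0 YS _] := subY.
pose M := 2 * `|F| + 2; have M0 : 0 < M by rewrite ltr_wpDl// mulr_ge0.
exists M => eps eps0; apply: contrapT => hno.
have B0 := basis0_gt0 e.
pose e1 := eps / 2; have e10 : 0 < e1 by rewrite divr_gt0.
have e32 : 0 < eps / 32 by rewrite divr_gt0.
have [d d0 dP] := f_uc e32.
have interp_near p : mesh p <= d -> forall u, `|f u - interp e reflX f p u| <= eps / 16.
  move=> pd u; have := @interp_close _ _ e reflX f p (eps / 32) bidual_fun0 (ltW e32).
  have -> : 2 * (eps / 32) = eps / 16 by field.
  by apply => a b ab; apply: dP; apply: le_trans pd.
have [q qd] := ex_partition d0.
pose g := interp e reflX f q.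
(* [N] is the gauge of the sum of the ball of radius [M] of [Y] and the ball of radius [e1] for the
   supremum norm. *)
pose NA (h : V) : set R := [set x | exists y r, [/\ Y y, 0 <= r,
  forall u, `|h u - y u| <= e1 * r & x = `|y| / M + r]].
pose N h := inf (NA h).
have NA_ge0 h x : NA h x -> 0 <= x.
  by move=> [y [r [_ r0 _ ->]]]; rewrite addr_ge0// divr_ge0// ltW.
have N_le h x : NA h x -> N h <= x.
  by move=> hx; apply: ge_inf => //; exists 0 => z /NA_ge0.
have NA0 h : NA h (`|h| / `|e 0%N| / e1).
  exists 0, (`|h| / `|e 0%N| / e1); split=> //.
  - by rewrite !divr_ge0// ltW.
  - by move=> u; rewrite subr0 mulrC divfK ?gt_eqF//; exact: VX0_le.
  - by rewrite normr0 mul0r add0r.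
have N_ge h m : (forall x, NA h x -> m <= x) -> m <= N h.
  by move=> hm; apply: lb_le_inf => //; exists (`|h| / `|e 0%N| / e1).
have YZ a y : Y y -> Y (a *: y) by move=> Yy; rewrite -[_ *: _]addr0; exact: YS.
have YD x y : Y x -> Y y -> Y (x + y) by move=> Yx Yy; rewrite -[x]scale1r; exact: YS.
have NZ a h : 0 < a -> a * N h <= N (a *: h).
  move=> a0; apply: (N_ge) => _ [y [r [Yy r0 yr ->]]].
  rewrite -ler_pdivlMl//; apply: N_le; exists (a^-1 *: y), (a^-1 * r); split.
  - exact: YZ.
  - by rewrite mulr_ge0// invr_ge0 ltW.
  - move=> u; rewrite VX0_scaleE.
    have -> : h u - a^-1 * y u = a^-1 * ((a *: h) u - y u).
      by rewrite VX0_scaleE mulrBr mulKf// gt_eqF.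
    by rewrite normrM gtr0_norm ?invr_gt0// mulrCA ler_pM2l ?invr_gt0.
  - by rewrite normrZ gtr0_norm ?invr_gt0// mulrDr mulrA.
have Nsub : sublinear N.
  split=> [h h'|a h].
    rewrite -lerBlDr; apply: (N_ge) => _ [y [r [Yy r0 yr ->]]]; rewrite lerBlDr -lerBlDl.
    apply: (N_ge) => _ [y' [r' [Yy' r0' yr' ->]]]; rewrite lerBlDl.
    have : NA (h + h') (`|y + y'| / M + (r + r')).
      exists (y + y'), (r + r'); split; [exact: YD|exact: addr_ge0| |by []].
      move=> u; rewrite !VX0_addE opprD addrACA mulrDr.
      by apply: le_trans (ler_normD _ _) _; exact: lerD.
    move=> /N_le/le_trans; apply; rewrite [leRHS]addrACA lerD2r -mulrDl.
    by rewrite ler_pM2r ?invr_gt0// ler_normD.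
  rewrite le_eqVlt => /predU1P[<-|a0].
    rewrite scale0r mul0r; apply/eqP; rewrite eq_le; apply/andP; split.
      by have := N_le _ _ (NA0 0); rewrite normr0 !mul0r.
    by apply: (N_ge) => x /NA_ge0.
  apply/eqP; rewrite eq_le NZ// andbT.
  have ai : 0 < a^-1 by rewrite invr_gt0.
  have := NZ _ (a *: h) ai.
  by rewrite scalerA mulVf ?gt_eqF// scale1r mulrC ler_pdivrMr// mulrC.
have [psi [lpsi psiN psig]] := hahn_banach g Nsub.
have psi_sup (h : V) (s : R) : 0 <= s -> (forall u, `|h u| <= s) -> `|psi h| <= e1^-1 * s.
  move=> s0 hs.
  have key (k : V) : (forall u, `|k u| <= s) -> psi k <= e1^-1 * s.
    move=> ks; apply: le_trans (psiN k) _; apply: N_le.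
    exists 0, (e1^-1 * s); split=> //.
    - by rewrite mulr_ge0// invr_ge0 ltW.
    - by move=> u; rewrite subr0 mulVKf ?gt_eqF.
    - by rewrite normr0 mul0r add0r.
  rewrite ler_norml key// andbT lerNl.
  have psi00 : psi 0 = 0.
    by apply/eqP; rewrite eq_le; have := lpsi 1 0 0; rewrite !scale1r addr0; lra.
  have <- : psi (- h) = - psi h.
    by have := lpsi (-1) h 0; rewrite !scaleN1r addr0 psi00 addr0.
  by apply: key => u; rewrite VX0_oppE normrN.
have psi_bd (h : V) : `|psi h| <= (e1^-1 / `|e 0%N|) * `|h|.
  rewrite -mulrA [_^-1 * `|h|]mulrC; apply: psi_sup; first by rewrite divr_ge0.
  by move=> u; exact: VX0_le.
have [psi' psi'E] := ex_dual lpsi psi_bd.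
have F1 : `|F psi'| <= 1 / 2.
  apply: le_trans (@bidual_annihilator_le _ _ Y F psi' M^-1 _ Y0 YS FY _) _.
  - by rewrite invr_ge0 ltW.
  - move=> y Yy; rewrite psi'E mulrC.
    have key z : Y z -> psi z <= `|z| / M.
      move=> Yz; apply: le_trans (psiN z) _; apply: N_le; exists z, 0; split=> //.
        by move=> u; rewrite subrr normr0 mulr0.
      by rewrite addr0.
    rewrite ler_norml key// andbT lerNl -psi'E -dualN psi'E.
    by rewrite -[`|y|]normrN; apply: key; rewrite -scaleN1r; exact: YZ.
  - by rewrite ler_pdivrMr// /M; lra.
have F1' : 0 < (8 * (`|F| + 1))^-1 by rewrite invr_gt0 mulr_gt0// ltr_wpDl.
have [p [pd pP]] := sup_bounded_interp lpsi psi_sup reflX F1' d0.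
(* [D] is [psi'] composed with interpolation at [p]. Being a combination of evaluations, it is sent
   by [F] to the same expression in [f], although [f] need not lie in V_X^0. *)
pose D := delta_sum (pcells p) (fun c => psi' (ramp e reflX c)).
have DE (h : V) : D h = psi' (interp e reflX h p).
  by rewrite delta_sumE dual_sum; apply: eq_bigr => c _; rewrite dualZ mulrC.
have FD : F D = psi' (interp e reflX f p).
  by rewrite bidual_delta_sum dual_sum; apply: eq_bigr => c _; rewrite dualZ mulrC.
have psiD : `|psi' - D| <= (8 * (`|F| + 1))^-1.
  apply: dual_norm_leP; first exact: ltW.
  move=> h; have -> : (psi' - D : dual V) h = psi' h - D h by [].
  by rewrite DE !psi'E; exact: pP.
have F2 : `|F psi' - F D| <= 1 / 8.
  rewrite -dualB; apply: le_trans (dual_le _ _) _.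
  apply: (@le_trans _ _ (`|F| * (8 * (`|F| + 1))^-1)); first by rewrite ler_wpM2l.
  rewrite ler_pdivrMr ?mulr_gt0 ?ltr_wpDl//.
  by have := normr_ge0 F; lra.
have F3 : `|psi' (interp e reflX f p) - psi' g| <= 1 / 4.
  rewrite -dualB psi'E; apply: le_trans (psi_sup _ (eps / 8) _ _) _.
  - by rewrite divr_ge0// ltW.
  - move=> u; rewrite VX0_addE VX0_oppE.
    have := interp_near p pd u; have := interp_near q qd u; rewrite -/g.
    set a := interp _ _ _ _ u; set b := g u => h1 h2.
    have -> : a - b = (f u - b) - (f u - a) by ring.
    by apply: le_trans (ler_normB _ _) _; lra.
  - by rewrite /e1 le_eqVlt; apply/orP; left; apply/eqP; field; rewrite gt_eqF.
have g1 : 1 <= psi' g.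
  rewrite psi'E psig; apply: (N_ge) => _ [y [r [Yy r0 yr ->]]].
  rewrite leNgt; apply/negP => lt1; apply: hno; exists y; split=> //.
    have : `|y| / M < 1 by lra.
    by rewrite ltr_pdivrMr// mul1r => /ltW.
  move=> u; have := yr u; have := interp_near q qd u; rewrite -/g => h1 h2.
  have r1 : r < 1 by have : 0 <= `|y| / M; [rewrite divr_ge0// ltW | lra].
  have -> : y u - f u = - ((f u - g u) + (g u - y u)) by ring.
  rewrite normrN; apply: le_trans (ler_normD _ _) _.
  have : e1 * r <= e1 by apply: ler_piMr; exact: ltW.
  by move: h1 h2; rewrite /e1; lra.
move: F1 F2 F3; rewrite FD !ler_norml => /andP[_ k1] /andP[k2 _] /andP[k3 _].
lra.
Qed.

End bidual_function.

(** * Convex combinations *)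

Section pairing_more.
Context {R : realType} {X : normedModType R} (e : symmetric_basis X).
Implicit Types (s : seq R) (x : nat -> R).

Lemma pairing_split x s K :
  pairing x s = \sum_(i < K) s`_i * x i + pairing x (nseq K 0 ++ drop K s).
Proof.
rewrite (@pairing_widen _ _ s (K + size s)) ?leq_addl//.
rewrite (@pairing_widen _ _ (nseq K 0 ++ drop K s) (K + size s)); last first.
  by rewrite size_cat size_nseq leq_add2l size_drop leq_subr.
rewrite !big_split_ord/= [X in _ + (X + _)]big1 ?add0r; last first.
  by move=> i _; rewrite nth_cat size_nseq ltn_ord nth_nseq ltn_ord mul0r.
congr (_ + _); apply: eq_bigr => i _; congr (_ * _).
by rewrite nth_cat size_nseq ltnNge leq_addr/= addKn nth_drop.
Qed.

Lemma dual_sequence_le x i : dual_sequence e x -> `|x i| <= `|e 0%N|.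
Proof.
move=> dx; have := dx (nseq i 0 ++ [:: 1]); rewrite nrm_nseq0 nrm_seq1 normr1 mul1r.
suff -> : pairing x (nseq i 0 ++ [:: 1]) = x i by [].
rewrite /pairing size_cat size_nseq addn1 big_ord_recr/= nth_cat size_nseq ltnn subnn/=.
by rewrite big1 ?add0r ?mul1r// => j _; rewrite nth_cat size_nseq ltn_ord nth_nseq ltn_ord mul0r.
Qed.

Lemma nrm_entry_le s (z : R) : z \in s -> `|z| * `|e 0%N| <= nrm e s.
Proof. by move=> xs; rewrite -nrm_seq1; apply: nrm_subseq; rewrite sub1seq. Qed.

Lemma nth_le s (i : nat) (r : R) : 0 <= r -> (forall z : R, z \in s -> `|z| <= r) -> `|s`_i| <= r.
Proof.
move=> r0 sr; have [h|h] := ltnP i (size s); first exact/sr/mem_nth.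
by rewrite nth_default// normr0.
Qed.

(** Coordinatewise limits along an ultrafilter exist because the coordinates are bounded by [|e 0|];
    each pairing involves finitely many of them. *)
Lemma dual_sequence_cluster (x : nat -> nat -> R) : (forall m, dual_sequence e (x m)) ->
  exists2 l, dual_sequence e l & forall K (r : R) M, 0 < r ->
    exists2 m, (M <= m)%N & forall i, (i < K)%N -> `|x m i - l i| < r.
Proof.
move=> dx; have [U [PU Uoo Ulim]] := @ex_free_ultrafilter R.
have /choice[l lP] : forall i, exists l, forall r, 0 < r -> U [set m | `|x m i - l| < r].
  by move=> i; apply: (Ulim (fun m => x m i) `|e 0%N|) => m; exact: dual_sequence_le.
have UK K (r : R) : 0 < r -> U [set m | forall i, (i < K)%N -> `|x m i - l i| < r].
  move=> r0; elim: K => [|K IH]; first by apply: filterS (Uoo 0%N).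
  apply: filterS2 IH (lP K r r0) => m /= h1 h2 i.
  by rewrite ltnS leq_eqVlt => /predU1P[->|/h1].
have cl K (r : R) M : 0 < r -> exists2 m, (M <= m)%N & forall i, (i < K)%N -> `|x m i - l i| < r.
  by move=> r0; have [m [h1 h2]] := filter_ex (filterI (UK K r r0) (Uoo M)); exists m.
exists l => // s; apply/ler_addgt0Pl => eta eta0.
pose S := \sum_(i < size s) `|s`_i| + 1.
have S0 : 0 < S by rewrite ltr_wpDl// sumr_ge0.
have [m _ hm] := cl (size s) (eta / S) 0%N (divr_gt0 eta0 S0).
have : `|pairing l s - pairing (x m) s| <= eta.
  rewrite /pairing -sumrB (le_trans (ler_norm_sum _ _ _))//.
  apply: (@le_trans _ _ (\sum_(i < size s) `|s`_i| * (eta / S))).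
    apply: ler_sum => i _; rewrite -mulrBr normrM ler_wpM2l// distrC ltW//.
    exact: hm.
  by rewrite -mulr_suml mulrA ler_pdivrMr// mulrC ler_pM2l// lerDl.
have := dx m s; have := ler_normD (pairing l s - pairing (x m) s) (pairing (x m) s).
rewrite subrK; lra.
Qed.

End pairing_more.

(** * Simons' inequality for increments with cutoffs *)

Section convex_combinations.
Context {R : realType} {X : normedModType R} (e : symmetric_basis X).
Local Notation U := (unit_itv R).
Local Notation V := (VX0 e).
Hypothesis reflX : reflexive_space X.

Definition len_ge (c c' : U * U) := len c' <= len c.

(** The [K] intervals in front of [c] are at least as long as [c], and all lengths add up to at most
    1. *)
Lemma sorted_len_le (I : seq (U * U)) K c : interval_family I -> sorted len_ge I ->
  (0 < K)%N -> c \in drop K I -> len c <= K%:R^-1.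
Proof.
move=> fI sI K0 cI.
have tr : transitive len_ge by move=> a b d h1 h2; exact: le_trans h2 h1.
have Ksz : (K < size I)%N by rewrite ltnNge; apply/negP => h; move: cI; rewrite drop_oversize.
have : \sum_(c' <- take K I) len c' <= 1.
  by apply: family_sum_len; exact: family_subseq (take_subseq _ _) fI.
have : K%:R * len c <= \sum_(c' <- take K I) len c'.
  have -> : K%:R * len c = \sum_(c' <- take K I) len c.
    by rewrite big_const_seq count_predT size_takel ?(ltnW Ksz)// iter_addr_0 mulr_natl.
  rewrite big_seq [leRHS]big_seq; apply: ler_sum => c' c'I.
  have := sI; rewrite sorted_pairwise// -{1}(cat_take_drop K I) pairwise_cat.
  by move=> /and3P[/allrelP/(_ c' c c'I cI)].
move=> /le_trans h /h; rewrite -ler_pdivlMl ?ltr0n// mulr1//.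
Qed.

Variables (f : U -> R^o) (Mf : R).
Hypothesis fM : forall p, alpha e f p <= Mf.
Hypothesis f_uc : forall eta : R, 0 < eta -> exists2 d, 0 < d &
  forall u v, `|pos u - pos v| <= d -> `|f u - f v| <= eta.
Variables (y : nat -> V) (My : R) (cut : nat -> R).
Hypothesis yM : forall k, `|y k| <= My.
Hypothesis yf : forall eta : R, 0 < eta -> exists n, forall k, (n <= k)%N ->
  forall u, `|y k u - f u| <= eta.
Hypothesis cut0 : forall k, 0 < cut k.
Hypothesis cut_cvg : forall eta : R, 0 < eta -> exists n, forall k, (n <= k)%N -> cut k <= eta.

(* The functions [f] approximated by [y k] need not lie in [V_X^0]; they are replaced by
   their increments over intervals longer than the cutoff [cut k]. *)
Definition defect k c : R := df (y k) c - (cut k < len c)%R%:R * df f c.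

Let W := My + Mf.

Let W0 : 0 <= W.
Proof.
rewrite addr_ge0//; first exact: le_trans (yM 0%N).
have [p _] := @ex_partition R 1 ltr01; apply: le_trans (fM p); exact: normr_ge0.
Qed.

Lemma defect_le I k : interval_family I -> nrm e (map (defect k) I) <= W.
Proof.
move=> fI; apply: (@le_trans _ _ (nrm e (map (df (y k)) I) + nrm e (map (df f) I))).
  apply: le_trans (nrm_mapD _ _ _ (fun c => - ((cut k < len c)%R%:R * df f c))) _.
  rewrite lerD2l; apply: nrm_map_le => c _; rewrite normrN normrM.
  by case: (cut k < len c); rewrite ?normr1 ?mul1r// normr0 mul0r.
apply: lerD; last exact: fnrm_le fM fI.
by apply: le_trans (yM k); exact: VX0_fnrm_le.
Qed.

Lemma defect_entry_small (rho : R) : 0 < rho -> exists n, forall k, (n <= k)%N ->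
  forall c, 0 <= len c -> `|defect k c| <= rho.
Proof.
move=> r0; have r4 : 0 < rho / 4 by rewrite divr_gt0.
have r2 : 0 < rho / 2 by rewrite divr_gt0.
have [d d0 dP] := f_uc r2; have [n1 h1] := yf r4; have [n2 h2] := cut_cvg d0.
exists (maxn n1 n2) => k; rewrite geq_max => /andP[k1 k2] c lc.
have := h1 k k1 c.1; have := h1 k k1 c.2; rewrite /defect /df.
set a := y k c.2 - f c.2; set b := y k c.1 - f c.1 => ha hb.
have hab : `|a - b| <= rho / 2 by apply: le_trans (ler_normB _ _) _; lra.
case: (ltP (cut k) (len c)) => hc.
  have -> : y k c.2 - y k c.1 - true%:R * (f c.2 - f c.1) = a - b by rewrite /a /b /=; ring.
  by lra.
have : `|f c.2 - f c.1| <= rho / 2.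
  by apply: dP; rewrite ger0_norm//; apply: le_trans hc (h2 k k2).
have -> : y k c.2 - y k c.1 - false%:R * (f c.2 - f c.1) = (a - b) + (f c.2 - f c.1).
  by rewrite /a /b /=; ring.
move=> hf; apply: le_trans (ler_normD _ _) _; lra.
Qed.

(** As only finitely many k are concerned, [K^-1] can be taken below all their cutoffs; there
    [defect k] is the increment of [y k], which lies in V_X^0. *)
Lemma defect_tail_small n L (eta : R) : 0 < eta -> exists2 K, (0 < K)%N &
  forall k I, (n <= k <= n + L)%N -> interval_family I ->
    (forall c, c \in I -> len c <= K%:R^-1) -> nrm e (map (defect k) I) <= eta.
Proof.
move=> eta0.
have [r r0 rP] : exists2 r : R, 0 < r & forall k, (n <= k <= n + L)%N -> r <= cut k /\
    forall I, interval_family I -> all (fun c => len c <= r) I -> fnrm e (y k) I <= eta.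
  elim: L => [|L [r r0 rP]].
    have [r r0 rP] := VX0_fnrm_small (y n) eta0.
    exists (Num.min r (cut n)); first by rewrite lt_min r0 cut0.
    move=> k; rewrite addn0 -eqn_leq => /eqP <-; rewrite ge_min lexx orbT; split=> // I fI aI.
    apply: rP => //; apply: sub_all aI => c /le_trans; apply.
    by rewrite ge_min lexx.
  have [r' r'0 r'P] := VX0_fnrm_small (y (n + L.+1)%N) eta0.
  exists (Num.min r (Num.min r' (cut (n + L.+1)))); first by rewrite !lt_min r0 r'0 cut0.
  set m := Num.min _ _; have m1 : m <= r by rewrite /m ge_min lexx.
  have m2 : m <= r' by rewrite /m !ge_min lexx !orbT.
  have m3 : m <= cut (n + L.+1)%N by rewrite /m !ge_min lexx !orbT.
  move=> k /andP[nk]; rewrite leq_eqVlt => /predU1P[->|kl].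
    split=> // I fI aI; apply: r'P => //; apply: sub_all aI => c /le_trans; exact.
  have [|h1 h2] := rP k; first by rewrite nk -ltnS -addnS.
  split; first exact: le_trans m1 h1.
  by move=> I fI aI; apply: h2 => //; apply: sub_all aI => c /le_trans; exact.
exists (Num.truncn r^-1).+1 => // k I kn fI lI.
have Kr : (Num.truncn r^-1).+1%:R^-1 <= r.
  by rewrite -[leRHS]invrK lef_pV2 ?posrE ?ltr0n ?invr_gt0// ltW// truncnS_gt.
have [rc rN] := rP k kn.
have -> : map (defect k) I = map (df (y k)) I.
  apply/eq_in_map => c cI; rewrite /defect (_ : (cut k < len c) = false) ?mul0r ?subr0//.
  by apply/negbTE; rewrite -leNgt; apply: le_trans (lI c cI) _; exact: le_trans Kr rc.
by apply: rN => //; apply/allP => c cI; exact: le_trans (lI c cI) Kr.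
Qed.

(** Listing each family by decreasing length gives the coordinates a meaning common to all families:
    from position K on, the intervals have length at most 1/K. *)
Let T := {b : seq (U * U) * (nat -> R) |
  [/\ interval_family b.1, sorted len_ge b.1 & dual_sequence e b.2]}.

Let h k (b : T) : R := pairing (sval b).2 (map (defect k) (sval b).1).

(** The pairing is split at position [K], behind which the intervals are short. In front of [K] the
    functional is replaced by a coordinatewise cluster point [l]: its tail beyond [K0] is small by
    reflexivity, and the first [K0] entries are uniformly small. [K0], [rho] and n depend only on
    [l], as [simons] requires n before [L]; [K] and [rho2] may depend on [L]. *)
Lemma defect_weakly_null (b : nat -> T) (c0 : R) : 0 < c0 -> exists n, forall L M,
  exists2 m, (M <= m)%N & forall k, (n <= k <= n + L)%N -> h k (b m) < c0.
Proof.
move=> c00; have B0 := basis0_gt0 e.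
have db m : dual_sequence e (sval (b m)).2 by have [] := svalP (b m).
have [l dl lP] := dual_sequence_cluster db.
have W1 : 0 < W + 1 by rewrite ltr_wpDl.
have [|K0 K0P] := @dual_sequence_tail _ _ e reflX l (c0 / 8 / (W + 1)) dl.
  by rewrite !divr_gt0.
have K01 : 0 < K0%:R + 1 :> R by rewrite ltr_wpDl.
pose rho := c0 / 8 / `|e 0%N| / (K0%:R + 1).
have rho0 : 0 < rho by rewrite !divr_gt0.
have [n nP] := defect_entry_small rho0.
exists n => L M.
have c4 : 0 < c0 / 4 by rewrite divr_gt0.
have [K K_gt0 KP] := defect_tail_small n L c4.
have K1 : 0 < K%:R + 1 :> R by rewrite ltr_wpDl.
pose rho2 := c0 / 8 * `|e 0%N| / (K%:R + 1) / (W + 1).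
have rho20 : 0 < rho2 by rewrite !divr_gt0// mulr_gt0// divr_gt0.
have [m Mm mP] := lP K rho2 M rho20; exists m => // k kn.
rewrite /h; case: (b m) mP => -[I x] /= [fI sI dx] mP.
set s := map (defect k) I.
have sW : nrm e s <= W by exact: defect_le.
have s_small i : `|s`_i| <= rho.
  apply: nth_le; first exact: ltW.
  move=> _ /mapP[c cI ->]; apply: nP; first by case/andP: kn.
  exact: family_len_ge0 cI.
have s_bd i : `|s`_i| <= W / `|e 0%N|.
  apply: nth_le; first by rewrite divr_ge0// ltW.
  by move=> x0 xs; rewrite ler_pdivlMr//; apply: le_trans sW; exact: nrm_entry_le.
have p1 : `|pairing x (nseq K 0 ++ drop K s)| <= c0 / 4.
  apply: le_trans (dx _) _; rewrite nrm_nseq0 /s -map_drop; apply: KP => //.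
    exact: family_subseq (drop_subseq _ _) fI.
  by move=> c; exact: sorted_len_le.
have p2 : `|\sum_(i < K) s`_i * x i - \sum_(i < K) s`_i * l i| <= c0 / 8.
  rewrite -sumrB (le_trans (ler_norm_sum _ _ _))//.
  apply: (@le_trans _ _ (\sum_(i < K) W / `|e 0%N| * rho2)).
    apply: ler_sum => i _; rewrite -mulrBr normrM ler_pM//.
    by apply/ltW/mP.
  rewrite sumr_const card_ord -[_ *+ K]mulr_natl.
  have -> : K%:R * (W / `|e 0%N| * rho2) = c0 / 8 * ((K%:R / (K%:R + 1)) * (W / (W + 1))).
    by rewrite /rho2; field; rewrite !gt_eqF.
  rewrite -[leRHS]mulr1 ler_pM2l ?divr_gt0//; apply: mulr_ile1.
  - by rewrite divr_ge0// ltW.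
  - by rewrite divr_ge0// ltW.
  - by rewrite ler_pdivrMr// mul1r lerDl.
  - by rewrite ler_pdivrMr// mul1r lerDl.
have p3 : `|\sum_(i < K) s`_i * l i| <= c0 / 8 + c0 / 8.
  have -> : \sum_(i < K) s`_i * l i = pairing l (take K s).
    rewrite (@pairing_widen _ _ _ K) ?size_take_min ?geq_minl//.
    by apply: eq_bigr => i _; rewrite nth_take.
  rewrite (pairing_split _ _ K0) (le_trans (ler_normD _ _))// lerD//.
    rewrite (le_trans (ler_norm_sum _ _ _))//.
    apply: (@le_trans _ _ (\sum_(i < K0) rho * `|e 0%N|)).
      apply: ler_sum => i _; rewrite normrM ler_pM// ?(dual_sequence_le _ dl)//.
      have [iK|Ki] := ltnP i K; first by rewrite nth_take.
      by rewrite nth_default ?normr0 ?ltW// size_take_min (leq_trans (geq_minl _ _)).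
    rewrite sumr_const card_ord -[_ *+ K0]mulr_natl.
    have -> : K0%:R * (rho * `|e 0%N|) = c0 / 8 * (K0%:R / (K0%:R + 1)).
      by rewrite /rho; field; rewrite !gt_eqF.
    rewrite -[leRHS]mulr1 ler_pM2l ?divr_gt0// ltW// ltr_pdivrMr// mul1r ltrDl//.
  apply: le_trans (K0P _ _) _.
    by move=> i iK0; rewrite nth_cat size_nseq iK0 nth_nseq iK0.
  rewrite nrm_nseq0; apply: (@le_trans _ _ (c0 / 8 / (W + 1) * W)).
    rewrite ler_pM2l ?divr_gt0//; apply: le_trans sW; apply: nrm_subseq.
    exact: subseq_trans (drop_subseq _ _) (take_subseq _ _).
  by rewrite mulrAC ler_pdivrMr// ler_pM2l ?divr_gt0// lerDl.
rewrite (pairing_split _ _ K).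
have := ler_norm (pairing x (nseq K 0 ++ drop K s)).
have := ler_norm (\sum_(i < K) s`_i * x i - \sum_(i < K) s`_i * l i).
have := ler_norm (\sum_(i < K) s`_i * l i).
lra.
Qed.

Theorem small_convex_combination (eps : R) N : 0 < eps -> exists a M, weights a N M /\
  forall p, nrm e [seq \sum_(k < M) a k * defect k c | c <- pcells p] <= eps.
Proof.
move=> eps0.
have t0P : [/\ interval_family ([::] : seq (U * U)), sorted len_ge [::] &
    dual_sequence e (fun=> 0)].
  split=> //; first by exact: (@family_cells _ unit_itv0 [::]).
  by move=> s; rewrite /pairing big1 ?normr0 ?nrm_ge0// => i _; rewrite mulr0.
have hW k (b : T) : `|h k b| <= W.
  case: b => -[I x] /= [fI sI dx]; apply: le_trans (dx _) _; exact: defect_le.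
have [a [M [wa aP]]] := simons (exist _ ([::], fun=> 0) t0P : T) hW defect_weakly_null N eps0.
(* Sorting the cells does not change [nrm], and pairing the sorted family with a norming functional
   yields a point of [T], so the one-sided bound of [simons] becomes a norm bound. *)
exists a, M; split=> // p; pose I := sort len_ge (pcells p).
have pI : perm_eq I (pcells p) by rewrite perm_sort.
pose G c := \sum_(k < M) a k * defect k c.
rewrite -(nrm_perm e (perm_map G pI)).
have [phi [phi1 phiE]] := ex_norming (lincomb e 0 (map G I)).
pose x i := phi (e i).
have dx : dual_sequence e x by move=> s; rewrite -dual_lincomb; exact: phi1.
have bP : [/\ interval_family I, sorted len_ge I & dual_sequence e x].
  split=> //; first exact: family_perm pI (pcells_family p).
  by apply: sort_sorted => c c'; exact: le_total.
have := aP (exist _ (I, x) bP); apply: le_trans.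
rewrite /nrm -phiE dual_lincomb -/x /h /=.
under eq_bigr do rewrite /pairing size_map mulr_sumr.
rewrite exchange_big/= /pairing size_map le_eqVlt; apply/orP; left; apply/eqP.
apply: eq_bigr => i _; rewrite (nth_map (unit_itv0, unit_itv0)) ?ltn_ord//.
rewrite /G mulr_suml; apply: eq_bigr => k _.
by rewrite (nth_map (unit_itv0, unit_itv0)) ?ltn_ord// mulrA.
Qed.

End convex_combinations.

(** * Embedding c0 *)

Section c0_embedding.
Context {R : realType} {X : normedModType R} (e : symmetric_basis X).
Local Notation U := (unit_itv R).
Local Notation V := (VX0 e).

Lemma closed_approx (W : normedModType R) (Y : set W) (g : W) : closed Y ->
  (forall eta : R, 0 < eta -> exists2 y, Y y & `|y - g| <= eta) -> Y g.
Proof.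
move=> cY h; apply: cY => A /nbhs_ballP[r /= r0 rA].
have r2 : 0 < r / 2 by rewrite divr_gt0.
have [y Yy yg] := h _ r2; exists y; split=> //; apply: rA.
rewrite -ball_normE /ball_/= distrC; apply: le_lt_trans yg _.
by rewrite ltr_pdivrMr// ltr_pMr// ltr1n.
Qed.

Lemma alpha_sup_le (f : U -> R^o) p (s : R) : (forall u, `|f u| <= s) ->
  alpha e f p <= (psize p)%:R * (2 * s * `|e 0%N|).
Proof.
move=> fs; apply: le_trans (ler_norm_sum _ _ _) _.
apply: (@le_trans _ _ (\sum_(i < psize p) 2 * s * `|e 0%N|)).
  apply: ler_sum => i _; rewrite normrZ basis_norm ler_wpM2r//.
  by apply: le_trans (ler_normB _ _) _; have := fs (p i.+1); have := fs (p i); lra.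
by rewrite sumr_const card_ord -[_ *+ psize p]mulr_natl.
Qed.

(** The limit is taken uniformly. On a fixed partition uniform convergence controls [alpha], so the
    Cauchy bound passes to the limit partition by partition. *)
Lemma VX0_complete (S : nat -> V) :
  (forall eta : R, 0 < eta -> exists N, forall m n, (N <= m)%N -> (N <= n)%N ->
     `|S m - S n| <= eta) ->
  exists g : V, forall eta : R, 0 < eta -> exists N, forall n, (N <= n)%N -> `|S n - g| <= eta.
Proof.
move=> cS; have B0 := basis0_gt0 e.
have ptw (eta : R) : 0 < eta -> exists N, forall u m n, (N <= m)%N -> (N <= n)%N ->
    `|S m u - S n u| <= eta.
  move=> eta0; have [N NP] := cS _ (mulr_gt0 eta0 B0); exists N => u m n Nm Nn.
  have := VX0_le (S m - S n) u; rewrite ler_pdivlMr// => h.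
  by rewrite -(ler_pM2r B0); apply: le_trans h (NP m n Nm Nn).
have /choice[f fP] : forall u, exists l : R, (fun n => S n u : R) @ \oo --> l.
  move=> u; apply/cvg_ex/cauchy_cvgP/cauchy_exP => r r0.
  have r2 : 0 < r / 2 by rewrite divr_gt0.
  have [N NP] := ptw _ r2; exists (S N u); exists N => // n /= Nn.
  rewrite /ball/=; apply: le_lt_trans (NP u N n (leqnn N) Nn) _.
  by rewrite ltr_pdivrMr// ltr_pMr// ltr1n.
have ptw' (eta : R) : 0 < eta -> exists N, forall u n, (N <= n)%N -> `|f u - S n u| <= eta.
  move=> eta0; have [N NP] := ptw _ eta0; exists N => u n Nn.
  apply/ler_addgt0Pl => r r0.
  have [N' _ N'P] := (cvgrPdistC_lt _ _).1 (fP u) r r0.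
  have h1 := N'P _ (leq_maxr N N'); have h2 := NP u _ n (leq_maxl N N') Nn.
  set m := maxn N N' in h1 h2.
  have -> : f u - S n u = (S m u - S n u) - (S m u - f u) by ring.
  by apply: le_trans (ler_normB _ _) _; move: h1 => /= /ltW; lra.
have diff_le (eta : R) N : 0 < eta ->
    (forall m n, (N <= m)%N -> (N <= n)%N -> `|S m - S n| <= eta) ->
    forall n p, (N <= n)%N -> alpha e (fun u => f u - S n u) p <= eta.
  move=> eta0 NP n p Nn; apply/ler_addgt0Pr => r r0.
  have k0 : 0 < (psize p)%:R + 1 :> R by rewrite ltr_wpDl.
  pose s := r / ((psize p)%:R + 1) / (2 * `|e 0%N|).
  have s0 : 0 < s by rewrite !divr_gt0// mulr_gt0.
  have [N' N'P] := ptw' _ s0; pose m := maxn N N'.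
  apply: le_trans (alpha_diff e _ (S m - S n) p) _; apply: lerD.
    by apply: le_trans (VX0_alpha_le _ p) _; apply: NP => //; exact: leq_maxl.
  apply: le_trans (@alpha_sup_le _ p s _) _.
    move=> u; have -> : f u - S n u - (S m - S n) u = f u - S m u.
      by rewrite VX0_addE VX0_oppE; ring.
    by apply: N'P; exact: leq_maxr.
  have -> : (psize p)%:R * (2 * s * `|e 0%N|) = r * ((psize p)%:R / ((psize p)%:R + 1)).
    by rewrite /s; field; rewrite !gt_eqF.
  by rewrite ler_piMr ?(ltW r0)// ler_pdivrMr// mul1r lerDl.
have f0 : f unit_itv0 = 0.
  apply: (cvg_unique _ (fP unit_itv0)) => //.
  have -> : (fun n => S n unit_itv0 : R) = fun=> 0 by apply/funext => n; rewrite VX0_at0.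
  exact: cvg_cst.
have fV : f \in VX0_pred e.
  apply: VX0_closed => // eta eta0; have [N NP] := cS _ eta0.
  by exists (S N) => p; apply: diff_le NP _ _ _.
exists (MkVX0 fV) => eta eta0; have [N NP] := cS _ eta0; exists N => n Nn.
rewrite distrC; apply: VX0_norm_le => p.
exact: (diff_le eta N eta0 NP n p Nn).
Qed.

Variables (Y : set V) (d : nat -> V) (C rho : R).
Hypothesis subY : closed_subspace Y.
Hypothesis Yd : forall i, Y (d i).
Hypothesis C0 : 0 < C.
Hypothesis rho0 : 0 < rho.
Hypothesis d_up : forall (u : nat -> R) (s : R) m n, (forall i, (m <= i)%N -> `|u i| <= s) ->
  `|\sum_(m <= i < n) u i *: d i| <= C * s.
Hypothesis d_low : forall (u : nat -> R) (s : R) j n, (forall i, `|u i| <= s) -> (j < n)%N ->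
  `|u j| * rho - s * (rho / 2) <= `|\sum_(0 <= i < n) u i *: d i|.

Lemma subspace_sum (W : normedModType R) (Z : set W) (r : seq nat) (u : nat -> R) (v : nat -> W) :
  closed_subspace Z -> (forall i, Z (v i)) -> Z (\sum_(i <- r) u i *: v i).
Proof.
by move=> [Z0 ZS _] Zv; elim: r => [|i r IH]; rewrite ?big_nil// big_cons; exact: ZS.
Qed.

Lemma c0_le (u : c0 R) i : `|u i| <= `|u|.
Proof. by have [M uM] := c0_bounded u; exact: (le_sup_range i uM). Qed.

Lemma c0_tail (u : c0 R) (eta : R) : 0 < eta -> exists m, forall i, (m <= i)%N -> `|u i| <= eta.
Proof.
move=> eta0; case: u => u uP; have u0 : u @ \oo --> (0 : R^o) by exact: set_mem uP.
have [m _ mP] := (cvgrPdistC_lt _ _).1 u0 eta eta0; exists m => i mi.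
by have := mP i mi; rewrite /= subr0 => /ltW.
Qed.

(** [T u] is the sum of the series of [u i *: d i], convergent by [d_up]. For the lower bound, an
    index j with [|u j|] above 3/4 of [|u|] leaves [(3/4 - 1/2) * rho] in [d_low], whence the
    constant [rho / 4]. *)
Lemma contains_c0 : contains_copy (c0 R) Y.
Proof.
pose S (u : c0 R) n : V := \sum_(0 <= i < n) u i *: d i.
have /choice[T TP] : forall u : c0 R, exists g : V, forall eta : R, 0 < eta ->
    exists N, forall n, (N <= n)%N -> `|S u n - g| <= eta.
  move=> u; apply: VX0_complete => eta eta0.
  have [m mP] := c0_tail u (divr_gt0 eta0 C0); exists m.
  have key a b : (m <= a)%N -> (a <= b)%N -> `|S u b - S u a| <= eta.
    move=> ma ab; rewrite /S (@big_cat_nat _ _ _ a 0 b)//= addrAC subrr add0r.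
    apply: le_trans (@d_up u (eta / C) a b _) _; last by rewrite mulrC divfK// gt_eqF.
    by move=> i ai; apply: mP; exact: leq_trans ai.
  move=> a b ma mb; have [ab|ba] := leqP a b; first by rewrite distrC key.
  by apply: key => //; exact: ltnW.
have Tlim (u : c0 R) g : (forall eta : R, 0 < eta -> exists N, forall n, (N <= n)%N ->
    `|S u n - g| <= eta) -> T u = g.
  move=> gP; apply/eqP; rewrite -subr_eq0 -normr_le0; apply/ler_addgt0Pl => r r0.
  have r2 : 0 < r / 2 by rewrite divr_gt0.
  have [N1 h1] := TP u _ r2; have [N2 h2] := gP _ r2.
  have -> : T u - g = (S u (maxn N1 N2) - g) - (S u (maxn N1 N2) - T u).
    by rewrite opprB addrACA [- g + _]addrC addrACA subrr add0r.
  rewrite addr0 (le_trans (ler_normB _ _))// [leRHS]splitr.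
  by apply: lerD; [apply: h2; exact: leq_maxr | apply: h1; exact: leq_maxl].
have lT : linear T.
  move=> a u v; apply: Tlim => eta eta0.
  have a1 : 0 < `|a| + 1 by rewrite ltr_wpDl.
  have e1 : 0 < eta / 2 / (`|a| + 1) by rewrite !divr_gt0.
  have e2 : 0 < eta / 2 by rewrite divr_gt0.
  have [N1 h1] := TP u _ e1; have [N2 h2] := TP v _ e2; exists (maxn N1 N2) => n.
  rewrite geq_max => /andP[n1 n2].
  have -> : S (a *: u + v) n = a *: S u n + S v n.
    rewrite /S scaler_sumr -big_split/=; apply: eq_bigr => i _.
    by rewrite scalerA -scalerDl.
  rewrite opprD addrACA -scalerBr (le_trans (ler_normD _ _))// [leRHS]splitr.
  apply: lerD; last exact: h2.
  rewrite normrZ; apply: (@le_trans _ _ ((`|a| + 1) * `|S u n - T u|)).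
    by rewrite ler_wpM2r// lerDl.
  by rewrite mulrC -ler_pdivlMr//; exact: h1.
exists (pack_linear lT); split.
  move=> _ [u _ <-] /=; have [_ _ cY] := subY; apply: closed_approx cY _ => eta eta0.
  have [N NP] := TP u _ eta0; exists (S u N); last exact: NP.
  exact: subspace_sum.
exists (rho / 4), C; split; first by rewrite divr_gt0.
move=> u; apply/andP; split.
  have [u0|un0] := eqVneq `|u| 0; first by rewrite u0 mulr0.
  have u0 : 0 < `|u| by rewrite lt_neqAle eq_sym un0 normr_ge0.
  have u4 : 0 < `|u| / 4 by rewrite divr_gt0.
  have [j uj] : exists j, `|u| - `|u| / 4 < `|u j|.
    have hs : has_sup (range (fun n => `|u n|)).
      split; first by exists `|u 0%N|, 0%N.
      by exists `|u| => _ [i _ <-]; exact: c0_le.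
    by have [_ [j _ <-] h] := sup_adherent u4 hs; exists j.
  apply/ler_addgt0Pl => r r0; have [N NP] := TP u _ r0.
  have h1 := @d_low u `|u| j (maxn N j.+1) (c0_le u) (leq_maxr N j.+1).
  have h2 := NP _ (leq_maxl N j.+1).
  have h3 := ler_normD (S u (maxn N j.+1) - T u) (T u); rewrite subrK in h3.
  have h4 : (`|u| - `|u| / 4) * rho <= `|u j| * rho by rewrite ler_pM2r// ltW.
  rewrite /= -/(T u); rewrite -/(S u _) in h1; lra.
apply/ler_addgt0Pl => r r0; have [N NP] := TP u _ r0.
have h1 := @d_up u `|u| 0 N (fun i _ => c0_le u i).
have h2 := NP N (leqnn N).
have h3 := ler_normB (S u N) (S u N - T u); rewrite subKr in h3.
by rewrite -/(S u _) in h1; rewrite /=; lra.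
Qed.

End c0_embedding.

(** * Convex blocks and the copy of c_0 in the subspace *)

Section blocks.
Context {R : realType} {X : normedModType R} (e : symmetric_basis X).
Local Notation U := (unit_itv R).
Local Notation V := (VX0 e).
Hypothesis reflX : reflexive_space X.

Definition harm (k : nat) : R := k.+1%:R^-1.

Lemma harm_gt0 k : 0 < harm k. Proof. by rewrite invr_gt0. Qed.

Lemma harm_le k l : (k <= l)%N -> harm l <= harm k.
Proof. by move=> kl; rewrite lef_pV2 ?posrE ?ltr0n// ler_nat. Qed.

Lemma harm_cvg (eta : R) : 0 < eta -> exists n, forall k, (n <= k)%N -> harm k <= eta.
Proof.
move=> eta0; exists (Num.truncn eta^-1) => k nk; apply: le_trans (harm_le nk) _.
by rewrite -[leRHS]invrK lef_pV2 ?posrE ?ltr0n ?invr_gt0// ltW// truncnS_gt.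
Qed.

Lemma df_sum n (a : nat -> R) (h : nat -> V) c :
  df (\sum_(k < n) a k *: h k : V) c = \sum_(k < n) a k * df (h k) c.
Proof. by rewrite /df !VX0_sumE -sumrB; apply: eq_bigr => k _; rewrite mulrBr. Qed.

(** The case [f = 0] of [small_convex_combination], in which [defect k] is the plain increment of
    [h k]. *)
Lemma unif_null_convex (h : nat -> V) (M : R) : (forall k, `|h k| <= M) ->
  (forall eta : R, 0 < eta -> exists n, forall k, (n <= k)%N -> forall u, `|h k u| <= eta) ->
  forall (eps : R) N, 0 < eps -> exists a M', weights a N M' /\
    `|\sum_(k < M') a k *: h k| <= eps.
Proof.
move=> hM h0 eps N eps0.
have [|||a [M' [wa aP]]] := @small_convex_combination _ _ e reflX (fun=> 0) 0 _ _ h M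
  harm hM _ harm_gt0 harm_cvg eps N eps0.
- by move=> p; rewrite alpha_fnrm /fnrm /df subrr /nrm lincomb_map0 normr0.
- by move=> eta eta0; exists 1 => // u v _; rewrite subrr normr0 ltW.
- by move=> eta eta0; have [n nP] := h0 eta eta0; exists n => k nk u; rewrite subr0 nP.
exists a, M'; split=> //; apply: VX0_norm_le => p; apply: le_trans (aP p).
rewrite alpha_fnrm /fnrm le_eqVlt; apply/orP; left; apply/eqP; congr nrm.
apply: eq_map => c; rewrite df_sum; apply: eq_bigr => k _; congr (_ * _).
by rewrite /defect [df (fun=> 0) c]subrr mulr0 subr0.
Qed.

Variable Y : set V.
Hypothesis subY : closed_subspace Y.

Lemma in_closed_subspace (g : V) (M : R) :
  (forall eps : R, 0 < eps -> exists y, [/\ Y y, `|y| <= M & forall u, `|y u - g u| <= eps]) ->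
  Y g.
Proof.
move=> appr; have [Y0 YS cY] := subY.
have /choice[y yP] : forall k, exists y, [/\ Y y, `|y| <= M & forall u, `|y u - g u| <= harm k].
  by move=> k; apply: appr; exact: harm_gt0.
apply: closed_approx cY _ => eta eta0.
have [||a [M' [[a0 az a1] aP]]] := @unif_null_convex (fun k => y k - g) (M + `|g|) _ _ eta 0 eta0.
- by move=> k; rewrite (le_trans (ler_normB _ _))// lerD2r; have [] := yP k.
- move=> eta' /harm_cvg[n nP]; exists n => k nk u; rewrite VX0_addE VX0_oppE.
  by have [_ _ h] := yP k; apply: le_trans (h u) (nP k nk).
have yY k : Y (y k) by have [] := yP k.
exists (\sum_(k < M') a k *: y k).
  have := @subspace_sum _ V Y (index_iota 0 M') a y subY yY.
  by rewrite big_mkord.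
have <- : \sum_(k < M') a k *: (y k - g) = \sum_(k < M') a k *: y k - g.
  by under eq_bigr do rewrite scalerBr; rewrite sumrB -scaler_suml a1 scale1r.
exact: aP.
Qed.

Variables (f : U -> R^o) (Mf My : R).
Hypothesis f0 : f unit_itv0 = 0.
Hypothesis fM : forall p, alpha e f p <= Mf.
Hypothesis f_uc : forall eta : R, 0 < eta -> exists2 d, 0 < d &
  forall u v, `|pos u - pos v| <= d -> `|f u - f v| <= eta.
Hypothesis appr : forall eps : R, 0 < eps ->
  exists y, [/\ Y y, `|y| <= My & forall u, `|y u - f u| <= eps].
Hypothesis fV : f \notin VX0_pred e.

Lemma mesh_variation_ge : exists2 rho : R, 0 < rho & forall eps : R, 0 < eps ->
  exists2 p, mesh p <= eps & rho < alpha e f p.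
Proof.
apply: contrapT => hno; move/negP: fV; apply; apply: (@VX0_predP _ _ e f Mf) => // eta eta0.
apply: contrapT => hno2; apply: hno; exists eta => // eps eps0.
apply: contrapT => hno3; apply: hno2; exists eps => // p pe.
by rewrite leNgt; apply/negP => h; apply: hno3; exists p.
Qed.

Lemma ex_min_len (I : seq (U * U)) : (forall c, c \in I -> 0 < len c) ->
  exists2 r : R, 0 < r & forall c, c \in I -> r <= len c.
Proof.
elim: I => [|c I IH] h; first by exists 1.
have [|r r0 rP] := IH; first by move=> c' cI; apply: h; rewrite in_cons cI orbT.
exists (Num.min r (len c)); first by rewrite lt_min r0 h// mem_head.
move=> c'; rewrite in_cons => /predU1P[->|/rP]; first by rewrite ge_min lexx orbT.
by apply: le_trans; rewrite ge_min lexx.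
Qed.

(** An averaged cutoff: for weights on [[N, M[] it is 1 on intervals longer than [harm N] and 0 on
    those of length at most [harm M]. *)
Let th (a : nat -> R) M (c : U * U) : R := \sum_(k < M) a k * (harm k < len c)%R%:R.

(* On [q j] only the difference of the cutoffs number [j] and [j + 1] is active,
   and the cutoffs increase with [j]; hence differences of the blocks span [c_0]. *)
Lemma c0_from_blocks : contains_copy (c0 R) Y.
Proof.
have [rho rho0 rhoP] := mesh_variation_ge.
have Mf0 : 0 <= Mf.
  have [p _] := @ex_partition R 1 ltr01; apply: le_trans (fM p); exact: normr_ge0.
have /choice[y yP] : forall k, exists y, [/\ Y y, `|y| <= My & forall u, `|y u - f u| <= harm k].
  by move=> k; apply: appr; exact: harm_gt0.
have yY k : Y (y k) by have [] := yP k.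
have yM k : `|y k| <= My by have [] := yP k.
have yf (eta : R) : 0 < eta -> exists n, forall k, (n <= k)%N -> forall u, `|y k u - f u| <= eta.
  move=> /harm_cvg[n nP]; exists n => k nk u.
  by have [_ _ h] := yP k; apply: le_trans (h u) (nP k nk).
(* A difference of consecutive blocks has error at most [2 * sg i]. These add up to at most
   [rho / 2], the loss that [contains_c0] tolerates. *)
pose sg j : R := rho / 8 * 2 ^- j.
have sg0 j : 0 < sg j by rewrite mulr_gt0 ?divr_gt0// invr_gt0 exprn_gt0.
(* A block starting at N consists of weights up to M, a partition so fine that the block's cutoff
   vanishes on it although [f] still has variation above [rho] there, and a start for the next block
   so late that its cutoff equals 1 on that partition. *)
have /choice[G GP] : forall jN : nat * nat,
    exists t : (nat -> R) * nat * Defs.partition R * nat,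
    [/\ weights t.1.1.1 jN.2 t.1.1.2,
      forall p, nrm e [seq \sum_(k < t.1.1.2) t.1.1.1 k * defect f y harm k c | c <- pcells p]
        <= sg jN.1,
      mesh t.1.2 <= harm t.1.1.2 /\ rho < alpha e f t.1.2,
      (t.1.1.2 <= t.2)%N & forall c, c \in pcells t.1.2 -> harm t.2 < len c].
  move=> [j N] /=.
  have [a [M [wa aP]]] := small_convex_combination reflX fM f_uc yM yf harm_gt0 harm_cvg N (sg0 j).
  have [q qm qr] := rhoP _ (harm_gt0 M).
  have [r r0 rP] := ex_min_len (@pcells_len_gt0 R q).
  have [n nP] := harm_cvg (divr_gt0 r0 (ltr0n R 2)).
  exists (a, M, q, maxn M n); split=> //=; first exact: leq_maxl.
  move=> c cq; apply: le_lt_trans (nP _ (leq_maxr M n)) _.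
  apply: lt_le_trans (rP c cq).
  by rewrite ltr_pdivrMr// ltr_pMr// ltr1n.
pose Ns := fix Ns j := if j is j'.+1 then (G (j', Ns j')).2 else 0%N.
pose a j := (G (j, Ns j)).1.1.1; pose M j := (G (j, Ns j)).1.1.2.
pose q j := (G (j, Ns j)).1.2.
have wa j : weights (a j) (Ns j) (M j) by have [] := GP (j, Ns j).
have aP j p : nrm e [seq \sum_(k < M j) a j k * defect f y harm k c | c <- pcells p] <= sg j.
  by have [_ + _ _ _] := GP (j, Ns j); exact.
have qm j : mesh (q j) <= harm (M j) by have [_ _ []] := GP (j, Ns j).
have qr j : rho < alpha e f (q j) by have [_ _ []] := GP (j, Ns j).
have MN j : (M j <= Ns j.+1)%N by have [] := GP (j, Ns j).
have ql j c : c \in pcells (q j) -> harm (Ns j.+1) < len c.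
  by have [_ _ _ _ +] := GP (j, Ns j); exact.
have NM j : (Ns j <= M j)%N.
  rewrite leqNgt; apply/negP => MNj; have [_ az a1] := wa j.
  have : \sum_(k < M j) a j k = 0.
    rewrite big1// => k _; apply: az; apply/negP => /andP[Nk kM].
    by move: (leq_ltn_trans Nk kM); rewrite ltnNge ltnW.
  by rewrite a1 => /eqP; rewrite oner_eq0.
have MS j : (M j <= M j.+1)%N := leq_trans (MN j) (NM j.+1).
have Mmono i j : (i <= j)%N -> (M i <= M j)%N.
  move=> ij; exact: (@homo_leq _ M leq leqnn leq_trans MS).
have Nmono i j : (i <= j)%N -> (Ns i <= Ns j)%N.
  have NS l : (Ns l <= Ns l.+1)%N := leq_trans (NM l) (MN l).
  move=> ij; exact: (@homo_leq _ Ns leq leqnn leq_trans NS).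
pose t j c := th (a j) (M j) c.
have t_ge0 j c : 0 <= t j c.
  by apply: sumr_ge0 => k _; rewrite mulr_ge0//; have [] := wa j.
have t_le1 j c : t j c <= 1.
  have [a0 az a1] := wa j; rewrite -a1; apply: ler_sum => k _.
  by rewrite ler_piMr//; case: (harm k < len c).
have t1 j c : harm (Ns j) < len c -> t j c = 1.
  move=> hc; have [a0 az a1] := wa j; rewrite -a1; apply: eq_bigr => k _.
  have [Nk|Nk] := leqP (Ns j) k; last by rewrite az ?mul0r// leqNgt Nk.
  by rewrite (le_lt_trans (harm_le Nk) hc) mulr1.
have t0 j c : len c <= harm (M j) -> t j c = 0.
  move=> hc; rewrite /t /th big1// => k _.
  have -> : (harm k < len c) = false; last by rewrite mulr0.
  by apply/negbTE; rewrite -leNgt; apply: le_trans hc (harm_le (ltnW (ltn_ord k))).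
have t_mono j c : t j c <= t j.+1 c.
  have [h|h] := ltP (harm (Ns j.+1)) (len c); first by rewrite (t1 j.+1).
  by rewrite (t0 j)//; apply: le_trans h (harm_le (MN j)).
pose z j : V := \sum_(k < M j) a j k *: y k.
pose D j c := \sum_(k < M j) a j k * defect f y harm k c.
have dz j c : df (z j) c = t j c * df f c + D j c.
  rewrite df_sum /t /th /D mulr_suml -big_split/=; apply: eq_bigr => k _.
  by rewrite /defect; ring.
pose d j : V := z j.+1 - z j.
pose w i c := t i.+1 c - t i c.
have w0 i c : 0 <= w i c by rewrite subr_ge0.
(* The [w i] are non-negative and telescope, so bounded coefficients multiply the increments of [f]
   by a bounded factor; unconditionality turns this into the upper c_0 estimate. *)
have wsum n c : \sum_(i < n) w i c <= 1.
  have -> : \sum_(i < n) w i c = t n c - t 0%N c.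
    by rewrite -(big_mkord xpredT (fun i => w i c)) telescope_sumr.
  by have := t_ge0 0%N c; have := t_le1 n c; lra.
have dd i c : df (d i) c = w i c * df f c + (D i.+1 c - D i c).
  have -> : df (d i) c = df (z i.+1) c - df (z i) c.
    by rewrite /df /d !VX0_addE !VX0_oppE; ring.
  by rewrite !dz /w; ring.
have errD i p : nrm e [seq D i.+1 c - D i c | c <- pcells p] <= 2 * sg i.
  apply: le_trans (nrm_mapD _ _ _ (fun c => - D i c)) _.
  have -> : nrm e [seq - D i c | c <- pcells p] = nrm e (map (D i) (pcells p)).
    by apply: nrm_map_abs => c _; rewrite normrN.
  have := aP i p; have := aP i.+1 p; rewrite -/(D i) -/(D i.+1).
  have : sg i.+1 <= sg i.
    rewrite /sg ler_pM2l ?divr_gt0// lef_pV2 ?posrE ?exprn_gt0//.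
    by rewrite exprS ler_pMl ?exprn_gt0// ler1n.
  lra.
have sg_sum n : \sum_(i < n) 2 * sg i <= rho / 2.
  have -> : \sum_(i < n) 2 * sg i = rho / 2 * (1 - 2 ^- n).
    elim: n => [|n IH]; first by rewrite big_ord0 expr0 invr1 subrr mulr0.
    by rewrite big_ord_recr/= IH /sg exprS; field; rewrite expf_neq0.
  have : 0 < 2 ^- n :> R by rewrite invr_gt0 exprn_gt0.
  nra.
have err (u : nat -> R) (s : R) n p : (forall i, `|u i| <= s) ->
    nrm e [seq \sum_(i < n) u i * (D i.+1 c - D i c) | c <- pcells p] <= s * (rho / 2).
  move=> us; have s0 : 0 <= s by apply: le_trans (us 0%N).
  apply: le_trans (nrm_map_sum e _ n (fun i c => u i * (D i.+1 c - D i c))) _.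
  apply: (@le_trans _ _ (\sum_(i < n) s * (2 * sg i))).
    by apply: ler_sum => i _; rewrite nrm_mapZ ler_pM// nrm_ge0.
  by rewrite -mulr_sumr ler_wpM2l.
have dsum (u : nat -> R) n c : df (\sum_(i < n) u i *: d i : V) c =
    (\sum_(i < n) u i * w i c) * df f c + \sum_(i < n) u i * (D i.+1 c - D i c).
  rewrite df_sum mulr_suml -big_split/=; apply: eq_bigr => i _.
  by rewrite dd; ring.
have up (u : nat -> R) (s : R) n : (forall i, `|u i| <= s) ->
    `|\sum_(i < n) u i *: d i| <= (Mf + rho / 2) * s.
  move=> us; have s0 : 0 <= s by apply: le_trans (us 0%N).
  apply: VX0_norm_le => p; rewrite alpha_fnrm /fnrm (eq_map (dsum u n)).
  apply: le_trans (nrm_mapD _ _ _ _) _; rewrite mulrDl; apply: lerD.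
    apply: (@le_trans _ _ (nrm e [seq s * df f c | c <- pcells p])).
      apply: nrm_map_le => c _; rewrite !normrM ler_wpM2r// (ger0_norm s0).
      apply: le_trans (ler_norm_sum _ _ _) _.
      apply: (@le_trans _ _ (\sum_(i < n) s * w i c)).
        by apply: ler_sum => i _; rewrite normrM (ger0_norm (w0 i c)) ler_wpM2r.
      by rewrite -mulr_sumr ler_piMr.
    rewrite nrm_mapZ ger0_norm// mulrC ler_wpM2r//.
    by apply: fnrm_le fM _; exact: pcells_family.
  by rewrite mulrC; exact: err.
apply: (@contains_c0 _ _ e Y d (Mf + rho / 2) rho) => //.
- move=> i; have [Y0 YS _] := subY.
  have Yz j : Y (z j).
    have := @subspace_sum _ V Y (index_iota 0 (M j)) (a j) y subY yY.
    by rewrite big_mkord.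
  by rewrite /d addrC -scaleN1r; exact: YS.
- by rewrite ltr_wpDl// divr_gt0.
- move=> u s m n us.
  pose u' i := if (i < m)%N then 0 else u i.
  have s0 : 0 <= s by apply: le_trans (us m (leqnn m)).
  have u's i : `|u' i| <= s.
    by rewrite /u'; case: ltnP => h; rewrite ?normr0//; exact: us.
  have := up u' s n u's; rewrite -(big_mkord xpredT (fun i => u' i *: d i)).
  have [mn|nm] := leqP m n; last first.
    move=> _; rewrite big_geq ?(ltnW nm)// normr0; apply: mulr_ge0 => //.
    by apply: addr_ge0 => //; rewrite divr_ge0// ltW.
  rewrite (@big_cat_nat _ _ _ m)//= [X in X + _]big_nat_cond big1 ?add0r; last first.
    by move=> i /andP[/andP[_ im] _]; rewrite /u' im scale0r.
  rewrite big_nat_cond [in X in _ -> X]big_nat_cond.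
  under eq_bigr => i /andP[/andP[mi _] _] do rewrite /u' ltnNge mi/=.
  by [].
- move=> u s j n us jn; rewrite big_mkord.
  apply: le_trans (VX0_alpha_le _ (q j)); rewrite alpha_fnrm /fnrm (eq_map (dsum u n)).
  (* The lengths in [q j] lie between the cutoffs of the blocks j and j + 1: [t i] is 0 for [i <= j]
     and 1 for [i > j], so only [w j] differs from 0. *)
  have E : {in pcells (q j), forall c, \sum_(i < n) u i * w i c = u j}.
    move=> c cq; rewrite (bigD1 (Ordinal jn))//= {1}/w t1 ?ql//.
    rewrite t0; last by apply: le_trans (pcells_len cq) (qm j).
    rewrite subr0 mulr1 big1 ?addr0// => i; rewrite -val_eqE/= => ij.
    have [lt|gt|eq] := ltngtP i j; last by rewrite eq eqxx in ij.
      rewrite /w !t0 ?subrr ?mulr0//; apply: le_trans (pcells_len cq) _;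
      apply: le_trans (qm j) _; apply: harm_le; apply: Mmono => //; exact: ltnW.
    rewrite /w !t1 ?subrr ?mulr0//; apply: le_lt_trans (ql j c cq); apply: harm_le;
    apply: Nmono => //.
    exact: ltnW.
  rewrite lerBlDr.
  have h1 : `|u j| * rho <= nrm e [seq u j * df f c | c <- pcells (q j)].
    by rewrite nrm_mapZ ler_wpM2l//; have := qr j; rewrite alpha_fnrm => /ltW.
  apply: (le_trans h1).
  have -> : [seq u j * df f c | c <- pcells (q j)] =
      [seq ((\sum_(i < n) u i * w i c) * df f c + \sum_(i < n) u i * (D i.+1 c - D i c)) +
        - \sum_(i < n) u i * (D i.+1 c - D i c) | c <- pcells (q j)].
    by apply/eq_in_map => c cq; rewrite addrK E.
  apply: le_trans (nrm_mapD _ _ _ _) _; rewrite lerD2l.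
  rewrite (@nrm_map_abs _ _ e _ _ _ (fun c => \sum_(i < n) u i * (D i.+1 c - D i c))).
    exact: err.
  by move=> c _; rewrite normrN.
Qed.

End blocks.

(** * From a copy of c0 to a continuous weak* limit *)

Section continuity.
Context {R : realType}.
Local Notation U := (unit_itv R).
Implicit Types (f : U -> R^o) (u v t : U).

(** The Heine-Cantor theorem; a cluster point of pairs violating uniform continuity would contradict
    continuity there. *)
Lemma C01P f : C01 R f <-> forall eta : R, 0 < eta -> exists2 d, 0 < d &
  forall u v, `|pos u - pos v| <= d -> `|f u - f v| <= eta.
Proof.
split=> [cf eta eta0|h t]; last first.
  apply/(@cvgrPdist_lt R R^o U (nbhs t) (nbhs_filter t)) => eps eps0.
  have e2 : 0 < eps / 2 by rewrite divr_gt0.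
  have [d d0 dP] := h _ e2; apply/nbhs_ballP; exists d => // u tu.
  apply: le_lt_trans (dP t u _) _; last by rewrite ltr_pdivrMr// ltr_pMr// ltr1n.
  exact: ltW.
apply: contrapT => hno.
have /choice[uv uvP] : forall n : nat, exists uv : U * U,
    `|pos uv.1 - pos uv.2| <= harm n /\ eta < `|f uv.1 - f uv.2|.
  move=> n; apply: contrapT => hn; apply: hno; exists (harm n); first exact: harm_gt0.
  by move=> u v h; rewrite leNgt; apply/negP => h2; apply: hn; exists (u, v).
have [W [PW Woo Wlim]] := @ex_free_ultrafilter R.
have [|l lP] := Wlim (fun n => pos (uv n).1) 1.
  by move=> n; have /andP[h0 h1] := unit_itv_bounds (uv n).1; rewrite ger0_norm.
have l01 : 0 <= l <= 1.
  apply/andP; split; apply/ler_addgt0Pl => r r0; have [n /= h] := filter_ex (lP r r0);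
  have /andP[h0 h1] := unit_itv_bounds (uv n).1; move: h; rewrite ltr_norml => /andP[]; lra.
pose t : U := clamp l.
have e2 : 0 < eta / 2 by rewrite divr_gt0.
have /(@cvgrPdist_lt R R^o U (nbhs t) (nbhs_filter t))/(_ _ e2)/nbhs_ballP[d /= d0 dP] := cf t.
have d2 : 0 < d / 2 by rewrite divr_gt0.
have [N NP] := harm_cvg d2.
have [n [/= h1 h2]] := filter_ex (filterI (lP _ d2) (Woo N)).
have [h3 h4] := uvP n; have := NP n h2.
have tE : pos t = l by rewrite pos_clamp.
move=> h5; have b1 : `|f t - f (uv n).1| < eta / 2.
  apply: (dP (uv n).1); suff : `|pos t - pos (uv n).1| < d by [].
  rewrite tE distrC.
  by apply: lt_trans h1 _; rewrite ltr_pdivrMr// ltr_pMr// ltr1n.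
have b2 : `|f t - f (uv n).2| < eta / 2.
  apply: (dP (uv n).2); suff : `|pos t - pos (uv n).2| < d by [].
  rewrite tE.
  have -> : l - pos (uv n).2 = (pos (uv n).1 - pos (uv n).2) - (pos (uv n).1 - l) by ring.
  by apply: le_lt_trans (ler_normB _ _) _; rewrite [ltRHS]splitr ler_ltD// (le_trans h3).
have := ler_normB (f t - f (uv n).2) (f t - f (uv n).1).
have -> : f t - f (uv n).2 - (f t - f (uv n).1) = f (uv n).1 - f (uv n).2 by ring.
by move: h4 b1 b2; lra.
Qed.

End continuity.

(** * Weakly unconditionally Cauchy series tend to 0 uniformly *)

Section weakly_unconditionally_cauchy.
Context {R : realType} {X : normedModType R} (e : symmetric_basis X).
Local Notation U := (unit_itv R).
Local Notation V := (VX0 e).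
Hypothesis reflX : reflexive_space X.
Variables (u : nat -> V) (C : R).
Hypothesis u_wuc : forall (a : nat -> R) n, (forall i, `|a i| <= 1) ->
  `|\sum_(i < n) a i *: u i| <= C.

(** Choosing the signs of the values at [t] as coefficients shows that these values are absolutely
    summable. *)
Lemma wuc_pointwise t (r : R) : 0 < r -> exists n, forall k, (n <= k)%N -> `|u k t| <= r.
Proof.
move=> r0; pose a i := Num.sg (u i t).
have a1 i : `|a i| <= 1 by rewrite normr_sg; case: (u i t == 0); rewrite //= ler01.
have sumle n : \sum_(i < n) `|u i t| <= C / `|e 0%N|.
  have := VX0_le (\sum_(i < n) a i *: u i) t; rewrite VX0_sumE.
  have -> : \sum_(i < n) (a i *: u i) t = \sum_(i < n) `|u i t|.
    by apply: eq_bigr => i _; rewrite VX0_scaleE /a normrEsg.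
  move=> h; apply: le_trans (ler_norm _) _; apply: le_trans h _.
  by rewrite ler_pM2r ?invr_gt0 ?basis0_gt0// u_wuc.
have cs : cvgn (series (fun i => `|u i t| : R)).
  apply: nondecreasing_is_cvgn.
    by apply/nondecreasing_seqP => n; rewrite /series/= big_nat_recr//= lerDl.
  by exists (C / `|e 0%N|) => _ [n _ <-]; rewrite /series/= big_mkord.
have /cvgrPdist_le/(_ r r0)[n _ nP] := cvg_series_cvg_0 cs.
exists n => k nk; have := nP k nk.
by rewrite /= sub0r normrN normr_id.
Qed.

(** A gliding hump argument. Later functions are small at the earlier points by pointwise
    convergence. Earlier functions are small at the later points because these are chosen near [t],
    where the functions are kept below [r / 2]; the induction carries this as an extra clause. *)
Lemma almost_diagonal (eta r : R) t (K : nat) : 0 < r -> r <= eta ->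
  (forall (d : R) N, 0 < d ->
     exists k s, [/\ (N <= k)%N, `|pos s - pos t| <= d & eta < `|u k s|]) ->
  exists (k : nat -> nat) (s : nat -> U), (forall i, (i < K)%N -> eta < `|u (k i) (s i)|) /\
    forall i j, (i < K)%N -> (j < K)%N -> i != j -> `|u (k i) (s j)| <= r.
Proof.
move=> r0 re bad; have r2 : 0 < r / 2 by rewrite divr_gt0.
suff [k [s [h1 h2 _]]] : exists (k : nat -> nat) (s : nat -> U),
    [/\ forall i, (i < K)%N -> eta < `|u (k i) (s i)|,
      forall i j, (i < K)%N -> (j < K)%N -> i != j -> `|u (k i) (s j)| <= r
    & forall i, (i < K)%N -> `|u (k i) t| <= r / 2] by exists k, s.
elim: K => [|K [k [s [h1 h2 h3]]]]; first by exists (fun=> 0%N), (fun=> t).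
have [d d0 dP] : exists2 d : R, 0 < d & forall i, (i < K)%N -> forall s,
    `|pos s - pos t| <= d -> `|u (k i) s| <= r.
  elim: K {h1 h2} h3 => [|K IH] h3; first by exists 1.
  have [d d0 dP] := IH (fun i iK => h3 i (ltnW iK)).
  have [d' d'0 d'P] := VX0_uniform_continuous (u (k K)) r2.
  exists (Num.min d d'); first by rewrite lt_min d0.
  move=> i; rewrite ltnS leq_eqVlt => /predU1P[->|iK] s'; rewrite le_min => /andP[sd sd'].
    have := d'P _ _ sd'; have := h3 K (ltnSn K).
    have := ler_normD (u (k K) s' - u (k K) t) (u (k K) t); rewrite subrK; lra.
  exact: dP.
have [N NP] : exists N, forall l, (N <= l)%N -> forall j, (j < K)%N -> `|u l (s j)| <= r.
  elim: K {h1 h2 h3 dP} => [|K [N NP]]; first by exists 0%N.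
  have [N' N'P] := wuc_pointwise (s K) r0; exists (maxn N N') => l.
  rewrite geq_max => /andP[Nl N'l] j; rewrite ltnS leq_eqVlt => /predU1P[->|jK].
    exact: N'P.
  exact: NP.
have [N' N'P] := wuc_pointwise t r2.
have [l [s' [ls ds us]]] := bad d (maxn N N') d0.
move: ls; rewrite geq_max => /andP[Nl N'l].
exists (fun i => if (i < K)%N then k i else l), (fun i => if (i < K)%N then s i else s').
split.
- move=> i; rewrite ltnS; case: ltnP => // iK _; exact: h1.
- move=> i j; rewrite !ltnS; case: ltnP => iK iK'; case: ltnP => jK jK' ij.
  + exact: h2.
  + exact: dP.
  + exact: NP.
  + by exfalso; move/eqP: ij; lia.
- move=> i; rewrite ltnS; case: ltnP => iK _; [exact: h3 | exact: N'P].
Qed.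

(* Alternating signs along the increasing enumeration of the points [s i] produce
   a bounded element whose consecutive increments all exceed [eta]. *)
Lemma wuc_uniform (eta : R) : 0 < eta -> exists n, forall k, (n <= k)%N ->
  forall t, `|u k t| <= eta.
Proof.
move=> eta0; apply: contrapT => hno.
have /choice[kt ktP] : forall n, exists kt : nat * U, (n <= kt.1)%N /\ eta < `|u kt.1 kt.2|.
  move=> n; apply: contrapT => hn; apply: hno; exists n => k nk t.
  by rewrite leNgt; apply/negP => h; apply: hn; exists (k, t).
have [W [PW Woo Wlim]] := @ex_free_ultrafilter R.
have [|l lP] := Wlim (fun n => pos (kt n).2) 1.
  by move=> n; have /andP[h0 h1] := unit_itv_bounds (kt n).2; rewrite ger0_norm.
have l01 : 0 <= l <= 1.
  apply/andP; split; apply/ler_addgt0Pl => r r0; have [n /= h] := filter_ex (lP r r0);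
  have /andP[h0 h1] := unit_itv_bounds (kt n).2; move: h; rewrite ltr_norml => /andP[]; lra.
pose t : U := clamp l; have tE : pos t = l by rewrite pos_clamp.
have bad (d : R) N : 0 < d ->
    exists k s, [/\ (N <= k)%N, `|pos s - pos t| <= d & eta < `|u k s|].
  move=> d0; have [n [/= h1 h2]] := filter_ex (filterI (lP _ d0) (Woo N)).
  have [h3 h4] := ktP n; exists (kt n).1, (kt n).2; split=> //; first exact: leq_trans h3.
  by rewrite tE ltW.
have [n nP] := fundamental_unbounded e reflX (C / eta).
pose K := n.+1; have K0 : 0 < K%:R :> R by rewrite ltr0n.
(* The off-diagonal values at any one point then add up to at most [eta / 4]. *)
pose r := eta / (4 * K%:R).
have r0 : 0 < r by rewrite divr_gt0// mulr_gt0.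
have re : r < eta.
  by rewrite /r ltr_pdivrMr ?mulr_gt0// ltr_pMr// -natrM ltr1n /K; lia.
have [k [s [diag off]]] := almost_diagonal K r0 (ltW re) bad.
pose ord := sort (fun i j => pos (s i) <= pos (s j)) (iota 0 K).
have ord_perm : perm_eq ord (iota 0 K) by rewrite perm_sort.
have ord_size : size ord = K by rewrite size_sort size_iota.
have ord_sorted : sorted (fun i j => pos (s i) <= pos (s j)) ord.
  by apply: sort_sorted => i j; exact: le_total.
pose o i := nth 0%N ord i.
have oK i : (i < K)%N -> (o i < K)%N.
  move=> iK; have : o i \in ord by rewrite mem_nth// ord_size.
  by rewrite (perm_mem ord_perm) mem_iota.
have o_inj i j : (i < K)%N -> (j < K)%N -> o i = o j -> i = j.
  move=> iK jK /eqP; rewrite /o nth_uniq ?ord_size// ?(perm_uniq ord_perm) ?iota_uniq//.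
  by move/eqP.
have o_sorted i : (i.+1 < K)%N -> ule (s (o i)) (s (o i.+1)).
  move=> iK; rewrite /ule.
  have tr : transitive (fun i j => pos (s i) <= pos (s j)) by move=> a b c'; exact: le_trans.
  by apply: (sorted_ltn_nth tr 0%N ord_sorted); rewrite ?inE ?ord_size// ltnW.
pose k' i := k (o i); pose s' i := s (o i).
have diag' i : (i < K)%N -> eta < `|u (k' i) (s' i)| by move=> iK; apply: diag; exact: oK.
have off' i j : (i < K)%N -> (j < K)%N -> i != j -> `|u (k' i) (s' j)| <= r.
  move=> iK jK ij; apply: off; try exact: oK.
  by apply: contra ij => /eqP/(o_inj i j iK jK)/eqP.
have k'_inj i j : (i < K)%N -> (j < K)%N -> k' i = k' j -> i = j.
  move=> iK jK kk; apply/eqP; apply: contraT => ij; have := off' i j iK jK ij.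
  by rewrite kk leNgt (lt_trans re)// diag'.
pose sg i : R := (-1) ^+ i * Num.sg (u (k' i) (s' i)).
have sg1 i : `|sg i| <= 1.
  by rewrite normrM normrX normrN1 expr1n mul1r normr_sg; case: (_ == 0); rewrite //= ler01.
pose N := (\max_(i < K) k' i).+1.
(* The coefficients are regrouped by the index of [u]. Since [k'] is injective, each [a l] has at
   most one non-zero term, as the bound [u_wuc] demands. *)
pose a (l : nat) : R := \sum_(i < K) (k' i == l)%:R * sg i.
have a1 l' : `|a l'| <= 1.
  have [/existsP[i /eqP il]|/existsPn hn] := boolP [exists i : 'I_K, k' i == l'].
    rewrite /a (bigD1 i)//= il eqxx mul1r big1 ?addr0// => j ji.
    rewrite -il; case: eqP => [/k'_inj E|_]; last by rewrite mul0r.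
    by move: ji; rewrite (val_inj (E (ltn_ord j) (ltn_ord i))) eqxx.
  by rewrite /a big1 ?normr0// => i _; rewrite (negbTE (hn i)) mul0r.
pose g : V := \sum_(i < K) sg i *: u (k' i).
have gC : `|g| <= C.
  have -> : g = \sum_(l' < N) a l' *: u l'; last exact: u_wuc.
  rewrite /a; under eq_bigr do rewrite scaler_suml.
  rewrite exchange_big/=; apply: eq_bigr => i _.
  have kN : (k' i < N)%N by rewrite ltnS; exact: (leq_bigmax i).
  rewrite (bigD1 (Ordinal kN))//= eqxx mul1r big1 ?addr0// => j.
  by rewrite -val_eqE/= eq_sym => /negPf ->; rewrite mul0r scale0r.
have g_val i : (i < K)%N -> `|g (s' i) - (-1) ^+ i * `|u (k' i) (s' i)| | <= eta / 4.
  move=> iK; rewrite /g VX0_sumE (bigD1 (Ordinal iK)) // VX0_scaleE.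
  have -> : sg i * u (k' i) (s' i) = (-1) ^+ i * `|u (k' i) (s' i)|.
    by rewrite /sg -mulrA -normrEsg.
  rewrite addrAC subrr add0r; apply: le_trans (ler_norm_sum _ _ _) _.
  apply: (@le_trans _ _ (\sum_(j < K) r)).
    rewrite [leRHS](bigD1 (Ordinal iK)) //; apply: ler_wpDl; first exact: ltW.
    apply: ler_sum => j ji; rewrite VX0_scaleE normrM.
    apply: (@le_trans _ _ (1 * r)); last by rewrite mul1r.
    by apply: ler_pM => //; apply: off'.
  rewrite sumr_const card_ord -[_ *+ K]mulr_natl /r le_eqVlt; apply/orP; left; apply/eqP.
  by field; rewrite gt_eqF.
(* The main terms have opposite signs and sizes above [eta]; the two errors take away at most
   [eta / 2] of a difference above [2 * eta]. *)
have jump i : (i.+1 < K)%N -> eta <= `|g (s' i.+1) - g (s' i)|.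
  move=> iK; have := g_val i (ltnW iK); have := g_val i.+1 iK.
  have := diag' i (ltnW iK); have := diag' i.+1 iK.
  rewrite exprS; set x := `|u _ _|; set y := `|u _ (s' i)|; set G := g _; set H := g _.
  rewrite -signr_odd; case: (odd i);
    rewrite ?expr1 ?expr0 !ler_norml => hx hy /andP[h1 h2] /andP[h3 h4].
    by rewrite ler_normr; apply/orP; left; lra.
  by rewrite ler_normr; apply/orP; right; lra.
have fam : interval_family [seq (s' i, s' i.+1) | i <- iota 0 n].
  rewrite -cells_iota; apply: family_cells; apply: path_iota => i.
  by rewrite add0n => /andP[_ iN]; exact: o_sorted.
have := le_trans (VX0_fnrm_le g fam) gC; rewrite /fnrm -map_comp => h.
have : eta * fundamental e n <= C.
  apply: le_trans h; rewrite /fundamental -{1}(gtr0_norm eta0).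
  have -> : nseq n (1 : R) = [seq 1 | i <- iota 0 n] by rewrite map_cst size_iota.
  rewrite -nrm_mapZ; apply: nrm_map_le => i; rewrite mem_iota add0n /= => iN.
  by rewrite mulr1 gtr0_norm//; exact: jump.
by rewrite mulrC -ler_pdivlMr// leNgt nP.
Qed.

End weakly_unconditionally_cauchy.

Section c0_unit.
Context {R : realType}.

Lemma c0_unit_subproof n : (fun i : nat => (i == n)%:R : R^o) \in @c0_pred R.
Proof.
apply/mem_set; apply: cvg_near_cst; exists n.+1 => // i /= ni.
by rewrite gtn_eqF.
Qed.

Definition c0_unit n : c0 R := C0 (c0_unit_subproof n).

Lemma c0_unitE n i : c0_unit n i = (i == n)%:R. Proof. by []. Qed.

Lemma c0_norm_le (u : c0 R) (s : R) : (forall i, `|u i| <= s) -> `|u| <= s.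
Proof. by move=> us; apply: (sup_range_le 0%N). Qed.

Lemma c0_sumE n (a : nat -> R) (v : nat -> c0 R) i :
  (\sum_(k < n) a k *: v k : c0 R) i = \sum_(k < n) a k * v k i.
Proof.
elim: n => [|n IH]; first by rewrite !big_ord0.
by rewrite !big_ord_recr/= -IH.
Qed.

End c0_unit.

(** * A continuous weak* limit outside the subspace *)

Section copy_to_weak_star.
Context {R : realType} {X : normedModType R} (e : symmetric_basis X).
Local Notation U := (unit_itv R).
Local Notation V := (VX0 e).
Hypothesis reflX : reflexive_space X.
Variables (Y : set V) (T : {linear c0 R -> V}) (c C : R).
Hypothesis TY : range T `<=` Y.
Hypothesis c_gt0 : 0 < c.
Hypothesis cTC : forall u, c * `|u| <= `|T u| <= C * `|u|.

Let C0 : 0 <= C.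
Proof.
have /andP[h1 h2] := cTC (c0_unit 0).
have u0 : 0 < `|c0_unit 0 : c0 R|.
  apply: lt_le_trans (c0_le (c0_unit 0) 0); by rewrite c0_unitE eqxx normr1.
by rewrite -(pmulr_lge0 C u0); apply: le_trans h2.
Qed.

Lemma copy_wuc (a : nat -> R) n : (forall i, `|a i| <= 1) ->
  `|\sum_(i < n) a i *: T (c0_unit i)| <= C.
Proof.
move=> a1; have -> : \sum_(i < n) a i *: T (c0_unit i) = T (\sum_(i < n) a i *: c0_unit i).
  by rewrite linear_sum; apply: eq_bigr => i _; rewrite linearZ.
have /andP[_ h] := cTC (\sum_(i < n) a i *: c0_unit i).
apply: le_trans h _; rewrite ler_piMr//; apply: c0_norm_le => i; rewrite c0_sumE.
have [ilt|ige] := ltnP i n.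
  under eq_bigr do rewrite c0_unitE.
  rewrite (bigD1 (Ordinal ilt))//= eqxx mulr1 big1 ?addr0// => k.
  by rewrite -val_eqE/= eq_sym => /negPf ->; rewrite mulr0.
rewrite big1 ?normr0// => k _; rewrite c0_unitE.
by rewrite gtn_eqF ?mulr0// (leq_trans (ltn_ord k)).
Qed.

Lemma copy_subsequence : exists m : nat -> nat, (forall k, (m k < m k.+1)%N) /\
  forall k t, `|T (c0_unit (m k)) t| <= 2 ^- k.
Proof.
have p0 k : 0 < 2 ^- k :> R by rewrite invr_gt0 exprn_gt0.
have /choice[N NP] : forall k, exists n, forall j, (n <= j)%N -> forall t,
    `|T (c0_unit j) t| <= 2 ^- k.
  by move=> k; exact: (wuc_uniform reflX copy_wuc (p0 k)).
pose m := fix m k := if k is k'.+1 then maxn (m k').+1 (N k) else N 0%N.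
exists m; split=> [k|k t]; first exact: leq_maxl.
by apply: NP; case: k => [|k] //=; exact: leq_maxr.
Qed.

Lemma copy_weak_star_closure : (C01 R `&` (weak_star_closure Y `\` @VX0_fun R X e @` Y)) !=set0.
Proof.
have [m [m_lt m_small]] := copy_subsequence.
have m_mono : {homo m : i j / (i < j)%N} by apply: homo_ltn => //; exact: ltn_trans.
have m_inj i j : m i = m j -> i = j.
  by move=> E; have [lt|lt|//] := ltngtP i j; have := m_mono _ _ lt; rewrite E ltnn.
pose w n : c0 R := \sum_(k < n) 1 *: c0_unit (m k).
have wE n i : w n i = \sum_(k < n) (i == m k)%:R.
  rewrite [LHS](@c0_sumE _ n (fun=> 1) (fun k => c0_unit (m k)) i).
  by apply: eq_bigr => k _; rewrite mul1r c0_unitE.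
have wm n j : w n (m j) = (j < n)%:R.
  rewrite wE; have [jn|nj] := ltnP j n.
    rewrite (bigD1 (Ordinal jn))//= eqxx big1 ?addr0// => k.
    by rewrite -val_eqE/= => kj; case: eqP => // /m_inj E; rewrite E eqxx in kj.
  rewrite big1// => k _; case: eqP => // /m_inj E.
  by move: (ltn_ord k); rewrite -E ltnNge nj.
have w1 n : `|w n| <= 1.
  apply: c0_norm_le => i.
  have [/existsP[k /eqP ->]|/existsPn h] := boolP [exists k : 'I_n, i == m k].
    by rewrite wm ltn_ord normr1.
  by rewrite wE big1 ?normr0// => k _; rewrite (negbTE (h k)).
pose S n := T (w n).
have SC n : `|S n| <= C.
  by have /andP[_ h] := cTC (w n); apply: le_trans h _; rewrite ler_piMr.
have SE n t : S n t = \sum_(k < n) T (c0_unit (m k)) t.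
  rewrite /S /w linear_sum VX0_sumE; apply: eq_bigr => k _.
  by rewrite scale1r.
have geo i n t : `|S (i + n)%N t - S i t| <= 2 * 2 ^- i.
  rewrite !SE -!(big_mkord xpredT (fun k => T (c0_unit (m k)) t)).
  rewrite (@big_cat_nat _ _ _ i 0 (i + n))//= ?leq_addr// addrAC subrr add0r.
  suff : `|\sum_(i <= k < i + n) T (c0_unit (m k)) t| <= 2 * (2 ^- i - 2 ^- (i + n)).
    have : 0 < 2 ^- (i + n) :> R by rewrite invr_gt0 exprn_gt0.
    lra.
  elim: n => [|n IH]; first by rewrite addn0 big_geq// subrr mulr0 normr0.
  rewrite addnS big_nat_recr ?leq_addr//=; apply: le_trans (ler_normD _ _) _.
  have := m_small (i + n)%N t; have -> : 2 ^- (i + n) = 2 * 2 ^- (i + n).+1 :> R.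
    by rewrite exprS invfM mulrA divff ?mul1r.
  move: IH; have -> : 2 ^- (i + n) = 2 * 2 ^- (i + n).+1 :> R.
    by rewrite exprS invfM mulrA divff ?mul1r.
  lra.
have pow_small (eta : R) : 0 < eta -> exists n, forall k, (n <= k)%N -> 2 * 2 ^- k <= eta.
  move=> eta0; have e2 : 0 < eta / 2 by rewrite divr_gt0.
  have := @near_infty_natSinv_expn_lt R (PosNum e2) => -[n _ nP].
  exists n => k nk; have := nP k nk; rewrite /= div1r => /ltW.
  by rewrite ler_pdivlMr// mulrC.
have [F [Flim Fcl]] := bounded_bidual_cluster SC.
pose f : U -> R^o := bidual_fun F.
have Sf i t : `|S i t - f t| <= 2 * 2 ^- i.
  have cS : (fun n => S n t : R) @ \oo --> (f t : R).
    have : cvgn (fun n => S n t : R).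
      apply/cauchy_cvgP/cauchy_exP => r r0; have r2 : 0 < r / 2 by rewrite divr_gt0.
      have [N NP] := pow_small _ r2; exists (S N t); exists N => // n /= Nn.
      rewrite /ball/= distrC -(subnKC Nn); apply: le_lt_trans (geo _ _ _) _.
      by apply: le_lt_trans (NP N (leqnn N)) _; rewrite ltr_pdivrMr// ltr_pMr// ltr1n.
    move=> /cvg_ex[l lP]; rewrite (_ : f t = l)//.
    by apply: (Flim (eval_at e t)).
  apply/ler_addgt0Pr => r r0.
  have [N _ NP] := (cvgrPdistC_lt _ _).1 cS r r0.
  have h1 := NP _ (leq_addl i N); have h2 := geo i N t.
  have -> : S i t - f t = - (S (i + N)%N t - S i t) + (S (i + N)%N t - f t) by ring.
  apply: le_trans (ler_normD _ _) _; rewrite normrN.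
  by move: h1 => /= /ltW; lra.
have f_uc (eta : R) : 0 < eta -> exists2 d, 0 < d &
    forall u v, `|pos u - pos v| <= d -> `|f u - f v| <= eta.
  move=> eta0; have e3 : 0 < eta / 3 by rewrite divr_gt0.
  have [N NP] := pow_small _ e3; have [d d0 dP] := VX0_uniform_continuous (S N) e3.
  exists d => // u v uv; have := dP u v uv; have := NP N (leqnn N).
  have := Sf N u; have := Sf N v.
  have -> : f u - f v = (S N v - f v) - (S N u - f u) + (S N u - S N v) by ring.
  move=> h1 h2 h3 h4; apply: le_trans (ler_normD _ _) _.
  have := ler_normB (S N v - f v) (S N u - f u); lra.
exists f; split; first exact/C01P.
split; first by exists F => //; apply: Fcl => n; apply: TY; exists (w n).
move=> [y Yy yf].
have hB k : `|S k - y| <= C + `|y| by rewrite (le_trans (ler_normB _ _))// lerD2r.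
have h0 (eta : R) : 0 < eta -> exists n, forall k, (n <= k)%N -> forall u, `|(S k - y) u| <= eta.
  move=> /pow_small[n nP]; exists n => k nk u; rewrite VX0_addE VX0_oppE.
  by have := Sf k u; rewrite -yf => /le_trans; apply; exact: nP.
have c4 : 0 < c / 4 by rewrite divr_gt0.
have [a [M [wa aP]]] := unif_null_convex reflX hB h0 0%N c4.
(* The second average starts at [M + 1], past the first. At the coordinate [m M] all terms of the
   first vanish and all those of the second are 1, so [v] has norm at least 1 in c_0, whereas [T v]
   has norm at most [c / 2]. *)
have [a' [M' [wa' aP']]] := unif_null_convex reflX hB h0 M.+1 c4.
pose v : c0 R := \sum_(k < M) a k *: w k - \sum_(k < M') a' k *: w k.
have vM : v (m M) = -1.
  have -> : v (m M) = (\sum_(k < M) a k *: w k : c0 R) (m M) -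
      (\sum_(k < M') a' k *: w k : c0 R) (m M).
    by [].
  rewrite !c0_sumE [X in X - _]big1 ?sub0r; last first.
    by move=> k _; rewrite wm ltnNge ltnW// mulr0.
  congr (- _); have [a0 az a1] := wa'; rewrite -a1; apply: eq_bigr => k _; rewrite wm.
  have [Mk|kM] := ltnP M k; first by rewrite mulr1.
  by rewrite az ?mul0r// ltnNge kM.
have v1 : 1 <= `|v| by have := c0_le v (m M); rewrite vM normrN1.
have Tv : T v = \sum_(k < M) a k *: (S k - y) - \sum_(k < M') a' k *: (S k - y).
  have E b L L' : weights b L L' ->
      \sum_(k < L') b k *: (S k - y) = T (\sum_(k < L') b k *: w k) - y.
    move=> [_ _ b1]; under eq_bigr do rewrite scalerBr.
    rewrite sumrB -scaler_suml b1 scale1r linear_sum; congr (_ - _).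
    by apply: eq_bigr => k _; rewrite linearZ.
  by rewrite (E _ _ _ wa) (E _ _ _ wa') /v linearB opprB subrKA.
have /andP[h _] := cTC v.
have : `|T v| <= c / 4 + c / 4.
  by rewrite Tv (le_trans (ler_normB _ _))// lerD.
have : c * 1 <= c * `|v| by rewrite ler_pM2l.
lra.
Qed.

End copy_to_weak_star.

Theorem theoremG (R : realType) (X : completeNormedModType R)
    (reflX : reflexive_space X) (e : symmetric_basis X)
    (Y : set (VX0 e)) (subY : closed_subspace Y) :
  contains_copy (c0 R) Y <->
  (C01 R `&` (weak_star_closure Y `\` @VX0_fun R X e @` Y)) !=set0.
Proof.
split=> [[T [TY [c [C [c0 cTC]]]]]|].
  exact (@copy_weak_star_closure _ _ _ reflX Y T c C TY c0 cTC).
move=> [f [/C01P f_uc [[F clF Ff] fY]]]; rewrite -{f}Ff in f_uc fY *.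
have FY (phi : dual (VX0 e)) : (forall y, Y y -> phi y = 0) -> F phi = 0.
  exact: weak_star_closure_annihilator clF.
have [M appr] := approx_in_subspace reflX subY FY f_uc.
have [fV|fV] := boolP (bidual_fun F \in VX0_pred e); last first.
  exact (c0_from_blocks reflX subY (bidual_fun0 F) (bidual_fun_alpha_le F) f_uc appr fV).
exfalso; apply: fY; exists (MkVX0 fV) => //.
exact: (@in_closed_subspace _ _ _ reflX _ subY (MkVX0 fV) M appr).
Qed.
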